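(* Let $T(k_\infty)=\mathbb{I}+\sum_{n\ge 1}\frac{(-1)^n}{n!}\,a^\dagger_{n\ldots 1}\,T^{(n)}_{\infty 1\ldots n}\,a_{1\ldots n}$ be a vertex operator associated to the ZF algebra $\mathcal{A}_R$. Then $T$ is well-bred if and only if its coefficients $T^{(n)}_{\infty 1\ldots n}$ are defined by the following inductive expressions: $$T^{(1)}_{\infty 0}=\mathbb{I}-R_{\infty 0},$$ and, for all $n\ge 1$, $$T^{(n+1)}_{\infty 01\ldots n}=\frac{1}{n+1}\sum_{i=0}^{n}\big(\mathcal{R}^{01\ldots n}_{p_i}\big)^{-1}\,T^{(n)}_{\infty 2\ldots i,0,i+1,\ldots,n}\,\mathcal{R}^{01\ldots n}_{p_i}\;-\;\frac{1}{(n+1)!}\sum_{\sigma\in\mathcal{S}_{n+1}}\big(\mathcal{R}^{01\ldots n}_{p_n\circ\sigma}\big)^{-1}R_{\infty\sigma(0)}\,T^{(n)}_{\infty\sigma(1)\ldots\sigma(n)}\,\mathcal{R}^{01\ldots n}_{p_n\circ\sigma},$$ where $T^{(n)}_{\infty 2\ldots i,0,i+1,\ldots,n}$ for $i=0$ stands for $T^{(n)}_{\infty 1\ldots n}$, and $p_j\in\mathcal{S}_{n+1}$ is defined by $p_j:(0,1,\ldots,j-1,j,j+1,\ldots,n)\to(1,2,\ldots,j,0,j+1,\ldots,n)$ for $1\le j\le n$ and $p_0=\mathrm{id}$.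
   Context: **R-matrix and ZF algebra.** Fix $N\ge 1$, $V=\mathbb{C}^N$ with canonical basis $e_i$ (columns), dual row vectors $e_i^\dagger$, elementary matrices $E_{ij}$. $R(k_1,k_2)\in\mathrm{End}(V\otimes V)$ depends on spectral parameters (real numbers). For labels $a\ne b$ of copies of $V$, $R_{ab}:=R_{ab}(k_a,k_b)$ acts on copies $a$ (first factor) and $b$ (second factor). It is assumed that $R_{12}R_{13}R_{23}=R_{23}R_{13}R_{12}$ (Yang-Baxter) and $R_{12}R_{21}=\mathbb{I}$ (unitarity), with $R_{21}=R_{21}(k_2,k_1)$. $\mathcal{A}_R$ is the unital algebra generated by $a_i(k),a_i^\dagger(k)$ ($1\le i\le N$) with relations $a_1a_2=R_{21}a_2a_1$, $a_1^\dagger a_2^\dagger=a_2^\dagger a_1^\dagger R_{21}$, $a_1a_2^\dagger=a_2^\dagger R_{12}a_1+\delta_{12}$, where $a_b=\sum_i a_i(k_b)e_i$ and $a^\dagger_b=\sum_i a_i^\dagger(k_b)e_i^\dagger$ in copy $b$ of $V$, and $\delta_{12}=\delta(k_1-k_2)\sum_i e_i\otimes e_i^\dagger$. Infinite formal normally ordered series ($a^\dagger$'s left of $a$'s, integrated over spectral parameters) are allowed as elements of $\mathcal{A}_R$. **Vertex operators.** A vertex operator is an $N\times N$ matrix $T_\infty=T(k_\infty)=\sum T^{ij}(k_\infty)E_{ij}$ with entries in $\mathcal{A}_R$, of the form $T(k_\infty)=\mathbb{I}+\sum_{n\ge1}\frac{(-1)^n}{n!}a^\dagger_{n\ldots1}T^{(n)}_{\infty1\ldots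 n}a_{1\ldots n}$. Here $a_{1\ldots n}=a_1\cdots a_n$, $a^\dagger_{n\ldots1}=a_n^\dagger\cdots a_1^\dagger$, and $T^{(n)}_{\infty1\ldots n}$ is a numerical matrix in $\mathrm{End}(V)^{\otimes(n+1)}$ (copies $\infty,1,\ldots,n$) depending on $k_\infty,k_1,\ldots,k_n$. Indices of spaces $1,\ldots,n$ are summed and $k_1,\ldots,k_n$ are integrated over (dummy); space $\infty$ carries the matrix indices of $T$. $T^{(n)}_{\infty b_1\ldots b_n}$ means spaces and spectral parameters are relabelled accordingly. Coefficients only matter through the operators $a^\dagger_{n\ldots1}T^{(n)}_{\infty1\ldots n}a_{1\ldots n}$: coefficients defining the same operators are identified, and representatives are taken $\mathcal{S}_n$-covariant, i.e. $T^{(n)}_{\infty\sigma(1)\ldots\sigma(n)}=\mathcal{R}^{1\ldots n}_\sigma T^{(n)}_{\infty1\ldots n}(\mathcal{R}^{1\ldots n}_\sigma)^{-1}$ for $\sigma\in\mathcal{S}_n$. **The matrices $\mathcal{R}_\sigma$.** $\mathcal{R}^{1\ldots n}_\sigma$ is the product of $R$-matrices such that the exchange relations give $a_{\sigma(1)\ldots\sigma(n)}=\mathcal{R}^{1\ldots n}_\sigma a_{1\ldots n}$: pass from the word $1\ldots n$ to $\sigma(1)\ldots\sigma(n)$ by adjacent swaps, each swap of adjacent letters $(a,b)\to(b,a)$ multiplying on the left by $R_{ab}$ (independent of choices by Yang-Baxter and unitarity). Same with labels $0,1,\ldots,n$, where $\mathcal{S}_{n+1}$ permutes $\{0,\ldots,n\}$.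 $\mathcal{R}^{\mu(1)\ldots\mu(n)}_\sigma$ is obtained from $\mathcal{R}^{1\ldots n}_\sigma$ by relabelling $i\to\mu(i)$. Composition convention: $(\sigma\circ\mu)(i)=\mu(\sigma(i))$; thus $a_{\sigma(1)\ldots\sigma(n)\sigma(0)}=\mathcal{R}^{01\ldots n}_{p_n\circ\sigma}a_{01\ldots n}$. **Well-bred.** A matrix $L(k)$ with entries in $\mathcal{A}_R$ is well-bred if $L_1a_2=R_{21}a_2L_1$ and $L_1a_2^\dagger=a_2^\dagger R_{12}L_1$. *)

(* Defs.v *)
From HB Require Import structures.
From mathcomp Require Import all_boot all_order all_algebra all_fingroup.
From mathcomp Require Import reals complex.

Set Implicit Arguments.
Unset Strict Implicit.
Unset Printing Implicit Defensive.

Import GRing.Theory.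
Local Open Scope ring_scope.

(* V = C^N.  The copies of V in a tensor product are labelled by a finite type
   [L]; a basis vector of the tensor product is a function [L -> 'I_N], and
   [Op L] is End (V^{(x) L}) as a matrix in this basis.
   The spaces 1..n are labelled by 'I_n (shifted by one), the spaces 0..n by
   'I_n.+1, and the space infinity is the extra point [None] of [option _]. *)
Section Operators.
Variables (K : realType) (N : nat).

Definition Op (L : finType) : Type := 'M[K[i]]_#|{ffun L -> 'I_N}|.

Definition entry (L : finType) (A : Op L) (u v : {ffun L -> 'I_N}) : K[i] :=
  A (enum_rank u) (enum_rank v).

Definition idop (L : finType) : Op L := 1%:M.

(* [place f A]: for injective [f], the operator [A] with its copy [l] put on
   copy [f l], acting as the identity on the other copies. *)
Definition place (L L' : finType) (f : L -> L') (A : Op L) : Op L' :=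
  \matrix_(p, q)
    let u : {ffun L' -> 'I_N} := enum_val p in
    let v : {ffun L' -> 'I_N} := enum_val q in
    if [forall c, (c \notin codom f) ==> (u c == v c)]
    then entry A [ffun l => u (f l)] [ffun l => v (f l)] else 0.

Definition duo (T : Type) (a b : T) (i : 'I_2) : T := if i == ord0 then a else b.

(* [R k1 k2] acts on V (x) V: copy [0 : 'I_2] is the first factor. *)
Definition Rmatrix : Type := K -> K -> Op 'I_2.

Variable R : Rmatrix.

Definition Rent (k1 k2 : K) (i j i' j' : 'I_N) : K[i] :=
  entry (R k1 k2) [ffun l => duo i j l] [ffun l => duo i' j' l].

Definition Rab (L : finType) (k : L -> K) (a b : L) : Op L :=
  place (duo a b) (R (k a) (k b)).

Definition yang_baxter : Prop := forall k : 'I_3 -> K,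
  let R12 := Rab k (inord 0) (inord 1) in
  let R13 := Rab k (inord 0) (inord 2) in
  let R23 := Rab k (inord 1) (inord 2) in
  R12 *m R13 *m R23 = R23 *m R13 *m R12.

Definition unitarity : Prop := forall k : 'I_2 -> K,
  Rab k (inord 0) (inord 1) *m Rab k (inord 1) (inord 0) = idop _.

(* The product of R-matrices [M] with a_s = M a_w, for words [w], [s] in the
   same distinct labels: the first letter [a] of [s] is brought to the front of
   [w] by adjacent swaps, then the tails are treated recursively.
   See [exchange_reorder] below. *)
Fixpoint exchange (L : finType) (k : L -> K) (w s : seq L) : Op L :=
  if s is a :: s' then
    exchange k (rem a w) s' *m
      \big[mulmx/idop L]_(b <- take (index a w) w) Rab k b a
  else idop L.

Inductive reorder (L : finType) (k : L -> K) (w : seq L) :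
    seq L -> Op L -> Prop :=
| reorder_refl : reorder k w w (idop L)
| reorder_swap u a b v M : reorder k w (u ++ a :: b :: v) M ->
    reorder k w (u ++ b :: a :: v) (Rab k a b *m M).

Lemma reorder_front (L : finType) (k : L -> K) w p a x y M :
  reorder k w (p ++ x ++ a :: y) M ->
  reorder k w (p ++ a :: x ++ y)
    ((\big[mulmx/idop L]_(b <- x) Rab k b a) *m M).
Proof.
elim: x p M => [|b x IHx] p M /= H; first by rewrite big_nil mul1mx.
rewrite big_cons -mulmxA; apply: reorder_swap.
have := IHx (rcons p b) M; rewrite !cat_rcons; exact.
Qed.

Lemma exchange_reorder (L : finType) (k : L -> K) (w s : seq L) :
  perm_eq w s -> reorder k w s (exchange k w s).
Proof.
suff H t p M : perm_eq t s -> reorder k w (p ++ t) M ->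
    reorder k w (p ++ s) (exchange k t s *m M).
  by move=> ws; rewrite -[exchange _ _ _]mulmx1; apply: (H w [::] _ ws);
    exact: reorder_refl.
elim: s t p M => [|a s IHs] t p M Hts H.
  by move/perm_nilP: Hts H => -> H; rewrite mul1mx.
have Ha : a \in t by rewrite (perm_mem Hts) mem_head.
have Ht : t = take (index a t) t ++ a :: drop (index a t).+1 t.
  by rewrite -{1}(cat_take_drop (index a t) t) (drop_nth a) ?index_mem //
    nth_index.
have Hp : perm_eq (rem a t) s.
  by rewrite -(perm_cons a) -(permPr Hts) perm_sym perm_to_rem.
rewrite /= -mulmxA -cat_rcons; apply: IHs => //.
by rewrite remE cat_rcons; apply: reorder_front; rewrite -Ht.
Qed.

Definition Rsigma (n : nat) (k : option 'I_n -> K) (s : 'S_n) : Op (option 'I_n) :=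
  exchange k [seq Some i | i <- enum 'I_n] [seq Some (s i) | i <- enum 'I_n].

(* [coef n]: the matrices T^{(n)}_{oo 1..n}, functions of k_oo, k_1, ..., k_n. *)
Definition coef (n : nat) : Type := (option 'I_n -> K) -> Op (option 'I_n).

(* T^{(n)}_{oo b_1 .. b_n} as an operator on the spaces oo, 1, ..., m. *)
Definition Tplace (n m : nat) (T : coef n) (b : 'I_n -> 'I_m)
    (k : option 'I_m -> K) : Op (option 'I_m) :=
  place (omap b) (T (k \o omap b)).

Definition covariant (n : nat) (T : coef n) : Prop :=
  forall (s : 'S_n) (k : option 'I_n -> K),
    Tplace T s k = Rsigma k s *m T k *m invmx (Rsigma k s).

(* p_j sends 0..n to 1, 2, .., j, 0, j+1, .., n. *)
Definition pperm (n : nat) (j : 'I_n.+1) : 'S_n.+1 := lift_perm j ord0 1%g.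

(* T^{(n)}_{oo s(1) .. s(n)} for s a permutation of 0..n. *)
Definition Ttail (n : nat) (T : coef n) (s : 'S_n.+1) : coef n.+1 :=
  Tplace T (fun j => s (lift ord0 j)).

Definition vertex_coef1 : coef 1 :=
  fun k => idop _ - Rab k None (Some ord0).

(* (sigma o mu)(i) = mu (sigma i) is the product [(sigma * mu)%g] of perm.v. *)
Definition vertex_coefS (n : nat) (T : coef n) : coef n.+1 := fun k =>
  n.+1%:R^-1 *: (\sum_(i < n.+1)
      invmx (Rsigma k (pperm i)) *m Ttail T (pperm i) k *m Rsigma k (pperm i))
  - (n.+1)`!%:R^-1 *: (\sum_(s : 'S_n.+1)
      let P := Rsigma k (pperm ord_max * s)%g in
      invmx P *m Rab k None (Some (s ord0)) *m Ttail T s k *m P).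

End Operators.

(* The ZF algebra.  Its elements are represented by formal sums of integrated
   words int dk K(k) x_1 ... x_r, where the integration variables are indexed by
   a finite type [X], [K] is a numerical kernel, and each letter x_s is some
   a_i or a_i^dagger whose spectral parameter is either a fixed real number
   ([inl]) or an integration variable ([inr]).  Integrals and delta are formal:
   kernels are arbitrary functions, taken pointwise. *)
Section ZFAlgebra.
Variables (K : realType) (N : nat).

Definition param (X : Type) : Type := (K + X)%type.

Inductive letter (X : Type) : Type :=
| Ann of 'I_N & param X
| Cre of 'I_N & param X.

Definition is_ann (X : Type) (l : letter X) : bool :=
  if l is Ann _ _ then true else false.

Record term : Type := Term {
  tvar : finType;
  tword : seq (letter tvar);
  tker : (tvar -> K) -> K[i] }.

Definition expr : Type := seq term.

Definition pval (X : Type) (k : X -> K) (x : param X) : K :=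
  match x with inl q => q | inr z => k z end.

Definition psubst (X Y : Type) (f : X -> param Y) (x : param X) : param Y :=
  match x with inl q => inl q | inr z => f z end.

Definition lsubst (X Y : Type) (f : X -> param Y) (l : letter X) : letter Y :=
  match l with
  | Ann i x => Ann i (psubst f x)
  | Cre i x => Cre i (psubst f x)
  end.

Definition lrename (X Y : Type) (f : X -> Y) : letter X -> letter Y :=
  lsubst (fun x => inr (f x)).

(* Replace the variable [None] by [z]. *)
Definition elim_var (Y : Type) (z : param Y) (o : option Y) : param Y :=
  if o is Some y then inr y else z.

Definition wide (Y : Type) (z : param Y) : param (option Y) :=
  psubst (fun y => inr (Some y)) z.

Definition elim_term (Y : finType) (z : param Y) (w : seq (letter (option Y)))
    (c : (option Y -> K) -> K[i]) : term :=
  Term [seq lsubst (elim_var z) l | l <- w]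
    (fun k => c (fun o => pval k (elim_var z o))).

(* [dirac x y w c e]: the integrated word with kernel delta(x - y) c and word
   [w] is [e].  An integration variable is eliminated when there is one;
   delta(q - q') = 0 for fixed real numbers q <> q'.  Nothing is prescribed
   for delta(0). *)
Inductive dirac : forall X : finType, param X -> param X ->
    seq (letter X) -> ((X -> K) -> K[i]) -> expr -> Prop :=
| dirac_fixed (X : finType) (q q' : K) (w : seq (letter X)) c :
    q <> q' -> dirac (inl q) (inl q') w c [::]
| dirac_right (Y : finType) (z : param Y) (w : seq (letter (option Y))) c :
    dirac (wide z) (inr None) w c [:: elim_term z w c]
| dirac_left (Y : finType) (z : param Y) (w : seq (letter (option Y))) c :
    dirac (inr None) (wide z) w c [:: elim_term z w c].

Variable R : Rmatrix K N.

(* Equality in A_R: the congruence generated by linearity in the kernel,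
   renaming of dummy variables and the exchange relations, inside arbitrary
   words [u _ v]. *)
Inductive zfeq : expr -> expr -> Prop :=
| zf_refl e : zfeq e e
| zf_sym e f : zfeq e f -> zfeq f e
| zf_trans e f g : zfeq e f -> zfeq f g -> zfeq e g
| zf_cat e e' f f' : zfeq e e' -> zfeq f f' -> zfeq (e ++ f) (e' ++ f')
| zf_catC e f : zfeq (e ++ f) (f ++ e)
| zf_zero (X : finType) (w : seq (letter X)) c :
    (forall k, c k = 0) -> zfeq [:: Term w c] [::]
| zf_add (X : finType) (w : seq (letter X)) c c1 c2 :
    (forall k, c k = c1 k + c2 k) ->
    zfeq [:: Term w c] [:: Term w c1; Term w c2]
| zf_rename (X Y : finType) (f : X -> Y) (w : seq (letter X)) c :
    bijective f ->
    zfeq [:: Term w c]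
         [:: Term [seq lrename f l | l <- w] (fun k => c (k \o f))]
(* a_1 a_2 = R_21 a_2 a_1 *)
| zf_aa (X : finType) (u v : seq (letter X)) (i j : 'I_N) (x y : param X) c :
    zfeq [:: Term (u ++ Ann i x :: Ann j y :: v) c]
         [seq Term (u ++ Ann j' y :: Ann i' x :: v)
                (fun k => Rent R (pval k y) (pval k x) j i j' i' * c k)
         | i' <- enum 'I_N, j' <- enum 'I_N]
(* a^+_1 a^+_2 = a^+_2 a^+_1 R_21 *)
| zf_cc (X : finType) (u v : seq (letter X)) (i j : 'I_N) (x y : param X) c :
    zfeq [:: Term (u ++ Cre i x :: Cre j y :: v) c]
         [seq Term (u ++ Cre j' y :: Cre i' x :: v)
                (fun k => Rent R (pval k y) (pval k x) j' i' j i * c k)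
         | i' <- enum 'I_N, j' <- enum 'I_N]
(* a_1 a^+_2 = a^+_2 R_12 a_1 + delta_12 *)
| zf_ac (X : finType) (u v : seq (letter X)) (i j : 'I_N) (x y : param X) c d :
    dirac x y (u ++ v) c d ->
    zfeq [:: Term (u ++ Ann i x :: Cre j y :: v) c]
         ([seq Term (u ++ Cre j' y :: Ann i' x :: v)
                 (fun k => Rent R (pval k x) (pval k y) i j' i' j * c k)
          | i' <- enum 'I_N, j' <- enum 'I_N]
          ++ if i == j then d else [::]).

Definition tmul (s t : term) : term :=
  Term ([seq lrename inl l | l <- tword s] ++ [seq lrename inr l | l <- tword t])
    (fun k : (tvar s + tvar t)%type -> K =>
       @tker s (fun x => k (inl x)) * @tker t (fun y => k (inr y))).

Definition emul (e f : expr) : expr := [seq tmul s t | s <- e, t <- f].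

Definition escale (c : K[i]) (e : expr) : expr :=
  [seq Term (tword t) (fun k => c * @tker t k) | t <- e].

Definition econst (c : K[i]) : expr := [:: @Term void [::] (fun=> c)].
Definition ann (i : 'I_N) (q : K) : expr :=
  [:: @Term void [:: Ann i (inl q)] (fun=> 1)].
Definition cre (i : 'I_N) (q : K) : expr :=
  [:: @Term void [:: Cre i (inl q)] (fun=> 1)].

(* Infinite formal sums sum_n S n live in the completion of A_R for the left
   ideals spanned by the words ending with [p] annihilation letters. *)
Definition fseries : Type := nat -> expr.

Definition in_ideal (p : nat) (e : expr) : bool :=
  all (fun t => (p <= size (tword t))%N &&
                all (@is_ann _) (take p (rev (tword t)))) e.

Definition psum (S : fseries) (M : nat) : expr := flatten [seq S n | n <- iota 0 M].

Definition fseries_eq (S S' : fseries) : Prop :=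
  forall p, exists M0, forall M, (M0 <= M)%N ->
    exists e e', [/\ in_ideal p e, in_ideal p e' &
      zfeq (psum S M ++ e) (psum S' M ++ e')].

Definition well_bred (L : K -> 'I_N -> 'I_N -> fseries) : Prop :=
  (forall (k1 k2 : K) (i j l : 'I_N),
     fseries_eq (fun n => emul (L k1 i j n) (ann l k2))
       (fun n => flatten
          [seq escale (Rent R k2 k1 l i l' i') (emul (ann l' k2) (L k1 i' j n))
          | i' <- enum 'I_N, l' <- enum 'I_N]))
  /\
  (forall (k1 k2 : K) (i j l : 'I_N),
     fseries_eq (fun n => emul (L k1 i j n) (cre l k2))
       (fun n => flatten
          [seq escale (Rent R k1 k2 i l' i' l) (emul (cre l' k2) (L k1 i' j n))
          | i' <- enum 'I_N, l' <- enum 'I_N])).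

Definition with_oo (T : Type) (n : nat) (t : T) (f : 'I_n -> T)
  (o : option 'I_n) : T := if o is Some a then f a else t.

(* The (i, j) entry in space oo of a^+_{n..1} T_{oo 1..n} a_{1..n}. *)
Definition sandwich (n : nat) (T : coef K N n) (koo : K) (i j : 'I_N) : expr :=
  [seq Term
     (rev [seq Cre (u a) (inr a) | a <- enum 'I_n]
        ++ [seq Ann (v a) (inr a) | a <- enum 'I_n])
     (fun k => entry (T (with_oo koo k)) [ffun o => with_oo i u o]
                                         [ffun o => with_oo j v o])
  | u : {ffun 'I_n -> 'I_N} <- enum {ffun 'I_n -> 'I_N},
    v : {ffun 'I_n -> 'I_N} <- enum {ffun 'I_n -> 'I_N}].

Definition same_operator (n : nat) (T T' : coef K N n) : Prop :=
  forall koo i j, zfeq (sandwich T koo i j) (sandwich T' koo i j).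

(* The coefficient [T 0] plays no role: the term of order 0 is the identity. *)
Definition vertex (T : forall n, coef K N n) (koo : K) (i j : 'I_N) : fseries :=
  fun n => if n is 0%N then econst (i == j)%:R
           else escale ((-1) ^+ n / n`!%:R) (sandwich (T n) koo i j).

End ZFAlgebra.

(* Main.v *)
(* On a word of labels put U([]) = 1 and U(b s) = U(s) - m^-1 R_{oo b} U(s) m, where
   m carries b through s, and let U_n be U(1 .. n).  Both sides of the equivalence
   say that T^{(n)} = U_n for all n >= 1.

   By Yang-Baxter, U is covariant under reorderings of the word.  Covariance turns
   every term of the recursion for T^{(n+1)} into the same operator, so that it
   reads U_{n+1}.  When the series with coefficients U_n is multiplied by a_o or
   by a^+_o, the n contractions arising at order n are equal by covariance as well,
   which turns 1/n! into 1/(n-1)!; each of them cancels against order n - 1 and the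
   sums telescope.  The boundary term ends with many annihilators, so it vanishes
   in the completion.

   For uniqueness, A_R acts on a Fock space over finitely many points carrying
   spectral parameters, with integrals replaced by sums over the points and delta
   by Kronecker's symbol.  Distinct points may carry the same parameter, hence
   the matrix elements between n-particle states recover all the entries of a
   covariant kernel, including those at coinciding parameters.  Applying the
   relation L a^+ = a^+ R L to states with n particles determines T^{(n+1)} from
   the lower orders. *)

From HB Require Import structures.
From mathcomp Require Import all_boot all_order all_algebra all_fingroup.
From mathcomp Require Import reals complex boolp generic_quotient ring.
Require Import Defs.

Set Implicit Arguments.
Unset Strict Implicit.
Unset Printing Implicit Defensive.

Import GRing.Theory Num.Theory.
Local Open Scope ring_scope.

(** * Operators on tensor products of labelled copies, entry by entry *)

Section Labelled.
Variables (K : realType) (N : nat).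
Local Notation I := 'I_N.
Local Notation C := K[i].
Local Notation "''V_' L" := {ffun L -> I} (at level 8, L at level 2).

(** The form of U is forced. Normal ordering [T a^+_o] conjugates the kernel of order m by the
    R-matrices of the crossings, while the m+1 contractions of order m+1 subtract the kernel with
    [o] as last letter. Comparing with [a^+_o R_{oo o} T] gives U(s o) as the conjugate of U(s)
    minus [R_{oo o} U(s)]; covariance then moves [o] to the front of the word. The algebra is given
    by a congruence on formal expressions. Equalities follow by computing in the quotient group, but
    concluding anything from an equality requires a model. States there are functions on words, not
    classes of tensors: the creation operator is defined so that the mixed relation holds by
    definition, the relation between creators is proved from Yang-Baxter and unitarity, and the one
    between annihilators holds only on states with the exchange symmetry, which creators must be
    shown to preserve. The set of points must be finite for the sums to make sense. A derivation
    mentions finitely many fixed parameters, so this set is chosen after the derivation. The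
    completion is harmless: a word ending with p annihilators kills every state with fewer than p
    particles. *)

Definition mkop (L : finType) (F : 'V_L -> 'V_L -> C) : Op K N L :=
  \matrix_(p, q) F (enum_val p) (enum_val q).

Lemma entry_mkop (L : finType) (F : 'V_L -> 'V_L -> C) u v :
  entry (mkop F) u v = F u v.
Proof. by rewrite /entry mxE !enum_rankK. Qed.

Lemma op_ext (L : finType) (A B : Op K N L) :
  (forall u v, entry A u v = entry B u v) -> A = B.
Proof.
move=> AB; apply/matrixP => p q.
by have := AB (enum_val p) (enum_val q); rewrite /entry !enum_valK.
Qed.

Lemma entry_mul (L : finType) (A B : Op K N L) u v :
  entry (A *m B) u v = \sum_w entry A u w * entry B w v.
Proof.
rewrite /entry mxE (reindex (@enum_rank _)) //.
by apply: onW_bij; apply: enum_rank_bij.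
Qed.

Lemma entry_id (L : finType) (u v : 'V_L) :
  entry (idop K N L) u v = (u == v)%:R.
Proof. by rewrite /entry mxE (inj_eq enum_rank_inj). Qed.

Lemma entryD (L : finType) (A B : Op K N L) u v :
  entry (A + B) u v = entry A u v + entry B u v.
Proof. by rewrite /entry mxE. Qed.

Lemma entryB (L : finType) (A B : Op K N L) u v :
  entry (A - B) u v = entry A u v - entry B u v.
Proof. by rewrite /entry !mxE. Qed.

Lemma entryZ (L : finType) c (A : Op K N L) u v :
  entry (c *: A) u v = c * entry A u v.
Proof. by rewrite /entry mxE. Qed.

Definition upd (L : finType) (u : 'V_L) (a : L) (x : I) : 'V_L :=
  [ffun c => if c == a then x else u c].

Lemma upd_same (L : finType) (u : 'V_L) a x : upd u a x a = x.
Proof. by rewrite ffunE eqxx. Qed.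

Lemma upd_other (L : finType) (u : 'V_L) a x c : c != a -> upd u a x c = u c.
Proof. by rewrite ffunE => /negbTE ->. Qed.

Lemma upd_id (L : finType) (u : 'V_L) a : upd u a (u a) = u.
Proof. by apply/ffunP => c; rewrite ffunE; case: eqP => // ->. Qed.

Lemma upd_upd (L : finType) (u : 'V_L) a x y : upd (upd u a x) a y = upd u a y.
Proof. by apply/ffunP => c; rewrite !ffunE; case: eqP. Qed.

Lemma updC (L : finType) (u : 'V_L) a b x y : a != b ->
  upd (upd u a x) b y = upd (upd u b y) a x.
Proof.
move=> ab; apply/ffunP => c; rewrite !ffunE.
by case: eqP => [->|//]; rewrite eq_sym (negbTE ab).
Qed.

(** Configurations are grouped by their values away from [a]; the one with value [x0] at [a]
    represents its group. *)
Lemma sum_upd (G : zmodType) (L : finType) (a : L) (x0 : I) (F : 'V_L -> G) :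
  \sum_u F u = \sum_(u : 'V_L | u a == x0) \sum_x F (upd u a x).
Proof.
pose f (u : 'V_L) := upd u a x0.
rewrite (partition_big f (fun u : {ffun L -> I} => u a == x0)) /=; last first.
  by move=> u _; rewrite upd_same.
apply: eq_bigr => u /eqP ua.
rewrite (reindex_onto (fun x => upd u a x) (fun w => w a)) /=; last first.
  by move=> w /eqP <-; rewrite /f upd_upd upd_id.
apply: eq_big => [x|//]; rewrite upd_same eqxx andbT /f upd_upd -ua upd_id.
by rewrite eqxx.
Qed.

Section Merge.
Variables (L L' : finType) (f : L -> L').
Hypothesis f_inj : injective f.

(** With [pull], a bijection between the configurations on [L] and those on [L'] that agree with [u]
    off the image of [f]. *)
Definition glue (u : 'V_L') (x : 'V_L) : 'V_L' :=
  [ffun c => if [pick l | f l == c] is Some l then x l else u c].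

Definition pull (u : 'V_L') : 'V_L := [ffun l => u (f l)].

Definition off (u v : 'V_L') : bool :=
  [forall c, (c \notin codom f) ==> (u c == v c)].

Lemma entry_place A u v :
  entry (place f A) u v =
  if off u v then entry A (pull u) (pull v) else 0 :> C.
Proof. by rewrite /place /entry mxE !enum_rankK. Qed.

Lemma glue_in u x l : glue u x (f l) = x l.
Proof.
rewrite ffunE; case: pickP => [l' /eqP /f_inj -> //|].
by move/(_ l); rewrite eqxx.
Qed.

Lemma glue_out (u : 'V_L') x c : c \notin codom f -> glue u x c = u c.
Proof.
move=> cf; rewrite ffunE; case: pickP => // l /eqP flc.
by rewrite -flc codom_f in cf.
Qed.

Lemma pull_glue u x : pull (glue u x) = x.
Proof. by apply/ffunP => l; rewrite ffunE glue_in. Qed.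

Lemma off_glue u x : off u (glue u x).
Proof. by apply/forallP => c; apply/implyP => cf; rewrite glue_out. Qed.

Lemma offP (u v : 'V_L') : reflect (forall c, c \notin codom f -> u c = v c) (off u v).
Proof.
apply: (iffP forallP) => H c; first by move=> cf; have /implyP/(_ cf)/eqP := H c.
by apply/implyP => /H ->.
Qed.

Lemma glue_pull (u w : 'V_L') : off u w -> glue u (pull w) = w.
Proof.
move=> /offP uw; apply/ffunP => c.
have [/codomP[l ->]|cf] := boolP (c \in codom f); last by rewrite glue_out ?uw.
by rewrite glue_in ffunE.
Qed.

Lemma sum_off (G : zmodType) u (F : 'V_L' -> G) :
  \sum_(w | off u w) F w = \sum_x F (glue u x).
Proof.
rewrite (reindex_onto (glue u) pull) /=; last exact: glue_pull.
by apply: eq_bigl => x; rewrite off_glue pull_glue eqxx.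
Qed.

Lemma place1 : place f (idop K N L) = idop K N L'.
Proof.
apply: op_ext => u v; rewrite entry_place !entry_id.
case: offP => [H|H]; last first.
  case: eqP => // uv; case: H => c _; by rewrite uv.
congr ((_ : bool)%:R); apply/eqP/eqP => [E|->//]; apply/ffunP => c.
have [/codomP[l ->]|cf] := boolP (c \in codom f); last exact: H.
by have /ffunP/(_ l) := E; rewrite !ffunE.
Qed.

Lemma place_mul (A B : Op K N L) : place f (A *m B) = place f A *m place f B.
Proof.
apply: op_ext => u v; rewrite entry_place !entry_mul.
transitivity (\sum_(w | off u w) entry (place f A) u w * entry (place f B) w v).
  rewrite sum_off; case: offP => H.
    apply: eq_bigr => x _.
    rewrite !entry_place off_glue !pull_glue.
    suff -> : off (glue u x) v by [].
    by apply/offP => c cf; rewrite glue_out // H.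
  rewrite big1 // => x _; rewrite !entry_place.
  case: (offP (glue u x)) => H'; last by rewrite mulr0.
  by case: H => c cf; rewrite -H' // glue_out.
rewrite [RHS](bigID (off u)) /= [X in _ + X]big1 ?addr0 // => w uw.
by rewrite entry_place (negbTE uw) mul0r.
Qed.

Lemma placeB (A B : Op K N L) : place f (A - B) = place f A - place f B.
Proof.
apply: op_ext => u v; rewrite entryB !entry_place.
by case: ifP => _; rewrite ?entryB ?subr0.
Qed.

End Merge.

Lemma place_ext (L L' : finType) (f g : L -> L') (A : Op K N L) :
  f =1 g -> place f A = place g A.
Proof.
move=> fg; apply: op_ext => u v; rewrite !entry_place.
have -> : off f u v = off g u v.
  by apply/eq_forallb => c; rewrite (eq_codom fg).
by case: ifP => // _; congr entry; apply/ffunP => l; rewrite !ffunE fg.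
Qed.

Lemma place_place (L L' L2 : finType) (f : L' -> L2) (g : L -> L')
    (A : Op K N L) : injective f ->
  place f (place g A) = place (f \o g) A.
Proof.
move=> fI; apply: op_ext => u v; rewrite !entry_place.
have <- : off f u v && off g (pull f u) (pull f v) = off (f \o g) u v.
  apply/andP/offP => [[/offP H1 /offP H2] c cfg|H].
    have [/codomP[l El]|/H1//] := boolP (c \in codom f).
    have /H2 : l \notin codom g.
      apply: contra cfg => /codomP[l' El']; apply/codomP; exists l'.
      by rewrite El El'.
    by rewrite !ffunE -El.
  split; apply/offP => c cf.
    by apply: H; apply: contra cf => /codomP[l ->]; exact: codom_f.
  rewrite !ffunE; apply: H; apply: contra cf => /codomP[l /fI ->].
  exact: codom_f.
case: (off f u v) => //=; case: ifP => // _.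
by congr entry; apply/ffunP => l; rewrite !ffunE.
Qed.

(** An injective self-map of a finite type is onto, so no copy is left on which equality has to be
    tested. *)
Lemma place_perm_entry (L : finType) (f : L -> L) (A : Op K N L) u v :
  injective f -> entry (place f A) u v = entry A (pull f u) (pull f v).
Proof.
move=> fI; rewrite entry_place.
suff -> : off f u v by [].
apply/offP => c /negP[]; have [g _ fg] := injF_bij fI.
by rewrite -[c]fg codom_f.
Qed.

End Labelled.

(** * R-matrices on arbitrary pairs of labels *)

Section RMat.
Variables (K : realType) (N : nat) (R : Rmatrix K N).
Local Notation I := 'I_N.
Local Notation C := K[i].
Local Notation "''V_' L" := {ffun L -> I} (at level 8, L at level 2).

Lemma duo_inj (T : eqType) (a b : T) : a != b -> injective (duo a b).
Proof.
move=> ab x y; rewrite /duo; case: eqP => [->|/eqP x0]; case: eqP => [->//|/eqP y0].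
- by move/eqP; rewrite (negbTE ab).
- by move/eqP; rewrite eq_sym (negbTE ab).
move=> _; apply: val_inj.
by case: x y x0 y0 => [[|[|[]]] ?] // [[|[|[]]] ?].
Qed.

Lemma duo0 (T : Type) (a b : T) : duo a b ord0 = a.
Proof. by []. Qed.

Lemma duo1 (T : Type) (a b : T) : duo a b ord_max = b.
Proof. by []. Qed.

Lemma codom_duo (T : eqType) (a b c : T) :
  (c \in codom (duo a b)) = (c == a) || (c == b).
Proof.
apply/codomP/orP => [[x ->]|[/eqP ->|/eqP ->]].
- by rewrite /duo; case: ifP; rewrite eqxx; [left|right].
- by exists ord0.
- by exists ord_max.
Qed.

Lemma sum_ffun2 (G : zmodType) (F : 'V_('I_2) -> G) :
  \sum_x F x = \sum_i \sum_j F [ffun l => duo i j l].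
Proof.
rewrite pair_big /=.
rewrite (reindex (fun p : I * I => [ffun l : 'I_2 => duo p.1 p.2 l])) //=.
exists (fun x : 'V_('I_2) => (x ord0, x ord_max)) => [[i j] _|x _].
  by rewrite !ffunE.
apply/ffunP => l; rewrite ffunE /duo /=; case: eqP => [-> //|l0].
congr (x _); apply: val_inj.
by case: l l0 => [[|[|[]]] ? l0] //; case: l0; apply: val_inj.
Qed.

Lemma glue_duo (L : finType) (a b : L) (u : 'V_L) i j : a != b ->
  glue (duo a b) u [ffun l => duo i j l] = upd (upd u a i) b j.
Proof.
move=> ab; have dI := duo_inj ab; apply/ffunP => c.
rewrite [RHS]ffunE [in RHS]ffunE.
case: (c =P b) => [->|/eqP cb].
  by rewrite -[X in glue _ _ _ X](duo1 a b) (glue_in dI) ffunE.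
case: (c =P a) => [->|/eqP ca].
  by rewrite -[X in glue _ _ _ X](duo0 a b) (glue_in dI) ffunE.
by rewrite glue_out // codom_duo negb_or ca cb.
Qed.

Lemma entry_Rab (L : finType) (k : L -> K) a b (u v : 'V_L) :
  entry (Rab R k a b) u v =
  if off (duo a b) u v then Rent R (k a) (k b) (u a) (u b) (v a) (v b) else 0.
Proof.
rewrite /Rab entry_place; case: ifP => // _; rewrite /Rent.
by congr entry; apply/ffunP => l; rewrite !ffunE /duo; case: eqP.
Qed.

Lemma entry_Rab_mul (L : finType) (k : L -> K) a b (M : Op K N L) (u v : 'V_L) :
  a != b -> entry (Rab R k a b *m M) u v =
  \sum_i \sum_j Rent R (k a) (k b) (u a) (u b) i j *
                entry M (upd (upd u a i) b j) v.
Proof.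
move=> ab; have dI := duo_inj ab; rewrite entry_mul.
transitivity (\sum_(w | off (duo a b) u w) entry (Rab R k a b) u w * entry M w v).
  rewrite [LHS](bigID (off (duo a b) u)) /= [X in _ + X]big1 ?addr0 // => w uw.
  by rewrite entry_Rab (negbTE uw) mul0r.
rewrite (sum_off dI) sum_ffun2; apply: eq_bigr => i _; apply: eq_bigr => j _.
rewrite entry_Rab off_glue // glue_duo // upd_same.
by rewrite (upd_other _ _ ab) upd_same.
Qed.

Lemma offC (L L' : finType) (f : L -> L') (u v : 'V_L') : off f u v = off f v u.
Proof. by apply/offP/offP => H c /H. Qed.

Lemma entry_mul_Rab (L : finType) (k : L -> K) a b (M : Op K N L) (u v : 'V_L) :
  a != b -> entry (M *m Rab R k a b) u v =
  \sum_i \sum_j entry M u (upd (upd v a i) b j) *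
                Rent R (k a) (k b) i j (v a) (v b).
Proof.
move=> ab; have dI := duo_inj ab; rewrite entry_mul.
transitivity (\sum_(w | off (duo a b) v w) entry M u w * entry (Rab R k a b) w v).
  rewrite [LHS](bigID (off (duo a b) v)) /= [X in _ + X]big1 ?addr0 // => w uw.
  by rewrite entry_Rab offC (negbTE uw) mulr0.
rewrite (sum_off dI) sum_ffun2; apply: eq_bigr => i _; apply: eq_bigr => j _.
rewrite entry_Rab offC off_glue // glue_duo // upd_same.
by rewrite (upd_other _ _ ab) upd_same.
Qed.

Lemma place_Rab (L L' : finType) (f : L -> L') (k : L' -> K) a b :
  injective f -> place f (Rab R (k \o f) a b) = Rab R k (f a) (f b).
Proof.
move=> fI; rewrite /Rab place_place //; apply: place_ext => l /=.
by rewrite /duo; case: ifP.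
Qed.

(** In the product the intermediate configuration is forced: it is [v] on the image of the first
    operator and [u] elsewhere. The entry is then a product of two scalars, symmetric in the two
    operators. *)
Lemma place_comm (L1 L2 L : finType) (f : L1 -> L) (g : L2 -> L)
    (A : Op K N L1) (B : Op K N L2) :
  injective f -> injective g -> (forall x y, f x != g y) ->
  place f A *m place g B = place g B *m place f A.
Proof.
have key (M1 M2 : finType) (f1 : M1 -> L) (g1 : M2 -> L) (A1 : Op K N M1)
    (B1 : Op K N M2) (u v : 'V_L) : injective f1 -> injective g1 ->
    (forall x y, f1 x != g1 y) ->
    entry (place f1 A1 *m place g1 B1) u v =
    if [forall c, (c \notin codom f1) ==> (c \notin codom g1) ==> (u c == v c)]
    then entry A1 (pull f1 u) (pull f1 v) * entry B1 (pull g1 u) (pull g1 v)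
    else 0.
  move=> fI gI fg; rewrite entry_mul.
  transitivity (\sum_(w | off f1 u w) entry (place f1 A1) u w * entry (place g1 B1) w v).
    rewrite [LHS](bigID (off f1 u)) /= [X in _ + X]big1 ?addr0 // => w uw.
    by rewrite entry_place (negbTE uw) mul0r.
  have cfg c : c \in codom g1 -> c \notin codom f1.
    move=> /codomP[y ->]; apply/negP => /codomP[x /esym/eqP].
    by rewrite (negbTE (fg _ _)).
  have cgf c : c \in codom f1 -> c \notin codom g1.
    by move=> cf; apply/negP => /cfg; rewrite cf.
  have E x : off g1 (glue f1 u x) v = (x == pull f1 v) &&
    [forall c, (c \notin codom f1) ==> (c \notin codom g1) ==> (u c == v c)].
    apply/offP/andP => [H|[/eqP -> /forallP H] c cg].
      split.
        apply/eqP/ffunP => l; rewrite ffunE -H ?glue_in //.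
        by apply: cgf; exact: codom_f.
      apply/forallP => c; apply/implyP => cf; apply/implyP => /H <-.
      by rewrite glue_out.
    have [/codomP[l ->]|cf] := boolP (c \in codom f1).
      by rewrite glue_in ?ffunE.
    by rewrite glue_out //; have /implyP/(_ cf)/implyP/(_ cg)/eqP := H c.
  rewrite (sum_off fI) (bigD1 (pull f1 v)) //= big1 ?addr0 => [|x xv]; last first.
    by rewrite [X in _ * X]entry_place E (negbTE xv) mulr0.
  rewrite [X in _ * X]entry_place E eqxx entry_place off_glue // andTb.
  case: ifP => _; last by rewrite mulr0.
  rewrite pull_glue //; congr (_ * entry B1 _ _).
  apply/ffunP => l; rewrite !ffunE; case: pickP => // x /eqP fx.
  by have := fg x l; rewrite fx eqxx.
move=> fI gI fg; apply: op_ext => u v.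
rewrite !key //; last by move=> x y; rewrite eq_sym.
rewrite mulrC; congr (if _ then _ else _); apply: eq_forallb => c.
by do 2! case: (c \in _).
Qed.

Lemma Rab_comm (L : finType) (k : L -> K) a b c d :
  a != b -> c != d -> a != c -> a != d -> b != c -> b != d ->
  Rab R k a b *m Rab R k c d = Rab R k c d *m Rab R k a b.
Proof.
move=> ab cd ac ad bc bd; apply: place_comm; try exact: duo_inj.
by move=> x y; rewrite /duo; do 2! case: ifP.
Qed.

Hypothesis hU : unitarity R.
Hypothesis hYB : yang_baxter R.

(** The hypothesis lives on two copies; [place] along [duo a b] carries it to any two distinct
    labels, and [trio] does the same below for Yang-Baxter. *)
Lemma Rab_unit (L : finType) (k : L -> K) a b : a != b ->
  Rab R k a b *m Rab R k b a = idop K N L.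
Proof.
move=> ab; have dI := duo_inj ab.
have /(congr1 (place (duo a b))) := hU (k \o duo a b).
rewrite place_mul // !place_Rab // place1 //.
by rewrite /duo -!val_eqE /= !inordK.
Qed.

Definition trio (T : Type) (a b c : T) (i : 'I_3) : T :=
  nth c [:: a; b] i.

Lemma trio_inj (T : eqType) (a b c : T) :
  a != b -> a != c -> b != c -> injective (trio a b c).
Proof.
move=> ab ac bc [[|[|[|//]]] x] [[|[|[|//]]] y]; rewrite /trio /= => /eqP E;
  apply: val_inj => //=; move: E; rewrite ?(negbTE ab) ?(negbTE ac) ?(negbTE bc) //;
  by rewrite eq_sym ?(negbTE ab) ?(negbTE ac) ?(negbTE bc).
Qed.

Lemma Rab_YB (L : finType) (k : L -> K) a b c : a != b -> a != c -> b != c ->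
  Rab R k a b *m Rab R k a c *m Rab R k b c =
  Rab R k b c *m Rab R k a c *m Rab R k a b.
Proof.
move=> ab ac bc; have dI := trio_inj ab ac bc.
have /(congr1 (place (trio a b c))) := hYB (k \o trio a b c).
rewrite !place_mul // !place_Rab //.
by rewrite /trio !inordK.
Qed.

End RMat.

(** The computation behind exchanging the first two letters b, c of a word with tail s. Here x and y
    are the R-matrices of the swap and of its inverse, u is U(s), mb and ib (mc and ic) carry b (c)
    through s and back, and pb, pc are the R-matrices with infinity. Both sides expand into four
    terms. *)
Lemma head_swap_identity (S : pzRingType) (u x y mb mc ib ic pb pc : S) :
  x * y = 1 -> y * x = 1 ->
  mb * ib = 1 -> ib * mb = 1 -> mc * ic = 1 -> ic * mc = 1 ->
  x * u = u * x -> pb * ic = ic * pb -> pc * ib = ib * pc ->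
  x * mb * mc = mc * mb * x -> pb * pc * x = x * pc * pb ->
  u - ib * pb * u * mb - x * ic * pc * (u - ib * pb * u * mb) * (mc * y) =
  x * (u - ic * pc * u * mc -
    y * ib * pb * (u - ic * pc * u * mc) * (mb * x)) * y.
Proof.
move=> xy yx bE bE' cE cE' uC C1 C2 G F6.
have KK (A B M : S) : A * B = 1 -> M * A * B = M.
  by move=> E; rewrite -mulrA E mulr1.
have F3 : mb * mc * y = y * mc * mb.
  have -> : mb * mc * y = y * (x * mb * mc) * y by rewrite !mulrA yx mul1r.
  by rewrite G !mulrA (KK _ _ _ xy).
have F4 : ic * ib * y = y * ib * ic.
  transitivity (ic * ib * y * (x * mb * mc) * (y * ib * ic)).
    by rewrite G !mulrA (KK _ _ _ xy) (KK _ _ _ bE) (KK _ _ _ cE).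
  by rewrite !mulrA (KK _ _ _ yx) (KK _ _ _ bE') cE' mul1r.
have F5 : x * ic * ib = ib * ic * x.
  have -> : x * ic * ib = x * (ic * ib * y) * x by rewrite !mulrA (KK _ _ _ yx).
  by rewrite F4 !mulrA xy mul1r.
(* The term containing both pb and pc is the only one that needs G and F6, the consequences of
   Yang-Baxter; the other three match by cancelling x against y. *)
have F7 : x * ic * pc * ib * pb * u * mb * mc * y =
          ib * pb * ic * pc * u * mc * mb.
  have -> : x * ic * pc * ib * pb * u * mb * mc * y =
            x * ic * (pc * ib) * pb * u * (mb * mc * y) by rewrite !mulrA.
  rewrite F3 C2.
  have -> : x * ic * (ib * pc) * pb * u * (y * mc * mb) =
            x * ic * ib * pc * pb * u * y * mc * mb by rewrite !mulrA.
  rewrite F5.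
  have -> : ib * ic * x * pc * pb * u * y * mc * mb =
            ib * ic * (x * pc * pb) * u * y * mc * mb by rewrite !mulrA.
  rewrite -F6.
  have -> : ib * ic * (pb * pc * x) * u * y * mc * mb =
            ib * ic * pb * pc * (x * u) * y * mc * mb by rewrite !mulrA.
  by rewrite uC !mulrA (KK _ _ _ xy) -(mulrA ib ic) -C1 !mulrA.
rewrite !(mulrBr, mulrBl) !mulrA !(KK _ _ _ xy) xy !mul1r F7 uC (KK _ _ _ xy).
by rewrite !opprB addrACA [RHS]addrACA [X in _ + X = _]addrC.
Qed.

(** * The operators U attached to words of labels *)

Section Words.
Variables (K : realType) (N : nat) (R : Rmatrix K N).
Hypothesis hU : unitarity R.
Hypothesis hYB : yang_baxter R.
Local Notation I := 'I_N.
Local Notation C := K[i].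
Local Notation "''V_' L" := {ffun L -> I} (at level 8, L at level 2).

Section Fixed.
Variables (L : finType) (k : L -> K).
Local Notation r := (Rab R k).
Local Notation "1" := (idop K N L).
Implicit Types (a b c oo : L) (s w : seq L) (A B M : Op K N L).

Lemma rV a b : a != b -> r a b *m r b a = 1.
Proof. exact: Rab_unit. Qed.

Lemma rVK a b M : a != b -> r a b *m (r b a *m M) = M.
Proof. by move=> ab; rewrite mulmxA rV // mul1mx. Qed.

(* Operators that touch only the copies in [S]; those of disjoint sets commute. *)
Inductive Rgen (S : {pred L}) : Op K N L -> Prop :=
| Rgen1 : Rgen S 1
| RgenR a b : a != b -> a \in S -> b \in S -> Rgen S (r a b)
| RgenM A B : Rgen S A -> Rgen S B -> Rgen S (A *m B)
| RgenB A B : Rgen S A -> Rgen S B -> Rgen S (A - B).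

Lemma Rgen_sub (S S' : {pred L}) A : {subset S <= S'} -> Rgen S A -> Rgen S' A.
Proof.
move=> SS; elim=> [|a b ab aS bS|A1 B1 _ HA _ HB|A1 B1 _ HA _ HB].
- exact: Rgen1.
- by apply: RgenR => //; apply: SS.
- exact: RgenM.
- exact: RgenB.
Qed.

Lemma Rgen_comm (S T : {pred L}) A B : (forall c, c \in S -> c \notin T) ->
  Rgen S A -> Rgen T B -> A *m B = B *m A.
Proof.
move=> ST GA GB; elim: GA => [|a b ab aS bS|A1 A2 _ H1 _ H2|A1 A2 _ H1 _ H2].
- by rewrite mul1mx mulmx1.
- elim: GB => [|c d cd cT dT|B1 B2 _ H1 _ H2|B1 B2 _ H1 _ H2].
  + by rewrite mul1mx mulmx1.
  + have ne x y : x \in S -> y \in T -> x != y.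
      by move=> /ST xT yT; apply: contraNneq xT => ->.
    by apply: Rab_comm => //; apply: ne.
  + by rewrite mulmxA H1 -mulmxA H2 mulmxA.
  + by rewrite mulmxBl mulmxBr H1 H2.
- by rewrite -mulmxA H2 mulmxA H1 mulmxA.
- by rewrite mulmxBl mulmxBr H1 H2.
Qed.

(* a_{s b} = Rpass b s a_{b s}. *)
Fixpoint Rpass b s : Op K N L := if s is c :: s' then Rpass b s' *m r b c else 1.

Fixpoint Rpass_inv b s : Op K N L := if s is c :: s' then r c b *m Rpass_inv b s' else 1.

Lemma RpassK b s : b \notin s -> Rpass b s *m Rpass_inv b s = 1.
Proof.
elim: s => [|c s IHs] /=; first by rewrite mulmx1.
by rewrite inE negb_or => /andP[bc /IHs E]; rewrite -mulmxA rVK.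
Qed.

Lemma RpassVK b s : b \notin s -> Rpass_inv b s *m Rpass b s = 1.
Proof.
elim: s => [|c s IHs] /=; first by rewrite mulmx1.
rewrite inE negb_or => /andP[bc /IHs E].
by rewrite -mulmxA (mulmxA (Rpass_inv _ _)) E mul1mx rV // eq_sym.
Qed.

Lemma Rpass_cat b s1 s2 : Rpass b (s1 ++ s2) = Rpass b s2 *m Rpass b s1.
Proof. by elim: s1 => [|c s1 IH] /=; rewrite ?mulmx1 // IH mulmxA. Qed.

Lemma Rgen_Rpass b s : b \notin s -> Rgen [in b :: s] (Rpass b s).
Proof.
elim: s => [|c s IH] /=; first by move=> _; exact: Rgen1.
rewrite inE negb_or => /andP[bc /IH G]; apply: RgenM.
  by apply: Rgen_sub G => x; rewrite !inE => /orP[->|->]; rewrite ?orbT.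
by apply: RgenR; rewrite ?inE ?eqxx ?orbT.
Qed.

Lemma Rgen_Rpass_inv b s : b \notin s -> Rgen [in b :: s] (Rpass_inv b s).
Proof.
elim: s => [|c s IH] /=; first by move=> _; exact: Rgen1.
rewrite inE negb_or => /andP[bc /IH G]; apply: RgenM; last first.
  by apply: Rgen_sub G => x; rewrite !inE => /orP[->|->]; rewrite ?orbT.
by apply: RgenR; rewrite ?inE ?eqxx ?orbT // eq_sym.
Qed.

(** Words over arbitrary labels, and not only 1..n, are allowed so that covariance can be proved one
    adjacent swap at a time and the label of the extra generator can enter the word. *)
Fixpoint ucoef oo s : Op K N L :=
  if s is b :: s' then
    ucoef oo s' - Rpass_inv b s' *m r oo b *m ucoef oo s' *m Rpass b s'
  else 1.

Lemma Rgen_ucoef oo s : uniq (oo :: s) -> Rgen [in oo :: s] (ucoef oo s).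
Proof.
elim: s => [|b s IH]; first by move=> _; exact: Rgen1.
rewrite /= inE negb_or -andbA => /and4P[oob oos bs us].
have G : Rgen [in oo :: b :: s] (ucoef oo s).
  apply: Rgen_sub (IH _); last by rewrite /= oos us.
  by move=> x; rewrite !inE => /orP[->|->]; rewrite ?orbT.
have sub : {subset b :: s <= oo :: b :: s}.
  by move=> x xs; rewrite inE xs orbT.
apply: RgenB => //; apply: RgenM; first (apply: RgenM => //; apply: RgenM).
- exact: Rgen_sub (Rgen_Rpass_inv bs).
- by apply: RgenR; rewrite ?inE ?eqxx ?orbT.
- exact: Rgen_sub (Rgen_Rpass bs).
Qed.

(** Only the factors at [x] and [y] are affected, and Yang-Baxter for b, x, y exchanges them; the
    R-matrices of the swap commute with the factors of [u] and [v]. *)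
Lemma Rpass_swap b u x y v : uniq (u ++ x :: y :: v) -> b \notin u ++ x :: y :: v ->
  Rpass b (u ++ y :: x :: v) = r x y *m Rpass b (u ++ x :: y :: v) *m r y x.
Proof.
rewrite cat_uniq => /and3P[_ /hasPn H /= /and3P[]].
have xu : x \notin u by apply: H; rewrite mem_head.
have yu : y \notin u by apply: H; rewrite !inE eqxx orbT.
rewrite inE negb_or => /andP[xy xv] yv _.
rewrite mem_cat !inE !negb_or => /and4P[bu bx by' bv].
have xyv (z : L) : z \in [pred z | (z == x) || (z == y)] -> z \notin b :: v.
  by rewrite inE => /orP[] /eqP ->; rewrite inE negb_or eq_sym ?bx ?by'.
have xyu (z : L) : z \in [pred z | (z == x) || (z == y)] -> z \notin b :: u.
  by rewrite inE => /orP[] /eqP ->; rewrite inE negb_or eq_sym ?bx ?by'.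
rewrite !Rpass_cat /= !mulmxA.
have yx : y != x by rewrite eq_sym.
have Cv : r x y *m Rpass b v = Rpass b v *m r x y.
  apply: (Rgen_comm xyv _ (Rgen_Rpass bv)).
  by apply: RgenR; rewrite ?inE ?eqxx ?orbT.
have Cu : r y x *m Rpass b u = Rpass b u *m r y x.
  apply: (Rgen_comm xyu _ (Rgen_Rpass bu)).
  by apply: RgenR; rewrite ?inE ?eqxx ?orbT.
rewrite Cv -3!(mulmxA (Rpass b v)) -2!mulmxA -Cu !mulmxA.
congr (_ *m Rpass b u); rewrite -!mulmxA; congr (Rpass b v *m _).
transitivity (r b x *m r b y *m (r x y *m r y x)).
  by rewrite rV // mulmx1.
by rewrite mulmxA Rab_YB // -!mulmxA.
Qed.

(** One use of Yang-Baxter for each letter of [s] that the pair b, c crosses. *)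
Lemma Rpass_comm b c s : b != c -> uniq s -> b \notin s -> c \notin s ->
  r b c *m Rpass b s *m Rpass c s = Rpass c s *m Rpass b s *m r b c.
Proof.
move=> bc; elim: s => [|x s IH] /=; first by rewrite !mulmx1 !mul1mx.
rewrite !inE !negb_or => /andP[xs us] /andP[bx bs] /andP[cx cs].
have bcs z : z \in [in [:: b; x]] -> z \notin [in c :: s].
  by rewrite !inE => /orP[] /eqP ->; rewrite negb_or ?bc ?bs // eq_sym cx.
have cbs z : z \in [in [:: c; x]] -> z \notin [in b :: s].
  rewrite !inE => /orP[] /eqP ->; rewrite negb_or 1?[_ == b]eq_sym ?bc ?cs //.
  by rewrite bx.
have C1 : r b x *m Rpass c s = Rpass c s *m r b x.
  by apply: (Rgen_comm bcs _ (Rgen_Rpass cs)); apply: RgenR; rewrite ?inE ?eqxx ?orbT.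
have C2 : r c x *m Rpass b s = Rpass b s *m r c x.
  by apply: (Rgen_comm cbs _ (Rgen_Rpass bs)); apply: RgenR; rewrite ?inE ?eqxx ?orbT.
transitivity (r b c *m Rpass b s *m Rpass c s *m (r b x *m r c x)).
  by rewrite -!mulmxA (mulmxA (r b x)) C1 -!mulmxA.
rewrite IH // -mulmxA [r b c *m _]mulmxA Rab_YB //.
by rewrite -!mulmxA (mulmxA (Rpass b s)) -C2 -!mulmxA.
Qed.

Lemma ucoef_head oo b c s : uniq (oo :: b :: c :: s) ->
  ucoef oo (c :: b :: s) = r b c *m ucoef oo (b :: c :: s) *m r c b.
Proof.
move=> /=; rewrite !inE !negb_or -!andbA.
move=> /and4P[ob oc os] /and4P[bc bs cs us].
have cb : c != b by rewrite eq_sym.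
set u := ucoef oo s; set mb := Rpass b s; set mc := Rpass c s.
set ib := Rpass_inv b s; set ic := Rpass_inv c s.
have xy : r b c *m r c b = 1 by exact: rV.
have yx : r c b *m r b c = 1 by exact: rV.
have bE : mb *m ib = 1 by exact: RpassK.
have bE' : ib *m mb = 1 by exact: RpassVK.
have cE : mc *m ic = 1 by exact: RpassK.
have cE' : ic *m mc = 1 by exact: RpassVK.
have uC : r b c *m u = u *m r b c.
  apply: (Rgen_comm (S := [in [:: b; c]]) _ _ (Rgen_ucoef _)).
  - by move=> z; rewrite !inE => /orP[] /eqP ->; rewrite negb_or eq_sym ?ob ?oc.
  - by apply: RgenR; rewrite ?inE ?eqxx ?orbT.
  - by rewrite /= os.
have C1 : r oo b *m ic = ic *m r oo b.
  apply: (Rgen_comm (S := [in [:: oo; b]]) _ _ (Rgen_Rpass_inv cs)).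
  - by move=> z; rewrite !inE => /orP[] /eqP ->; rewrite negb_or ?oc ?bc.
  - by apply: RgenR; rewrite ?inE ?eqxx ?orbT.
have C2 : r oo c *m ib = ib *m r oo c.
  apply: (Rgen_comm (S := [in [:: oo; c]]) _ _ (Rgen_Rpass_inv bs)).
  - by move=> z; rewrite !inE => /orP[] /eqP ->; rewrite negb_or ?ob ?cb.
  - by apply: RgenR; rewrite ?inE ?eqxx ?orbT.
apply: (@head_swap_identity 'M[C]_#|{ffun L -> I}|) => //; first exact: Rpass_comm.
exact: Rab_YB.
Qed.

End Fixed.
End Words.

(** * Covariance of U under reordering *)

Section Words2.
Variables (K : realType) (N : nat) (R : Rmatrix K N).
Hypothesis hU : unitarity R.
Hypothesis hYB : yang_baxter R.
Local Notation I := 'I_N.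
Local Notation C := K[i].
Local Notation "''V_' L" := {ffun L -> I} (at level 8, L at level 2).

(** The swap takes place behind the first letter. Then U of the tail and both passes are conjugated
    by the same x, the R-matrix p of the first letter with infinity commutes with x, and the inner
    factors cancel. *)
Lemma conj_identity (S : pzRingType) (x y u m i p : S) :
  x * y = 1 -> y * x = 1 -> p * x = x * p ->
  x * u * y - x * i * y * p * (x * u * y) * (x * m * y) =
  x * (u - i * p * u * m) * y.
Proof.
move=> xy yx px; have KK M : M * y * x = M by rewrite -mulrA yx mulr1.
rewrite !mulrA !(mulrBr, mulrBl) !mulrA; congr (_ - _).
by rewrite -(mulrA _ p x) px !mulrA !KK.
Qed.

Lemma invmx_eq n (A B : 'M[C]_n) : A *m B = 1%:M -> invmx A = B.
Proof.
move=> AB; have [uA _] := mulmx1_unit AB.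
by rewrite -[RHS](mulKmx uA) AB mulmx1.
Qed.

Section Fixed.
Variables (L : finType) (k : L -> K).
Local Notation r := (Rab R k).
Local Notation "1" := (idop K N L).
Implicit Types (a b c oo : L) (s w : seq L) (A B M : Op K N L).

Lemma mem_swap (p s : seq L) b c :
  p ++ c :: b :: s =i p ++ b :: c :: s.
Proof.
apply: perm_mem; rewrite perm_cat2l.
by rewrite (perm_catCA [:: c] [:: b] s).
Qed.

Lemma swap_neq (p s : seq L) b c : uniq (p ++ b :: c :: s) -> b != c.
Proof.
by rewrite cat_uniq => /and3P[_ _ /=]; rewrite inE negb_or -andbA => /andP[].
Qed.

Lemma Rpass_inv_swap b u x y v : uniq (u ++ x :: y :: v) -> b \notin u ++ x :: y :: v ->
  Rpass_inv R k b (u ++ y :: x :: v) = r x y *m Rpass_inv R k b (u ++ x :: y :: v) *m r y x.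
Proof.
move=> un bn; have xy := swap_neq un; have yx : y != x by rewrite eq_sym.
have bn' : b \notin u ++ y :: x :: v by rewrite mem_swap.
set m := Rpass R k b (u ++ y :: x :: v); set i := Rpass_inv R k b (u ++ x :: y :: v).
have E : m *m (r x y *m i *m r y x) = 1.
  rewrite /m Rpass_swap // -!mulmxA (mulmxA (r y x)) rV // mul1mx.
  by rewrite (mulmxA (Rpass _ _ _ _)) RpassK // mul1mx rV.
rewrite -[LHS]mulmx1 -[1%:M]E mulmxA RpassVK //; exact: mul1mx.
Qed.

Lemma ucoef_swap oo p b c s : uniq (oo :: p ++ b :: c :: s) ->
  ucoef R k oo (p ++ c :: b :: s) =
  r b c *m ucoef R k oo (p ++ b :: c :: s) *m r c b.
Proof.
elim: p => [|x p IH]; first exact: ucoef_head.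
rewrite /= inE negb_or => /andP[/andP[ox on] /andP[xn un]].
have bc := swap_neq un; have cb : c != b by rewrite eq_sym.
rewrite IH /= ?on // Rpass_swap // Rpass_inv_swap //.
apply: (@conj_identity 'M[C]_#|{ffun L -> I}|); try exact: rV.
have bs : b \in p ++ b :: c :: s by rewrite mem_cat mem_head orbT.
have cs : c \in p ++ b :: c :: s by rewrite mem_cat !inE eqxx !orbT.
apply: (Rab_comm _ _ ox bc).
- by apply: contraNneq on => ->.
- by apply: contraNneq on => ->.
- by apply: contraNneq xn => ->.
- by apply: contraNneq xn => ->.
Qed.

Lemma reorder_perm w s M : reorder R k w s M -> perm_eq w s.
Proof.
elim=> // u a b v {}M _ /perm_trans; apply.
by rewrite perm_cat2l (perm_catCA [:: a] [:: b] v).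
Qed.

Lemma reorder_Rgen w s M : reorder R k w s M -> uniq w -> Rgen R k [in w] M.
Proof.
move=> H uw; elim: H => [|u a b v {}M H IH]; first exact: Rgen1.
have pw := reorder_perm H.
have un : uniq (u ++ a :: b :: v) by rewrite -(perm_uniq pw).
apply: RgenM => //; apply: RgenR; first exact: swap_neq un.
- by rewrite (perm_mem pw) mem_cat mem_head orbT.
- by rewrite (perm_mem pw) mem_cat !inE eqxx !orbT.
Qed.

(** Invertibility and covariance go through one induction along the chain of swaps, with an explicit
    inverse; [invmx] is identified with it only at the end. *)
Lemma reorder_inv w s M : reorder R k w s M -> uniq w ->
  exists M', [/\ M *m M' = 1, M' *m M = 1 &
    forall oo, oo \notin w -> ucoef R k oo s = M *m ucoef R k oo w *m M'].
Proof.
move=> H uw; elim: H => [|u a b v {}M H [M' [E1 E2 E3]]].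
  by exists 1; split; rewrite ?mulmx1 // => oo _; rewrite mul1mx mulmx1.
have pw := reorder_perm H.
have un : uniq (u ++ a :: b :: v) by rewrite -(perm_uniq pw).
have ab := swap_neq un; have ba : b != a by rewrite eq_sym.
exists (M' *m r b a); split.
- by rewrite -mulmxA (mulmxA M) E1 mul1mx rV.
- by rewrite -mulmxA (mulmxA (r b a)) rV // mul1mx.
move=> oo ow; rewrite ucoef_swap; last by rewrite /= un -(perm_mem pw) ow.
by rewrite E3 // !mulmxA.
Qed.

Lemma reorder_unit w s M : reorder R k w s M -> uniq w -> M \in unitmx.
Proof. by move=> /reorder_inv H /H[M' [/mulmx1_unit[]]]. Qed.

Lemma ucoef_reorder oo w s M : reorder R k w s M -> uniq (oo :: w) ->
  ucoef R k oo s = M *m ucoef R k oo w *m invmx M.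
Proof.
move=> H /andP[ow uw]; have [M' [E1 E2 ->//]] := reorder_inv H uw.
by rewrite (invmx_eq E1).
Qed.

End Fixed.

Lemma place_Rpass (L L' : finType) (f : L -> L') (k : L' -> K) b s :
  injective f -> place f (Rpass R (k \o f) b s) = Rpass R k (f b) (map f s).
Proof.
move=> fI; elim: s => [|c s IH] /=; first exact: place1.
by rewrite place_mul // IH place_Rab.
Qed.

Lemma place_Rpass_inv (L L' : finType) (f : L -> L') (k : L' -> K) b s :
  injective f -> place f (Rpass_inv R (k \o f) b s) = Rpass_inv R k (f b) (map f s).
Proof.
move=> fI; elim: s => [|c s IH] /=; first exact: place1.
by rewrite place_mul // IH place_Rab.
Qed.

Lemma place_ucoef (L L' : finType) (f : L -> L') (k : L' -> K) oo s :
  injective f -> place f (ucoef R (k \o f) oo s) = ucoef R k (f oo) (map f s).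
Proof.
move=> fI; elim: s => [|c s IH] /=; first exact: place1.
by rewrite placeB !(place_mul fI) IH (place_Rab R _ _ _ fI) (place_Rpass _ _ _ fI)
  (place_Rpass_inv _ _ _ fI).
Qed.

Definition somes n : seq (option 'I_n) := [seq Some i | i <- enum 'I_n].

Definition uvertex n : coef K N n := fun k => ucoef R k None (somes n).

Lemma None_somes n : None \notin somes n.
Proof. by apply/mapP => -[]. Qed.

Lemma uniq_somes n : uniq (somes n).
Proof. by rewrite map_inj_uniq ?enum_uniq //; apply: Some_inj. Qed.

Lemma perm_somes n (s : 'S_n) :
  perm_eq (somes n) [seq Some (s i) | i <- enum 'I_n].
Proof.
rewrite (map_comp Some s); apply: perm_map; apply: uniq_perm.
- exact: enum_uniq.
- by rewrite map_inj_uniq ?enum_uniq //; apply: perm_inj.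
move=> i; rewrite mem_enum; apply/esym/mapP; exists ((s^-1)%g i).
  by rewrite mem_enum.
by rewrite permKV.
Qed.

Lemma Rsigma_reorder n k (s : 'S_n) :
  reorder R k (somes n) [seq Some (s i) | i <- enum 'I_n] (Rsigma R k s).
Proof. exact/exchange_reorder/perm_somes. Qed.

Lemma omap_inj (T T' : Type) (f : T -> T') : injective f -> injective (omap f).
Proof. by move=> fI [x|] [y|] //= [] /fI ->. Qed.

Lemma uvertex_covariant n : covariant R (@uvertex n).
Proof.
move=> s k; rewrite /Tplace /uvertex place_ucoef; last first.
  by apply: omap_inj; apply: perm_inj.
rewrite -map_comp -(ucoef_reorder (Rsigma_reorder k s)) /=.
  by congr ucoef; apply: eq_map.
by rewrite None_somes uniq_somes.
Qed.

End Words2.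

(** * The ZF algebra as an abelian group *)

Section Quotient.
Local Open Scope quotient_scope.
Variables (K : realType) (N : nat) (R : Rmatrix K N).
Local Notation I := 'I_N.
Local Notation C := K[i].

(* Terms quantify over all finite types; coding them over ordinals brings them
   down to a universe where they can carry a [choiceType] structure. *)
Definition code : Type :=
  {n : nat & (seq (letter K N 'I_n) * (('I_n -> K) -> C))%type}.

HB.instance Definition _ := gen_eqMixin code.
HB.instance Definition _ := gen_choiceMixin code.

Definition decode (c : code) : term K N := Term (tagged c).1 (tagged c).2.

Definition encode (t : term K N) : code :=
  existT _ #|tvar t|
    ([seq lrename (@enum_rank (tvar t)) l | l <- tword t],
     fun k => tker (fun x => k (enum_rank x))).

Lemma zf_encode e : zfeq R e (map (decode \o encode) e).
Proof.
elim: e => [|[X w c] e IH]; first exact: zf_refl.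
apply: (@zf_cat _ _ _ [:: _] [:: _] _ _ _ IH).
exact: (zf_rename _ _ _ (enum_rank_bij X)).
Qed.

Definition zrel (e f : seq code) : bool :=
  `[< zfeq R (map decode e) (map decode f) >].

Lemma zrel_refl : reflexive zrel.
Proof. by move=> e; apply/asboolP; exact: zf_refl. Qed.

Lemma zrel_sym : symmetric zrel.
Proof. by move=> e f; apply: asbool_equiv_eq; split; apply: zf_sym. Qed.

Lemma zrel_trans : transitive zrel.
Proof. by move=> f e g /asboolP H1 /asboolP H2; apply/asboolP; apply: zf_trans H2. Qed.

Canonical zequiv := EquivRel zrel zrel_refl zrel_sym zrel_trans.

(** An abelian group suffices: the relations hold inside arbitrary words, so products of classes are
    never formed, while the sums over indices become big operators. Scalars stay inside the
    kernels. *)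
Definition zfmod := {eq_quot zrel}.
HB.instance Definition _ := EqQuotient.on zfmod.
HB.instance Definition _ := Choice.on zfmod.

Definition cls (e : expr K N) : zfmod := \pi_zfmod (map encode e).

Lemma cls_eq e f : cls e = cls f <-> zfeq R e f.
Proof.
have E g : zfeq R g (map decode (map encode g)).
  by rewrite -map_comp; exact: zf_encode.
split => [/eqmodP /= /asboolP H|H].
  exact: zf_trans (E e) (zf_trans H (zf_sym (E f))).
apply/eqmodP/asboolP.
exact: zf_trans (zf_sym (E e)) (zf_trans H (E f)).
Qed.

Lemma cls_surj (x : zfmod) : exists e, x = cls e.
Proof.
exists (map decode (repr x)); rewrite -[LHS]reprK; apply/eqmodP/asboolP.
by rewrite -[in X in zfeq R _ X]map_comp; exact: zf_encode.
Qed.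

Definition zadd (x y : zfmod) : zfmod := \pi_zfmod (repr x ++ repr y).

Definition zneg (e : expr K N) : expr K N :=
  [seq Term (tword t) (fun k => - @tker _ _ t k) | t <- e].

Definition zopp (x : zfmod) : zfmod := cls (zneg (map decode (repr x))).

Lemma repr_cls e : zfeq R (map decode (repr (cls e))) e.
Proof.
have /eqmodP /= /asboolP H : \pi_zfmod (repr (cls e)) = \pi_zfmod (map encode e).
  by rewrite reprK.
by apply: (zf_trans H); apply: zf_sym; rewrite -map_comp; exact: zf_encode.
Qed.

Lemma cls_cat e f : cls (e ++ f) = zadd (cls e) (cls f).
Proof.
rewrite /zadd -{1}[cls _]reprK; apply/eqmodP/asboolP; rewrite map_cat.
apply: zf_trans (repr_cls _) _.
by apply: zf_cat; apply: zf_sym; exact: repr_cls.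
Qed.

Lemma zaddA : associative zadd.
Proof.
move=> x y z; have [[e ->] [f ->] [g ->]] := And3 (cls_surj x) (cls_surj y) (cls_surj z).
by rewrite -!cls_cat catA.
Qed.

Lemma zaddC : commutative zadd.
Proof.
move=> x y; have [[e ->] [f ->]] := conj (cls_surj x) (cls_surj y).
by rewrite -!cls_cat; apply/cls_eq; exact: zf_catC.
Qed.

Lemma zadd0 : left_id (cls [::]) zadd.
Proof. by move=> x; have [e ->] := cls_surj x; rewrite -cls_cat. Qed.

Lemma zneg_cat e : zfeq R (zneg e ++ e) [::].
Proof.
elim: e => [|[X w c] e IH]; first exact: zf_refl.
have C1 : zfeq R (zneg e ++ Term w c :: e) (Term w c :: e ++ zneg e).
  exact: (zf_catC _ (zneg e) (Term w c :: e)).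
apply: zf_trans (zf_cat (zf_refl R [:: Term w (fun k => - c k)]) C1) _.
change (zfeq R ([:: Term w (fun k => - c k); Term w c] ++ (e ++ zneg e)) [::]).
apply: (@zf_trans _ _ _ _ ([::] ++ [::])); last exact: zf_refl.
apply: zf_cat; last exact: zf_trans (zf_catC _ _ _) IH.
apply: zf_trans (zf_sym _) (zf_zero R w (c := fun=> 0) (fun _ => erefl)).
by apply: zf_add => k; rewrite addNr.
Qed.

Lemma cls_repr (x : zfmod) : cls (map decode (repr x)) = x.
Proof.
rewrite -[RHS]reprK; apply/eqmodP/asboolP; rewrite -map_comp.
by apply: zf_sym; exact: zf_encode.
Qed.

Lemma zaddN : left_inverse (cls [::]) zopp zadd.
Proof.
move=> x; rewrite /zopp -{2}[x]cls_repr -cls_cat.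
by apply/cls_eq; exact: zneg_cat.
Qed.

HB.instance Definition _ := GRing.isZmodule.Build zfmod zaddA zaddC zadd0 zaddN.

Lemma clsD e f : cls (e ++ f) = cls e + cls f.
Proof. exact: cls_cat. Qed.

Lemma cls0 : cls [::] = 0.
Proof. by []. Qed.

Lemma cls_sum (e : expr K N) : cls e = \sum_(t <- e) cls [:: t].
Proof. by elim: e => [|t e IH]; rewrite ?big_nil // big_cons -IH -clsD. Qed.

Lemma cls_flatten (T : Type) (s : seq T) (F : T -> expr K N) :
  cls (flatten [seq F x | x <- s]) = \sum_(x <- s) cls (F x).
Proof. by elim: s => [|x s IH] /=; rewrite ?big_nil // big_cons -IH -clsD. Qed.

Lemma cls_map (T : Type) (s : seq T) (F : T -> term K N) :
  cls [seq F x | x <- s] = \sum_(x <- s) cls [:: F x].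
Proof. by rewrite cls_sum big_map. Qed.

Section Bracket.
Variable X : finType.
Implicit Types (w u v : seq (letter K N X)) (c : (X -> K) -> C).

Definition br w c : zfmod := cls [:: Term w c].

Lemma br_ext w c1 c2 : c1 =1 c2 -> br w c1 = br w c2.
Proof.
move=> E; rewrite /br -[RHS]addr0 -cls0 -(iffRL (cls_eq _ _) (zf_zero R w (c := fun=> 0)
  (fun=> erefl))).
rewrite -clsD; apply/cls_eq; apply: zf_add => k; by rewrite E addr0.
Qed.

Lemma brD w c1 c2 : br w (fun k => c1 k + c2 k) = br w c1 + br w c2.
Proof. by rewrite -clsD; apply/cls_eq; apply: zf_add. Qed.

Lemma br0 w : br w (fun=> 0) = 0.
Proof. by apply/cls_eq; apply: zf_zero. Qed.

Lemma br_sum (T : Type) (s : seq T) (P : pred T) w (F : T -> (X -> K) -> C) :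
  br w (fun k => \sum_(i <- s | P i) F i k) = \sum_(i <- s | P i) br w (F i).
Proof.
elim: s => [|x s IH].
  by rewrite big_nil -(br0 w); apply: br_ext => k; rewrite big_nil.
rewrite big_cons -IH; case: ifP => Px; last first.
  by apply: br_ext => k; rewrite big_cons Px.
by rewrite -brD; apply: br_ext => k; rewrite big_cons Px.
Qed.

Lemma cls_allpairs (F : I -> I -> term K N) :
  cls [seq F i j | i <- enum I, j <- enum I] = \sum_i \sum_j cls [:: F i j].
Proof.
rewrite cls_flatten big_enum; apply: eq_bigr => i _.
by rewrite cls_map big_enum.
Qed.

Lemma br_aa u v i j x y c :
  br (u ++ Ann i x :: Ann j y :: v) c =
  \sum_i' \sum_j' br (u ++ Ann j' y :: Ann i' x :: v)
    (fun k => Rent R (pval k y) (pval k x) j i j' i' * c k).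
Proof. by rewrite -cls_allpairs; apply/cls_eq; exact: zf_aa. Qed.

Lemma br_cc u v i j x y c :
  br (u ++ Cre i x :: Cre j y :: v) c =
  \sum_i' \sum_j' br (u ++ Cre j' y :: Cre i' x :: v)
    (fun k => Rent R (pval k y) (pval k x) j' i' j i * c k).
Proof. by rewrite -cls_allpairs; apply/cls_eq; exact: zf_cc. Qed.

Lemma br_ac u v i j x y c d : dirac x y (u ++ v) c d ->
  br (u ++ Ann i x :: Cre j y :: v) c =
  \sum_i' \sum_j' br (u ++ Cre j' y :: Ann i' x :: v)
    (fun k => Rent R (pval k x) (pval k y) i j' i' j * c k) +
  (if i == j then cls d else 0).
Proof.
move=> D; rewrite -cls_allpairs -cls0 -(fun_if cls) -clsD.
by apply/cls_eq; exact: zf_ac.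
Qed.

End Bracket.

Lemma br_rename (X Y : finType) (f : X -> Y) w c : bijective f ->
  br w c = br [seq lrename f l | l <- w] (fun k => c (k \o f)).
Proof. by move=> fB; apply/cls_eq; exact: zf_rename. Qed.

End Quotient.

(** * Words in labelled copies, paired with a matrix kernel *)

Section Brackets.
Variables (K : realType) (N : nat) (R : Rmatrix K N).
Hypothesis hU : unitarity R.
Local Notation I := 'I_N.
Local Notation C := K[i].
Local Notation "''V_' L" := {ffun L -> I} (at level 8, L at level 2).

Definition agrees (L : finType) (c : L -> option I) (u : 'V_L) : bool :=
  [forall a, if c a is Some x then u a == x else true].

Definition setc (L : finType) (c : L -> option I) (a : L) (x : I) (b : L) : option I :=
  if b == a then Some x else c b.

Lemma agreesP (L : finType) (c : L -> option I) (u : 'V_L) :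
  reflect (forall a x, c a = Some x -> u a = x) (agrees c u).
Proof.
apply: (iffP forallP) => H a; last by case E: (c a) => [x|//]; rewrite (H a x E).
by move=> x E; have := H a; rewrite E => /eqP.
Qed.

Lemma agrees_upd (L : finType) (c : L -> option I) (u : 'V_L) a x :
  c a = None -> agrees c (upd u a x) = agrees c u.
Proof.
move=> ca; apply: eq_forallb => b; case E: (c b) => [y|//].
by rewrite upd_other //; apply: contra_eq_neq E => ->; rewrite ca.
Qed.

Lemma agrees_setc (L : finType) (c : L -> option I) (u : 'V_L) a x :
  c a = None -> agrees (setc c a x) u = agrees c u && (u a == x).
Proof.
move=> ca; apply/agreesP/andP => [H|[/agreesP H /eqP ua] b y].
  split; last by apply/eqP/H; rewrite /setc eqxx.
  by apply/agreesP => b y E; apply: H; rewrite /setc; case: eqP => // ba; rewrite ba ca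
    in E.
by rewrite /setc; case: eqP => [-> [<-//]|_ /H].
Qed.

Lemma sum_updP (G : zmodType) (L : finType) (P : pred 'V_L) a x0 (F : 'V_L -> G) :
  (forall u x, P (upd u a x) = P u) ->
  \sum_(u | P u) F u = \sum_(u | P u && (u a == x0)) \sum_x F (upd u a x).
Proof.
move=> HP; rewrite big_mkcond (sum_upd a x0) [RHS]big_mkcondl.
by apply: eq_bigr => u _; case: ifP => Pu; [apply: eq_bigr|apply: big1] => x _; rewrite
  HP Pu.
Qed.

(** Exchanging the free index with the value at [a] is an involution of the range of summation. It
    turns the indices summed in an exchange relation into row or column indices of the kernel. *)
Lemma sum_swap1 (G : zmodType) (L : finType) (P : pred 'V_L) a (F : 'V_L -> I -> G) :
  (forall u x, P (upd u a x) = P u) ->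
  \sum_(u | P u) \sum_i F u i = \sum_(u | P u) \sum_i F (upd u a i) (u a).
Proof.
move=> HP; rewrite !pair_big_dep /=.
pose h (p : 'V_L * I) := (upd p.1 a p.2, p.1 a).
have hK : involutive h.
  by move=> [u i]; rewrite /h /= upd_upd upd_id upd_same.
rewrite (reindex_inj (inv_inj hK)) /=.
by apply: eq_bigl => -[u i] /=; rewrite HP.
Qed.

Section Par.
Variables (X L : finType) (par : L -> param K X).
Implicit Types (lw p q : seq (bool * L)) (cu cv : L -> option I) (u v : 'V_L)
  (M : (L -> K) -> Op K N L).

Definition mkl (u v : 'V_L) (x : bool * L) : letter K N X :=
  if x.1 then Cre (u x.2) (par x.2) else Ann (v x.2) (par x.2).

Definition kv (k : X -> K) (a : L) : K := pval k (par a).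

(* A word [lw] of letters a (for [false]) and a^+ (for [true]), each in a copy of V,
   sandwiching the kernel [M]: a creator carries the row index of [M] in its copy
   and an annihilator the column index.  [cu] and [cv] prescribe the indices that
   are not summed. *)
Definition BR lw cu cv M : zfmod R :=
  \sum_(u | agrees cu u) \sum_(v | agrees cv v)
    br R (map (mkl u v) lw) (fun k => entry (M (kv k)) u v).

Lemma BR_ext lw cu cv M1 M2 :
  (forall k u v, agrees cu u -> agrees cv v ->
    entry (M1 (kv k)) u v = entry (M2 (kv k)) u v) ->
  BR lw cu cv M1 = BR lw cu cv M2.
Proof.
move=> E; apply: eq_bigr => u Pu; apply: eq_bigr => v Pv.
by apply: br_ext => k; exact: E.
Qed.

Lemma BRD lw cu cv M1 M2 :
  BR lw cu cv M1 + BR lw cu cv M2 = BR lw cu cv (fun k => M1 k + M2 k).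
Proof.
rewrite -big_split; apply: eq_bigr => u _; rewrite -big_split.
apply: eq_bigr => v _; rewrite /= -brD.
by apply: br_ext => k; rewrite entryD.
Qed.

Lemma BR0 lw cu cv : BR lw cu cv (fun=> 0) = 0.
Proof.
rewrite /BR big1 // => u _; rewrite big1 // => v _.
rewrite -(br0 R (map (mkl u v) lw)); apply: br_ext => k.
by rewrite /entry mxE.
Qed.

Lemma BR_muln n lw cu cv M :
  BR lw cu cv M *+ n = BR lw cu cv (fun k => n%:R *: M k).
Proof.
elim: n => [|n IH]; last rewrite mulrS IH BRD.
  by rewrite mulr0n -[LHS](BR0 lw cu cv); apply: BR_ext => k u v _ _; rewrite scale0r.
by apply: BR_ext => k u v _ _; rewrite -nat1r scalerDl scale1r.
Qed.

Lemma mkl_updv lw u v a x : (false, a) \notin lw ->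
  map (mkl u (upd v a x)) lw = map (mkl u v) lw.
Proof.
move=> alw; apply/eq_in_map => -[[] b] blw //; rewrite /mkl /= upd_other //.
by apply: contraNneq alw => <-.
Qed.

Lemma mkl_updu lw u v a x : (true, a) \notin lw ->
  map (mkl (upd u a x) v) lw = map (mkl u v) lw.
Proof.
move=> alw; apply/eq_in_map => -[[] b] blw //; rewrite /mkl /= upd_other //.
by apply: contraNneq alw => <-.
Qed.

Lemma uniq_mid (T : eqType) (s1 s2 : seq T) x y : uniq (s1 ++ x :: y :: s2) ->
  [/\ x != y, x \notin s1, x \notin s2, y \notin s1 & y \notin s2].
Proof.
rewrite cat_uniq => /and3P[_ /hasPn H /= /and3P[]].
rewrite inE negb_or => /andP[-> ->] -> _.
by split => //; apply: H; rewrite !inE eqxx ?orbT.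
Qed.

(** Annihilators carry column indices, so the sum over the two new indices is a product by an
    R-matrix on the right; this requires both columns to be summed freely. *)
Lemma BR_aa p q a b cu cv M : uniq (p ++ (false, a) :: (false, b) :: q) ->
  cv a = None -> cv b = None ->
  BR (p ++ (false, b) :: (false, a) :: q) cu cv M =
  BR (p ++ (false, a) :: (false, b) :: q) cu cv (fun k => M k *m Rab R k a b).
Proof.
move=> /uniq_mid[/= ab ap aq bp bq] ca cb.
have {}ab : a != b by apply: contraNneq ab => ->.
apply: eq_bigr => u _.
transitivity (\sum_(v | agrees cv v) \sum_i \sum_j
  br R (map (mkl u (upd (upd v a j) b i)) (p ++ (false, a) :: (false, b) :: q))
    (fun k => Rent R (kv k a) (kv k b) (v a) (v b) j i * entry (M (kv k)) u v)).
  apply: eq_bigr => v _; rewrite map_cat /= br_aa.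
  apply: eq_bigr => i _; apply: eq_bigr => j _.
  rewrite map_cat /= !mkl_updv // /mkl /=.
  by rewrite upd_same upd_other ?upd_same.
rewrite (sum_swap1 (a := b)); last by move=> v x; rewrite agrees_upd.
under [LHS]eq_bigr do rewrite exchange_big /=.
rewrite (sum_swap1 (a := a)); last by move=> v x; rewrite agrees_upd.
apply: eq_bigr => v _.
transitivity (br R (map (mkl u v) (p ++ (false, a) :: (false, b) :: q))
  (fun k => \sum_i \sum_j entry (M (kv k)) u (upd (upd v a i) b j) *
                Rent R (kv k a) (kv k b) i j (v a) (v b))); last first.
  by apply: br_ext => k; rewrite entry_mul_Rab.
rewrite br_sum; apply: eq_bigr => i _; rewrite br_sum; apply: eq_bigr => j _.
have ba : b != a by rewrite eq_sym.
have E : upd (upd (upd (upd v a i) b j) a (v a)) b (upd v a i b) = v.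
  by rewrite (updC _ _ _ ba) !upd_upd upd_id (upd_other _ _ ba) upd_id.
rewrite E; apply: br_ext => k.
by rewrite !(upd_other _ _ ab) !(upd_other _ _ ba) !upd_same mulrC.
Qed.

Lemma BR_cc p q a b cu cv M : uniq (p ++ (true, a) :: (true, b) :: q) ->
  cu a = None -> cu b = None ->
  BR (p ++ (true, a) :: (true, b) :: q) cu cv M =
  BR (p ++ (true, b) :: (true, a) :: q) cu cv (fun k => Rab R k b a *m M k).
Proof.
move=> /uniq_mid[/= ab ap aq bp bq] ca cb.
have {}ab : a != b by apply: contraNneq ab => ->.
rewrite /BR exchange_big [RHS]exchange_big /=; apply: eq_bigr => v _.
have ba : b != a by rewrite eq_sym.
transitivity (\sum_(u | agrees cu u) \sum_i \sum_j
  br R (map (mkl (upd (upd u b j) a i) v) (p ++ (true, b) :: (true, a) :: q))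
    (fun k => Rent R (kv k b) (kv k a) j i (u b) (u a) * entry (M (kv k)) u v)).
  apply: eq_bigr => u _; rewrite map_cat /= br_cc.
  apply: eq_bigr => i _; apply: eq_bigr => j _.
  rewrite map_cat /= !mkl_updu // /mkl /=.
  by rewrite upd_same upd_other ?upd_same.
rewrite (sum_swap1 (a := a)); last by move=> u x; rewrite agrees_upd.
under [LHS]eq_bigr do rewrite exchange_big /=.
rewrite (sum_swap1 (a := b)); last by move=> u x; rewrite agrees_upd.
apply: eq_bigr => u _.
transitivity (br R (map (mkl u v) (p ++ (true, b) :: (true, a) :: q))
  (fun k => \sum_i \sum_j Rent R (kv k b) (kv k a) (u b) (u a) i j *
              entry (M (kv k)) (upd (upd u b i) a j) v)); last first.
  by apply: br_ext => k; rewrite entry_Rab_mul.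
rewrite br_sum; apply: eq_bigr => i _; rewrite br_sum; apply: eq_bigr => j _.
have E : upd (upd (upd (upd u b i) a j) b (u b)) a (upd u b i a) = u.
  by rewrite (updC _ _ _ ab) !upd_upd upd_id (upd_other _ _ ab) upd_id.
rewrite E; apply: br_ext => k.
by rewrite !(upd_other _ _ ab) !(upd_other _ _ ba) !upd_same.
Qed.

End Par.

Section Relabel.
Variables (X L L' : finType) (f : L' -> L) (par : L -> param K X).
Hypothesis f_inj : injective f.

Definition relab (x : bool * L') : bool * L := (x.1, f x.2).

Lemma sum_relabel (G : zmodType) (c : L -> option I) (u0 : 'V_L) (F : 'V_(L') -> G) :
  (forall a, a \notin codom f -> c a = Some (u0 a)) ->
  \sum_(u | agrees c u) F (pull f u) = \sum_(u | agrees (c \o f) u) F u.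
Proof.
move=> H; rewrite (eq_bigl (fun u : 'V_L => off f u0 u && agrees (c \o f) (pull f u)));
  last first.
  move=> u; apply/agreesP/andP => [Hu|[/offP Hu /agreesP Hu'] a x E].
    split; first by apply/offP => a /H /Hu.
    by apply/agreesP => a x /Hu; rewrite ffunE.
  have [/codomP[l El]|af] := boolP (a \in codom f).
    by have := Hu' l x; rewrite ffunE -El => ->; rewrite //= -El.
  by rewrite -Hu //; move: E; rewrite H // => -[].
rewrite big_mkcondr (sum_off f_inj u0 (fun u : 'V_L => if agrees (c \o f) (pull f u) then
  F (pull f u) else 0)).
by rewrite [RHS]big_mkcond; apply: eq_bigr => x _; rewrite pull_glue.
Qed.

Lemma BR_relabel (u0 : 'V_L) lw cu cv M M' :
  (forall a, a \notin codom f -> cu a = Some (u0 a)) ->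
  (forall a, a \notin codom f -> cv a = Some (u0 a)) ->
  (forall k, M k = place f (M' (k \o f))) ->
  BR par (map relab lw) cu cv M = BR (par \o f) lw (cu \o f) (cv \o f) M'.
Proof.
move=> Hu Hv HM.
transitivity (\sum_(u | agrees cu u) \sum_(v | agrees cv v)
  br R (map (mkl (par \o f) (pull f u) (pull f v)) lw)
     (fun k => entry (M' (kv (par \o f) k)) (pull f u) (pull f v))).
  apply: eq_bigr => u /agreesP Pu; apply: eq_bigr => v /agreesP Pv.
  rewrite -map_comp; have -> : map (mkl par u v \o relab) lw =
    map (mkl (par \o f) (pull f u) (pull f v)) lw.
    by apply: eq_map => -[b a]; rewrite /mkl /= !ffunE.
  apply: br_ext => k; rewrite HM entry_place.
  suff -> : off f u v by [].
  by apply/offP => a af; rewrite (Pu _ _ (Hu _ af)) (Pv _ _ (Hv _ af)).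
pose G (u v : 'V_(L')) := br R (map (mkl (par \o f) u v) lw)
     (fun k => entry (M' (kv (par \o f) k)) u v).
transitivity (\sum_(u | agrees cu u) \sum_(v | agrees (cv \o f) v) G (pull f u) v).
  by apply: eq_bigr => u _; rewrite (sum_relabel (u0 := u0) (G (pull f u))).
by rewrite (sum_relabel (u0 := u0) (fun u : 'V_(L') => \sum_(v | agrees (cv \o f) v) G u
  v)).
Qed.

End Relabel.

End Brackets.

(** * Reordering the letters of a bracket *)

Section Moves.
Variables (K : realType) (N : nat) (R : Rmatrix K N).
Hypothesis hU : unitarity R.
Local Notation I := 'I_N.
Local Notation C := K[i].
Local Notation "''V_' L" := {ffun L -> I} (at level 8, L at level 2).

Section Swaps.
Variable (L : finType).
Implicit Types (w s p q : seq L) (M : (L -> K) -> Op K N L).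

(* [reorder] with the same chain of swaps for all spectral parameters. *)
Inductive swaps w : seq L -> ((L -> K) -> Op K N L) -> Prop :=
| swaps_refl : swaps w w (fun=> idop K N L)
| swaps_step u a b v M : swaps w (u ++ a :: b :: v) M ->
    swaps w (u ++ b :: a :: v) (fun k => Rab R k a b *m M k).

Lemma swaps_reorder w s M k : swaps w s M -> reorder R k w s (M k).
Proof.
elim=> [|u a b v {}M _ H]; first exact: reorder_refl.
exact: reorder_swap.
Qed.

Lemma swaps_ext w s M M' : (forall k, M k = M' k) -> swaps w s M -> swaps w s M'.
Proof. by move=> /funext ->. Qed.

Lemma swaps_front w p a x y M : swaps w (p ++ x ++ a :: y) M ->
  swaps w (p ++ a :: x ++ y)
    (fun k => (\big[mulmx/idop K N L]_(b <- x) Rab R k b a) *m M k).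
Proof.
elim: x p M => [|b x IHx] p M /= H.
  by apply: swaps_ext H => k; rewrite big_nil mul1mx.
apply: (@swaps_ext _ _ (fun k => Rab R k b a *m
  ((\big[mulmx/idop K N L]_(b <- x) Rab R k b a) *m M k))).
  by move=> k; rewrite big_cons mulmxA.
apply: swaps_step.
have := IHx (rcons p b) M; rewrite !cat_rcons; exact.
Qed.

Lemma exchange_swaps w s : perm_eq w s -> swaps w s (fun k => exchange R k w s).
Proof.
suff H t p M : perm_eq t s -> swaps w (p ++ t) M ->
    swaps w (p ++ s) (fun k => exchange R k t s *m M k).
  move=> ws; apply: swaps_ext (H w [::] _ ws (swaps_refl w)) => k.
  exact: mulmx1.
elim: s t p M => [|a s IHs] t p M Hts H.
  move/perm_nilP: Hts H => ->; apply: swaps_ext => k; exact/esym/mul1mx.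
have Ha : a \in t by rewrite (perm_mem Hts) mem_head.
have Ht : t = take (index a t) t ++ a :: drop (index a t).+1 t.
  by rewrite -{1}(cat_take_drop (index a t) t) (drop_nth a) ?index_mem //
    nth_index.
have Hp : perm_eq (rem a t) s.
  by rewrite -(perm_cons a) -(permPr Hts) perm_sym perm_to_rem.
rewrite -cat_rcons /=.
apply: swaps_ext (IHs _ (rcons p a) _ Hp _); last first.
  by rewrite remE cat_rcons; apply: swaps_front; rewrite -Ht; exact: H.
by move=> k; rewrite mulmxA.
Qed.

Lemma swaps_catr w s t M : swaps w s M -> swaps (w ++ t) (s ++ t) M.
Proof.
elim=> [|u a b v {}M _ H]; first exact: swaps_refl.
by rewrite -catA; apply: swaps_step; rewrite -catA in H.
Qed.

Lemma swaps_catl w s t M : swaps w s M -> swaps (t ++ w) (t ++ s) M.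
Proof.
elim=> [|u a b v {}M _ H]; first exact: swaps_refl.
by rewrite catA; apply: swaps_step; rewrite -catA.
Qed.

Lemma swaps_Rpass b s : swaps (b :: s) (rcons s b) (fun k => Rpass R k b s).
Proof.
elim/last_ind: s => [|s c IH]; first exact: swaps_refl.
apply: (@swaps_ext _ _ (fun k => Rab R k b c *m Rpass R k b s)).
  by move=> k; rewrite -[rcons s c]cats1 Rpass_cat /= mul1mx.
have -> : rcons (rcons s c) b = s ++ c :: b :: [::] by rewrite -!cats1 -catA.
have -> : b :: rcons s c = (b :: s) ++ [:: c] by rewrite -cats1.
by apply: swaps_step; have := swaps_catr [:: c] IH; rewrite cat_rcons.
Qed.

End Swaps.

Definition anns (L : Type) (s : seq L) : seq (bool * L) := map (pair false) s.
(** Reversed as in [a^+_{n..1}], so that one word indexes both halves of a sandwich. *)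
Definition cres (L : Type) (s : seq L) : seq (bool * L) := map (pair true) (rev s).

Section SwapBR.
Variables (X L : finType) (par : L -> param K X).

Lemma BR_swaps_ann w s Mx p q cu cv M : swaps w s Mx ->
  uniq (p ++ anns w ++ q) -> (forall a, a \in w -> cv a = None) ->
  BR R par (p ++ anns s ++ q) cu cv M =
  BR R par (p ++ anns w ++ q) cu cv (fun k => M k *m Mx k).
Proof.
move=> H un Hv; elim: H M => [|u a b v {}Mx H IH] M.
  by apply: BR_ext => k *; rewrite mulmx1.
have pw : perm_eq w (u ++ a :: b :: v) by apply: reorder_perm (swaps_reorder (fun=> 0) H).
have := IH (fun k => M k *m Rab R k a b); rewrite /anns !map_cat /= -!catA /= => IH'.
rewrite catA BR_aa; first last.
- by apply: Hv; rewrite (perm_mem pw) mem_cat !inE eqxx !orbT.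
- by apply: Hv; rewrite (perm_mem pw) mem_cat mem_head orbT.
- suff : perm_eq (p ++ anns w ++ q)
    ((p ++ anns u) ++ (false, a) :: (false, b) :: (anns v ++ q)).
    by move/perm_uniq <-.
  rewrite -catA perm_cat2l.
  have E := perm_map (pair false) pw; rewrite map_cat in E.
  by rewrite -(perm_cat2r q) -catA in E.
rewrite -catA IH'; apply: BR_ext => k *; by rewrite mulmxA.
Qed.

(** Each relation between creators multiplies the kernel on the left by an R-matrix that unitarity
    cancels against the outermost factor of [Mx]; creators thus transform inversely to
    annihilators. *)
Lemma BR_swaps_cre w s Mx p q cu cv M : swaps w s Mx ->
  uniq (p ++ cres w ++ q) -> (forall a, a \in w -> cu a = None) ->
  BR R par (p ++ cres s ++ q) cu cv (fun k => Mx k *m M k) =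
  BR R par (p ++ cres w ++ q) cu cv M.
Proof.
move=> H un Hv; elim: H M => [|u a b v {}Mx H IH] M.
  by apply: BR_ext => k *; rewrite mul1mx.
have pw : perm_eq w (u ++ a :: b :: v) by apply: reorder_perm (swaps_reorder (fun=> 0) H).
rewrite -IH /cres !rev_cat !rev_cons -!cats1 !map_cat /= -!catA /=.
have uab : uniq (u ++ a :: b :: v).
  have : uniq (cres w) by move: un; rewrite !cat_uniq => /and3P[_ _ /andP[]].
  rewrite map_inj_uniq ?rev_uniq ?(perm_uniq pw) //.
  by move=> x y [].
rewrite catA BR_cc; first last.
- by apply: Hv; rewrite (perm_mem pw) mem_cat !inE eqxx !orbT.
- by apply: Hv; rewrite (perm_mem pw) mem_cat mem_head orbT.
- suff : perm_eq (p ++ cres w ++ q)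
    ((p ++ map (pair true) (rev v)) ++ (true, a) :: (true, b) :: (map (pair true) (rev u)
      ++ q)).
    by move/perm_uniq <-.
  rewrite -catA perm_cat2l.
  have E : perm_eq (cres w) (map (pair true) (rev v) ++ (true, a) :: (true, b) :: map
    (pair true) (rev u)).
    have -> : map (pair true) (rev v) ++ (true, a) :: (true, b) :: map (pair true) (rev u) =
              map (pair true) (rev v ++ a :: b :: rev u) by rewrite map_cat.
    apply: perm_map; rewrite perm_rev (permPl pw) -perm_rev.
    rewrite rev_cat !rev_cons -!cats1 -!catA /=.
    by rewrite perm_cat2l (perm_catCA [:: b] [:: a] (rev u)).
  by rewrite -(perm_cat2r q) -catA in E.
rewrite -catA; apply: BR_ext => k *.
by rewrite !mulmxA Rab_unit ?mul1mx // eq_sym (swap_neq uab).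
Qed.

End SwapBR.
End Moves.

(** * Contraction of an annihilator with a creator *)

Section Contraction.
Variables (K : realType) (N : nat) (R : Rmatrix K N).
Local Notation I := 'I_N.
Local Notation C := K[i].
Local Notation "''V_' L" := {ffun L -> I} (at level 8, L at level 2).

Section Elim.
Variables (X Y : finType) (g : X -> option Y) (z : param K Y).
Hypothesis g_bij : bijective g.

Definition elimp : param K X -> param K Y := psubst (fun x => elim_var z (g x)).

Definition elimk (k : Y -> K) (x : X) : K := pval k (elim_var z (g x)).

(** [dirac] eliminates the point [None] of an option type. The bijection [g] presents the variables
    in this form, and [z] is the value imposed on the eliminated one. *)
Definition eliminable (x y : param K X) : Prop :=
  forall w (c : (option Y -> K) -> C),
    dirac (psubst (fun t => inr (g t)) x) (psubst (fun t => inr (g t)) y) w c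
      [:: elim_term (N := N) z w c].

Lemma br_ac_elim u v i j x y c : eliminable x y ->
  br R (u ++ Ann i x :: Cre j y :: v) c =
  \sum_i' \sum_j' br R (u ++ Cre j' y :: Ann i' x :: v)
    (fun k => Rent R (pval k x) (pval k y) i j' i' j * c k) +
  (if i == j then br R (map (lsubst (fun t => elim_var z (g t))) (u ++ v))
                    (fun k => c (elimk k)) else 0).
Proof.
move=> D; rewrite (br_rename R _ _ g_bij) map_cat /= (br_ac R _ _ (D _ _)).
congr (_ + _).
  apply: eq_bigr => i' _; apply: eq_bigr => j' _.
  rewrite [RHS](br_rename R _ _ g_bij) map_cat /=; apply: br_ext => k.
  have pE p : pval k (psubst (fun t => inr (g t)) p) = pval (k \o g) p.
    by case: p.
  by rewrite !pE.
case: eqP => // _; rewrite /elim_term -map_cat -map_comp /br.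
by congr (cls R [:: Term _ _]); apply: eq_map => -[l [q|t]|l [q|t]] /=.
Qed.

Variables (L : finType) (par : L -> param K X).
Implicit Types (p q : seq (bool * L)) (cu cv : L -> option I)
  (M : (L -> K) -> Op K N L).

Lemma kv_elim k : kv par (elimk k) = kv (elimp \o par) k.
Proof. by apply/funext => a; rewrite /kv /=; case: (par a). Qed.

(** M1 is the kernel after crossing and M2 the kernel after contraction; both are described by
    entries and recognised as operators later. After the contraction the row index at [b] and the
    column index at [a] occur in no letter: they are pinned to an arbitrary [l], and M2 carries the
    sum over their common value. The delta allows M2 to be compared only where [k a = k b]. *)
Lemma BR_ac p q a b l cu cv M M1 M2 :
  uniq (p ++ (false, a) :: (true, b) :: q) -> eliminable (par a) (par b) ->
  elimp (par a) = elimp (par b) -> cu b = None -> cv a = None ->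
  (forall k u v, entry (M1 k) u v =
    \sum_i \sum_j Rent R (k a) (k b) i (u b) (v a) j *
                  entry (M k) (upd u b j) (upd v a i)) ->
  (forall k u v, k a = k b -> agrees cu u -> agrees cv v -> u b = l -> v a = l ->
    entry (M2 k) u v = \sum_x entry (M k) (upd u b x) (upd v a x)) ->
  BR R par (p ++ (false, a) :: (true, b) :: q) cu cv M =
  BR R par (p ++ (true, b) :: (false, a) :: q) cu cv M1 +
  BR R (elimp \o par) (p ++ q) (setc cu b l) (setc cv a l) M2.
Proof.
move=> /uniq_mid[/= _ ap aq bp bq] D par_ab cub cva H1 H2.
have Pu u x : agrees cu (upd u b x) = agrees cu u by rewrite agrees_upd.
have Pv v x : agrees cv (upd v a x) = agrees cv v by rewrite agrees_upd.
pose F (u v : 'V_L) i' j' := br R (map (mkl par u v) p ++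
   Cre j' (par b) :: Ann i' (par a) :: map (mkl par u v) q)
   (fun k => Rent R (kv par k a) (kv par k b) (v a) j' i' (u b) *
             entry (M (kv par k)) u v).
pose G (u v : 'V_L) := br R (map (mkl (elimp \o par) u v) (p ++ q))
   (fun k => entry (M (kv (elimp \o par) k)) u v).
transitivity (\sum_(u | agrees cu u) \sum_(v | agrees cv v)
    (\sum_i' \sum_j' F u v i' j') +
  \sum_(u | agrees cu u) \sum_(v | agrees cv v) (if v a == u b then G u v else 0)).
  rewrite -big_split; apply: eq_bigr => u _; rewrite -big_split.
  apply: eq_bigr => v _ /=; rewrite map_cat /= (br_ac_elim _ _ _ _ _ D).
  congr (_ + _); case: eqP => // _; rewrite -map_cat -map_comp /G.
  rewrite (_ : map _ _ = map (mkl (elimp \o par) u v) (p ++ q)).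
    by apply: br_ext => k; rewrite kv_elim.
  by apply: eq_map => -[[] c]; rewrite /mkl /=.
congr (_ + _).
  transitivity (\sum_(u | agrees cu u) \sum_(v | agrees cv v) \sum_j' \sum_i'
    F u (upd v a i') (v a) j').
    apply: eq_bigr => u _; rewrite (sum_swap1 (a := a)) //.
    by apply: eq_bigr => v _; rewrite exchange_big.
  rewrite exchange_big /=.
  transitivity (\sum_(v | agrees cv v) \sum_(u | agrees cu u) \sum_j' \sum_i'
    F (upd u b j') (upd v a i') (v a) (u b)).
    by apply: eq_bigr => v _; rewrite (sum_swap1 (a := b)).
  rewrite exchange_big /=; apply: eq_bigr => u _; apply: eq_bigr => v _.
  transitivity (\sum_i \sum_j br R (map (mkl par u v) (p ++ (true, b) :: (false, a) :: q))
     (fun k => Rent R (kv par k a) (kv par k b) i (u b) (v a) j *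
               entry (M (kv par k)) (upd u b j) (upd v a i))).
    rewrite exchange_big; apply: eq_bigr => i _; apply: eq_bigr => j _.
    rewrite /F !mkl_updv // !mkl_updu // map_cat /=.
    by apply: br_ext => k; rewrite !upd_same.
  under eq_bigr do rewrite -br_sum; rewrite -br_sum.
  by apply: br_ext => k; rewrite H1.
(* The delta part remains: the Kronecker symbol merges the sums over the values at [b] and at [a]
   into one sum over x, and [l] is the value of the chosen representatives. *)
rewrite (sum_updP (a := b) l) //.
transitivity (\sum_(u : 'V_L | agrees cu u && (u b == l)) \sum_(v : 'V_L | agrees cv v &&
  (v a == l))
   \sum_x G (upd u b x) (upd v a x)).
  apply: eq_bigr => u _; rewrite exchange_big /= (sum_updP (a := a) l) //.
  apply: eq_bigr => v _; apply: eq_bigr => x _.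
  rewrite (bigD1 x) //= !upd_same eqxx big1 ?addr0 // => y yx.
  by rewrite !upd_same eq_sym (negbTE yx).
rewrite /BR [RHS](eq_bigl (fun u : 'V_L => agrees cu u && (u b == l))); last first.
  by move=> u; rewrite agrees_setc.
apply: eq_bigr => u /andP[okU /eqP ub].
rewrite [RHS](eq_bigl (fun v : 'V_L => agrees cv v && (v a == l))); last first.
  by move=> v; rewrite agrees_setc.
apply: eq_bigr => v /andP[okV /eqP va].
transitivity (\sum_x br R (map (mkl (elimp \o par) u v) (p ++ q))
   (fun k => entry (M (kv (elimp \o par) k)) (upd u b x) (upd v a x))).
  apply: eq_bigr => x _; rewrite /G mkl_updv ?mkl_updu //.
    by rewrite mem_cat negb_or bp bq.
  by rewrite mem_cat negb_or ap aq.
rewrite -br_sum; apply: br_ext => k; rewrite H2 //.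
by rewrite /kv /= par_ab.
Qed.

End Elim.
End Contraction.

(** * Operators that are the identity on a given copy *)

Section Triv.
Variables (K : realType) (N : nat) (R : Rmatrix K N).
Local Notation I := 'I_N.
Local Notation C := K[i].
Local Notation "''V_' L" := {ffun L -> I} (at level 8, L at level 2).
Variable L : finType.
Implicit Types (a b c : L) (A T : Op K N L) (u v w : 'V_L).

(** Diagonal in the copy [c], with an entry that does not depend on the common value there. *)
Definition trivial_on c A := forall u v x,
  entry A u v = (u c == v c)%:R * entry A (upd u c x) (upd v c x).

Lemma trivial_upd c A u v x y : trivial_on c A ->
  entry A (upd u c x) (upd v c x) = entry A (upd u c y) (upd v c y).
Proof. by move=> /(_ (upd u c x) (upd v c x) y) ->; rewrite !upd_same eqxx mul1r
  !upd_upd. Qed.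

Lemma trivial_entry0 c A u v : trivial_on c A -> u c != v c -> entry A u v = 0.
Proof. by move=> /(_ u v (u c)) -> /negbTE ->; rewrite mul0r. Qed.

Lemma trivial_id c : trivial_on c (idop K N L).
Proof.
move=> u v x; rewrite !entry_id -natrM mulnb; congr ((_ : bool)%:R).
apply/eqP/andP => [->|[/eqP uv /eqP E]]; first by rewrite !eqxx.
apply/ffunP => b; have /ffunP/(_ b) := E; rewrite !ffunE.
by case: eqP => // ->.
Qed.

Lemma trivial_mul c A B : trivial_on c A -> trivial_on c B -> trivial_on c (A *m B).
Proof.
move=> HA HB u v x; rewrite !entry_mul [in LHS](sum_upd c x) [in RHS](sum_upd c x).
rewrite mulr_sumr; apply: eq_bigr => w /eqP wc.
rewrite [in RHS](bigD1 x) //= [X in _ * (_ + X)]big1 ?addr0; last first.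
  by move=> y yx; rewrite (trivial_entry0 HA) ?mul0r // !upd_same eq_sym.
rewrite (bigD1 (u c)) //= [X in _ + X]big1 ?addr0; last first.
  by move=> y yx; rewrite (trivial_entry0 HA) ?mul0r // !upd_same eq_sym.
rewrite [entry A _ _](HA _ _ x) [entry B _ _](HB _ _ x) !upd_same !upd_upd.
by rewrite eqxx mul1r mulrCA.
Qed.

Lemma trivial_sub c A B : trivial_on c A -> trivial_on c B -> trivial_on c (A - B).
Proof.
by move=> HA HB u v x; rewrite !entryB (HA _ _ x) (HB _ _ x) -mulrBr.
Qed.

Lemma trivial_scale c t A : trivial_on c A -> trivial_on c (t *: A).
Proof.
by move=> HA u v x; rewrite !entryZ (HA _ _ x) mulrCA.
Qed.

Lemma trivial_Rab k a b c : a != b -> c != a -> c != b -> trivial_on c (Rab R k a b).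
Proof.
move=> ab ca cb u v x; rewrite !entry_Rab.
have ac : a != c by rewrite eq_sym.
have bc : b != c by rewrite eq_sym.
rewrite !(upd_other _ _ ac) !(upd_other _ _ bc).
case: (offP (duo a b) u v) => H.
  rewrite (H c) ?eqxx ?mul1r; last by rewrite codom_duo negb_or ca.
  case: offP => // -[] d dn; rewrite !ffunE; case: eqP => // _; exact: H.
case: eqP => uv; last by rewrite mul0r.
rewrite mul1r; case: offP => // H'; case: H => d dn.
by have := H' d dn; rewrite !ffunE; case: eqP => [->|].
Qed.

Lemma Rgen_trivial k (S : {pred L}) c A : c \notin S -> Rgen R k S A -> trivial_on c A.
Proof.
move=> cS; elim=> [|a b ab aS bS|A1 A2 _ H1 _ H2|A1 A2 _ H1 _ H2].
- exact: trivial_id.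
- by apply: trivial_Rab => //; apply: contraNneq cS => ->.
- exact: trivial_mul.
- exact: trivial_sub.
Qed.

Lemma sum_upd2 (G : zmodType) a b x0 (F : 'V_L -> G) : a != b ->
  \sum_w F w = \sum_(w : 'V_L | (w a == x0) && (w b == x0))
                 \sum_i \sum_j F (upd (upd w a i) b j).
Proof.
move=> ab; have ba : b != a by rewrite eq_sym.
rewrite (sum_upd b x0) big_mkcond (sum_upd a x0) [RHS]big_mkcondr.
apply: eq_bigr => w /eqP wa; case: ifP => wb.
  by apply: eq_bigr => i _; rewrite (upd_other _ _ ba) wb.
by apply: big1 => i _; rewrite (upd_other _ _ ba) wb.
Qed.

(** As [A] ignores [b] and [T] ignores [a], the middle factor reads its row at [b] directly from [u]
    and its column at [a] directly from [v]. This is the index pattern that the mixed relation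
    produces in [BR_ac], so a crossing inserts an R-matrix between [A] and [T]. *)
Lemma cross_entry k a b A T u v : a != b -> trivial_on b A -> trivial_on a T ->
  entry (A *m Rab R k a b *m T) u v =
  \sum_i \sum_j Rent R (k a) (k b) i (u b) (v a) j *
                entry (A *m T) (upd u b j) (upd v a i).
Proof.
move=> ab HA HT; have ba : b != a by rewrite eq_sym.
have updU w i j j' : upd (upd (upd w a i) b j) b j' = upd (upd w a i) b j'.
  by rewrite upd_upd.
rewrite entry_mul (sum_upd2 (v a) _ ab).
transitivity (\sum_(w : 'V_L | (w a == v a) && (w b == v a)) \sum_i \sum_j
   Rent R (k a) (k b) i (u b) (v a) j *
   (entry A u (upd (upd w a i) b (u b)) * entry T (upd (upd w a (v a)) b j) v)).
  apply: eq_bigr => w _; rewrite (bigD1 (v a)) //= [X in _ + X]big1 ?addr0.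
    rewrite exchange_big /=; apply: eq_bigr => j _.
    rewrite entry_mul_Rab // mulr_suml; apply: eq_bigr => i _.
    rewrite (bigD1 (u b)) //= [X in (_ + X) * _]big1 ?addr0.
      rewrite !(upd_other _ _ ab) !upd_same.
      rewrite (updC _ _ _ ab) upd_upd (updC _ _ _ ba) upd_upd.
      by rewrite mulrAC mulrC mulrA.
    by move=> j' j'u; rewrite (trivial_entry0 HA) ?mul0r // upd_same eq_sym.
  move=> x xv; apply: big1 => j _; rewrite [X in _ * X](trivial_entry0 HT) ?mulr0 //.
  by rewrite (upd_other _ _ ab) upd_same.
rewrite exchange_big; apply: eq_bigr => i _; rewrite exchange_big.
apply: eq_bigr => j _; rewrite entry_mul (sum_upd2 (v a) _ ab) mulr_sumr.
apply: eq_bigr => w _; congr (_ * _).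
rewrite (bigD1 i) //= [X in _ + X]big1 ?addr0.
  rewrite (bigD1 j) //= [X in _ + X]big1 ?addr0.
    rewrite (trivial_upd _ _ j (u b) HA) upd_id; congr (_ * _).
    rewrite !(updC _ _ _ ab) (trivial_upd _ _ i (v a) HT) upd_id.
    by [].
  by move=> j' j'j; rewrite (trivial_entry0 HA) ?mul0r // !upd_same eq_sym.
move=> i' i'i; apply: big1 => j' _; rewrite [X in _ * X](trivial_entry0 HT) ?mulr0 //.
by rewrite (upd_other _ _ ab) !upd_same.
Qed.

Definition swapped a b A A' := forall u v,
  entry A u v = entry A' (pull (tperm a b) u) (pull (tperm a b) v).

(** The contracted index x is at once the column index of [A] at [a] and the row index of [T] at
    [b]. Summing over it is a matrix product once [A] is moved from [a] to [b]. *)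
Lemma contract_left a b A A' T u v l : a != b ->
  trivial_on b A -> trivial_on a T -> trivial_on a A' -> swapped a b A A' ->
  u a = l -> u b = l -> v a = l ->
  entry (A' *m T) u v = \sum_x entry (A *m T) (upd u b x) (upd v a x).
Proof.
move=> ab HA HT HA' SA ua ub va; have ba : b != a by rewrite eq_sym.
rewrite entry_mul (sum_upd2 l _ ab).
transitivity (\sum_(w : 'V_L | (w a == l) && (w b == l)) \sum_x
   entry A' u (upd (upd w a l) b x) * entry T (upd (upd w a l) b x) v).
  apply: eq_bigr => w _; rewrite (bigD1 l) //= [X in _ + X]big1 ?addr0 //.
  move=> i il; apply: big1 => j _; rewrite (trivial_entry0 HA') ?mul0r //.
  by rewrite (upd_other _ _ ab) upd_same ua eq_sym.
rewrite exchange_big; apply: eq_bigr => x _.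
rewrite entry_mul (sum_upd2 l _ ab); apply: eq_bigr => w _.
rewrite [RHS](bigD1 x) //= [X in _ + X]big1 ?addr0; last first.
  move=> i il; apply: big1 => j _; rewrite [X in _ * X](trivial_entry0 HT) ?mulr0 //.
  by rewrite (upd_other _ _ ab) !upd_same.
rewrite [RHS](bigD1 x) //= [X in _ + X]big1 ?addr0; last first.
  by move=> j jx; rewrite (trivial_entry0 HA) ?mul0r // !upd_same eq_sym.
rewrite SA.
have -> : pull (tperm a b) (upd u b x) = upd u a x.
  apply/ffunP => c; rewrite !ffunE; case: tpermP => [->|->|/eqP ca /eqP cb].
  - by rewrite !eqxx.
  - by rewrite (negbTE ab) (negbTE ba) ua ub.
  - by rewrite (negbTE ca) (negbTE cb).
have -> : pull (tperm a b) (upd (upd w a x) b x) = upd (upd w b x) a x.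
  apply/ffunP => c; rewrite !ffunE; case: tpermP => [->|->|/eqP ca /eqP cb].
  - by rewrite !eqxx.
  - by rewrite !eqxx (negbTE ba) if_same.
  - by rewrite (negbTE ca) (negbTE cb).
rewrite !(updC _ _ _ ab) (trivial_upd _ _ x l HA') (trivial_upd _ _ x l HT).
have -> : upd u a l = u by rewrite -ua upd_id.
by have -> : upd v a l = v by rewrite -va upd_id.
Qed.

(** The same sum, read as a product after moving [T] from [b] to [a]. *)
Lemma contract_right a b A T T' u v l : a != b ->
  trivial_on b A -> trivial_on a T -> trivial_on b T' -> swapped a b T T' ->
  v b = l -> v a = l -> u b = l ->
  entry (A *m T') u v = \sum_x entry (A *m T) (upd u b x) (upd v a x).
Proof.
move=> ab HA HT HT' ST vb va ub; have ba : b != a by rewrite eq_sym.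
rewrite entry_mul (sum_upd2 l _ ab).
transitivity (\sum_(w : 'V_L | (w a == l) && (w b == l)) \sum_x
   entry A u (upd (upd w a x) b l) * entry T' (upd (upd w a x) b l) v).
  apply: eq_bigr => w _; apply: eq_bigr => x _.
  rewrite (bigD1 l) //= [X in _ + X]big1 ?addr0 //.
  by move=> j jl; rewrite (trivial_entry0 HA) ?mul0r // upd_same ub eq_sym.
rewrite exchange_big; apply: eq_bigr => x _.
rewrite entry_mul (sum_upd2 l _ ab); apply: eq_bigr => w _.
rewrite [RHS](bigD1 x) //= [X in _ + X]big1 ?addr0; last first.
  move=> i il; apply: big1 => j _; rewrite [X in _ * X](trivial_entry0 HT) ?mulr0 //.
  by rewrite (upd_other _ _ ab) !upd_same.
rewrite [RHS](bigD1 x) //= [X in _ + X]big1 ?addr0; last first.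
  by move=> j jx; rewrite (trivial_entry0 HA) ?mul0r // !upd_same eq_sym.
rewrite ST.
have -> : pull (tperm a b) (upd v a x) = upd v b x.
  apply/ffunP => c; rewrite !ffunE; case: tpermP => [->|->|/eqP ca /eqP cb].
  - by rewrite (negbTE ab) (negbTE ba) va vb.
  - by rewrite !eqxx.
  - by rewrite (negbTE ca) (negbTE cb).
have -> : pull (tperm a b) (upd (upd w a x) b x) = upd (upd w a x) b x.
  apply/ffunP => c; rewrite !ffunE; case: tpermP => [->|->|/eqP ca /eqP cb].
  - by rewrite !eqxx if_same.
  - by rewrite !eqxx if_same.
  - by rewrite (negbTE ca) (negbTE cb).
rewrite (trivial_upd _ _ x l HA) (trivial_upd _ _ x l HT').
have -> : upd u b l = u by rewrite -ub upd_id.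
by have -> : upd v b l = v by rewrite -vb upd_id.
Qed.

End Triv.

(** * The extra generator passes one letter *)

Section Halves.
Variables (K : realType) (N : nat) (R : Rmatrix K N).
Hypothesis hU : unitarity R.
Hypothesis hYB : yang_baxter R.
Local Notation I := 'I_N.
Local Notation C := K[i].
Local Notation "''V_' L" := {ffun L -> I} (at level 8, L at level 2).

Lemma cres_rcons (T : Type) (w : seq T) a : cres (rcons w a) = (true, a) :: cres w.
Proof. by rewrite /cres rev_rcons. Qed.

Lemma cres_cat (T : Type) (w1 w2 : seq T) : cres (w1 ++ w2) = cres w2 ++ cres w1.
Proof. by rewrite /cres rev_cat map_cat. Qed.

Lemma cres_cons (T : Type) (w : seq T) a : cres (a :: w) = rcons (cres w) (true, a).
Proof. by rewrite /cres rev_cons map_rcons. Qed.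

Lemma anns_cat (T : Type) (w1 w2 : seq T) : anns (w1 ++ w2) = anns w1 ++ anns w2.
Proof. exact: map_cat. Qed.

Section Sel.
Variable L : eqType.
Implicit Types (lw : seq (bool * L)) (s : seq L).

Definition sel (d : bool) lw : seq L := [seq x.2 | x <- lw & x.1 == d].

Lemma sel_cat d lw1 lw2 : sel d (lw1 ++ lw2) = sel d lw1 ++ sel d lw2.
Proof. by rewrite /sel filter_cat map_cat. Qed.

Lemma sel_cons d x lw : sel d (x :: lw) = if x.1 == d then x.2 :: sel d lw else sel d lw.
Proof. by rewrite /sel /=; case: ifP. Qed.

Lemma sel_map d d' s : sel d (map (pair d') s) = if d' == d then s else [::].
Proof.
rewrite /sel; elim: s => [|a s IH] /=; first by case: ifP.
by case: (d' == d) IH => /= ->.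
Qed.

Lemma sel_cres d s : sel d (cres s) = if d then rev s else [::].
Proof. by rewrite sel_map; case: d. Qed.

Lemma sel_anns d s : sel d (anns s) = if d then [::] else s.
Proof. by rewrite sel_map; case: d. Qed.

(** A label may occur once as a creator and once as an annihilator, so repetitions are tested
    separately for each kind. *)
Lemma uniq_sel lw : uniq (sel true lw) -> uniq (sel false lw) -> uniq lw.
Proof.
move=> /map_uniq U1 /map_uniq U2.
rewrite -(perm_uniq (permEl (perm_filterC (fun x => x.1 == true) lw))).
rewrite cat_uniq U1 /=; apply/andP; split.
  by apply/hasPn => x; rewrite !mem_filter /= => /andP[/negbTE ->].
by rewrite (eq_filter (a2 := fun x => x.1 == false)) // => -[[] ?].
Qed.

Definition selE := (sel_cat, sel_cons, sel_cres, sel_anns).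

End Sel.

Lemma ucoef_Rpass (L : finType) (k : L -> K) oo s2 b t : uniq (oo :: s2 ++ b :: t) ->
  ucoef R k oo (s2 ++ rcons t b) =
  Rpass R k b t *m ucoef R k oo (s2 ++ b :: t) *m Rpass_inv R k b t.
Proof.
move=> un; rewrite (ucoef_reorder hU hYB (swaps_reorder k (swaps_catl s2 (swaps_Rpass R b
  t))) un).
congr (_ *m _); apply: invmx_eq; apply: RpassK => //.
by move: un => /= /andP[_]; rewrite cat_uniq => /and3P[_ _ /= /andP[]].
Qed.

(** The delta has made the parameters of [a] and [b] equal, so exchanging these labels leaves [k]
    unchanged and is a pure relabelling of the operator. *)
Lemma swap_Rab (L : finType) (k : L -> K) a b x : k a = k b -> x != a -> x != b ->
  swapped a b (Rab R k a x) (Rab R k b x).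
Proof.
move=> kab xa xb u v.
have tI : injective (tperm a b) by exact: perm_inj.
rewrite -(place_perm_entry _ _ _ tI) -{1}[k]/(k).
have kt : k \o tperm a b = k.
  by apply/funext => c /=; case: tpermP => [->|->|].
by rewrite -{2}kt (place_Rab R _ _ _ tI) tpermR tpermD // eq_sym.
Qed.

Lemma swap_Rpass (L : finType) (k : L -> K) a b (t : seq L) : k a = k b -> a \notin t ->
  b \notin t ->
  swapped a b (Rpass R k a t) (Rpass R k b t).
Proof.
move=> kab aT bT u v.
have tI : injective (tperm a b) by exact: perm_inj.
rewrite -(place_perm_entry _ _ _ tI).
have kt : k \o tperm a b = k.
  by apply/funext => c /=; case: tpermP => [->|->|].
rewrite -{2}kt (place_Rpass R _ _ _ tI) tpermR; congr (entry (Rpass _ _ _ _) _ _).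
rewrite -[LHS]map_id; apply/eq_in_map => c ct; rewrite tpermD //.
  by apply: contraNneq aT => ->.
by apply: contraNneq bT => ->.
Qed.

Lemma swap_Rpass_inv (L : finType) (k : L -> K) a b (t : seq L) : k a = k b -> a \notin t
  -> b \notin t ->
  swapped b a (Rpass_inv R k a t) (Rpass_inv R k b t).
Proof.
move=> kab aT bT u v.
have tI : injective (tperm b a) by exact: perm_inj.
rewrite -(place_perm_entry _ _ _ tI).
have kt : k \o tperm b a = k.
  by apply/funext => c /=; case: tpermP => [->|->|].
rewrite -{2}kt (place_Rpass_inv R _ _ _ tI) tpermL; congr (entry (Rpass_inv _ _ _ _) _ _).
rewrite -[LHS]map_id; apply/eq_in_map => c ct; rewrite tpermD //.
  by apply: contraNneq bT => ->.
by apply: contraNneq aT => ->.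
Qed.

Lemma swapped_mul (L : finType) a b (A A' B B' : Op K N L) :
  swapped a b A A' -> swapped a b B B' -> swapped a b (A *m B) (A' *m B').
Proof.
move=> HA HB u v; rewrite !entry_mul.
have pI : injective (pull (N := N) (tperm a b)).
  move=> w w' /ffunP E; apply/ffunP => c.
  by have := E (tperm a b c); rewrite !ffunE tpermK.
rewrite [RHS](reindex_inj pI) /=; apply: eq_bigr => w _.
by rewrite HA HB.
Qed.

Section Step.
Variables (X Y L : finType) (par : L -> param K X).
Variables (g : X -> option Y) (z : param K Y).
Hypothesis g_bij : bijective g.
Variables (oo o b : L) (s2 t : seq L) (cu cv : L -> option I) (l : I) (c : C).
Local Notation s := (s2 ++ b :: t).
Hypothesis un : uniq (oo :: o :: s).

Let un_s : uniq s. Proof. by case/and3P: un. Qed.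
Let un_oo : uniq (oo :: s).
Proof.
by move: un; rewrite /= inE negb_or -andbA => /and4P[_ -> _ ->].
Qed.
Let oo_s : oo \notin s. Proof. by case/andP: un_oo. Qed.
Let o_s : o \notin s. Proof. by case/and3P: un. Qed.
Let oo_o : oo != o.
Proof. by move: un; rewrite /= inE negb_or => /andP[/andP[]]. Qed.
Let b_s : b \in s. Proof. by rewrite mem_cat mem_head orbT. Qed.
Let t_s : {subset t <= s}.
Proof. by move=> x xt; rewrite mem_cat inE xt !orbT. Qed.
Let b_t : b \notin t.
Proof. by move: un_s; rewrite cat_uniq => /and3P[_ _ /= /andP[]]. Qed.
Let us2t : uniq (s2 ++ t).
Proof. by apply: subseq_uniq un_s; apply: cat_subseq => //; exact: subseq_cons. Qed.
Let o_b : o != b. Proof. by apply: contraNneq o_s => ->. Qed.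
Let oo_b : oo != b. Proof. by apply: contraNneq oo_s => ->. Qed.
Let o_t : o \notin t. Proof. by apply: contra o_s; exact: t_s. Qed.
Let oo_t : oo \notin t. Proof. by apply: contra oo_s; exact: t_s. Qed.

(* The kernels absorb the R-matrices of the crossings, and the contraction
   identifies the label [o] with [b]. *)
Lemma half1_step :
  eliminable N g z (par o) (par b) ->
  elimp g z (par o) = elimp g z (par b) ->
  cu o = Some l -> cu b = None -> cv o = None ->
  (forall a, a \in s -> cv a = None) ->
  BR R par (cres t ++ (false, o) :: cres (rcons s2 b) ++ anns s) cu cv
    (fun k => Rab R k o oo *m Rpass R k o t *m (c *: ucoef R k oo s)) =
  BR R par (cres (b :: t) ++ (false, o) :: cres s2 ++ anns s) cu cv
    (fun k => Rab R k o oo *m Rpass R k o (b :: t) *m (c *: ucoef R k oo s)) +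
  BR R (elimp g z \o par) (cres (s2 ++ t) ++ anns (s2 ++ rcons t b))
    (setc cu b l) (setc cv o l)
    (fun k => c *: (Rab R k b oo *m ucoef R k oo (s2 ++ rcons t b))).
Proof.
move=> D E cuo cub cvo cvs.
have ooo : o != oo by rewrite eq_sym.
have b_o : b != o by rewrite eq_sym.
have boo : b != oo by rewrite eq_sym.
rewrite cres_rcons.
have u1 : uniq (cres t ++ (false, o) :: (true, b) :: cres s2 ++ anns s).
  apply: uniq_sel; rewrite !selE /= ?cats0.
    have -> : rev t ++ b :: rev s2 = rev s by rewrite rev_cat rev_cons cat_rcons.
    by rewrite rev_uniq; exact: un_s.
  by rewrite o_s.
have u2 : uniq ((cres t ++ cres s2) ++ anns s ++ [::]).
  apply: uniq_sel; rewrite !selE /= ?cats0 //.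
  by rewrite -rev_cat rev_uniq; apply: us2t.
(* The crossing kernel gains one more factor of [Rpass]; the contracted kernel is the old one with
   [o] replaced by [b] in the factors left of U. The annihilator of [b], deprived of its creator,
   then moves to the end of the word and takes over the role of [a_o]. *)
rewrite (@BR_ac _ _ R _ _ g z g_bij _ par _ _ _ _ l cu cv _
  (fun k => Rab R k o oo *m Rpass R k o (b :: t) *m (c *: ucoef R k oo s))
  (fun k => Rab R k b oo *m Rpass R k b t *m (c *: ucoef R k oo s))) //.
- congr (_ + _); first by rewrite cres_cons cat_rcons.
  rewrite [cres (s2 ++ t)]cres_cat.
  rewrite catA -[anns s]cats0 -[anns (s2 ++ rcons t b)]cats0.
  rewrite [RHS](BR_swaps_ann _ _ _ (swaps_catl s2 (swaps_Rpass R b t)) u2); last first.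
    by move=> a aS; rewrite /setc; case: eqP => [ao|_]; [move: o_s; rewrite -ao aS|exact:
      cvs].
  apply: BR_ext => k u v _ _; congr entry.
  rewrite ucoef_Rpass // -scalemxAl -scalemxAr -!mulmxA; congr (_ *: _).
  by rewrite RpassVK // mulmx1.
- move=> k u v; rewrite /= mulmxA; apply: cross_entry => //.
    apply: trivial_mul; first exact: trivial_Rab.
    by apply: Rgen_trivial (Rgen_Rpass R k o_t); rewrite !inE negb_or eq_sym o_b b_t.
  apply/trivial_scale/(Rgen_trivial _ (Rgen_ucoef R k un_oo)).
  by rewrite !inE negb_or eq_sym oo_o o_s.
- move=> k u v kob oku okv ub vo; have uo : u o = l by move/agreesP: oku; apply.
  apply: (contract_left o_b _ _ _ _ uo ub vo).
  + apply: trivial_mul; first exact: trivial_Rab.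
    by apply: Rgen_trivial (Rgen_Rpass R k o_t); rewrite !inE negb_or eq_sym o_b b_t.
  + apply/trivial_scale/(Rgen_trivial _ (Rgen_ucoef R k un_oo)).
    by rewrite !inE negb_or eq_sym oo_o o_s.
  + apply: trivial_mul; first exact: trivial_Rab.
    by apply: Rgen_trivial (Rgen_Rpass R k b_t); rewrite !inE negb_or o_b o_t.
  + by apply: swapped_mul; [exact: swap_Rab|exact: swap_Rpass].
Qed.

(** Here [a^+_o] travels to the left through the annihilators and its R-matrices multiply the kernel
    on the right. It is the creator of [b] that survives the contraction and plays the role of
    [a^+_o]. *)
Lemma half2_step :
  eliminable N g z (par b) (par o) ->
  elimp g z (par b) = elimp g z (par o) ->
  cv o = Some l -> cu o = None -> (forall a, a \in s -> cu a = None) ->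
  (forall a, a \in s -> cv a = None) ->
  BR R par (cres s ++ anns (rcons s2 b) ++ (true, o) :: anns t) cu cv
    (fun k => c *: ucoef R k oo s *m Rpass_inv R k o t) =
  BR R par (cres s ++ anns s2 ++ (true, o) :: anns (b :: t)) cu cv
    (fun k => c *: ucoef R k oo s *m Rpass_inv R k o (b :: t)) +
  BR R (elimp g z \o par) (cres (s2 ++ rcons t b) ++ anns (s2 ++ t))
    (setc cu o l) (setc cv b l)
    (fun k => c *: ucoef R k oo (s2 ++ rcons t b)).
Proof.
move=> D E cvo cuo cus cvs.
have b_o : b != o by rewrite eq_sym.
have -> : cres s ++ anns (rcons s2 b) ++ (true, o) :: anns t =
  (cres s ++ anns s2) ++ (false, b) :: (true, o) :: anns t.
  by rewrite /anns map_rcons cat_rcons catA.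
have u1 : uniq ((cres s ++ anns s2) ++ (false, b) :: (true, o) :: anns t).
  apply: uniq_sel; rewrite !selE /= ?cats0 ?cat0s; last exact: un_s.
  by rewrite cats1 rcons_uniq mem_rev o_s rev_uniq; exact: un_s.
have u2 : uniq ([::] ++ cres s ++ anns (s2 ++ t)).
  apply: uniq_sel; rewrite !selE /= ?cats0 ?rev_uniq; first exact: un_s.
  exact: us2t.
rewrite (@BR_ac _ _ R _ _ g z g_bij _ par _ _ _ _ l cu cv _
  (fun k => c *: ucoef R k oo s *m Rpass_inv R k o (b :: t))
  (fun k => c *: ucoef R k oo s *m Rpass_inv R k b t)) //.
- congr (_ + _); first by rewrite -catA.
  rewrite -catA -anns_cat.
  rewrite -[cres s ++ _]cat0s.
  rewrite -(BR_swaps_cre hU _ _ _ (swaps_catl s2 (swaps_Rpass R b t)) u2); last first.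
    by move=> a aS; rewrite /setc; case: eqP => [ao|_]; [move: o_s; rewrite -ao aS|exact:
      cus].
  apply: BR_ext => k u v _ _; congr entry.
  by rewrite ucoef_Rpass // -!scalemxAl -!scalemxAr !mulmxA.
- exact: cvs.
- move=> k u v; rewrite /= mulmxA; apply: cross_entry => //.
    apply/trivial_scale/(Rgen_trivial _ (Rgen_ucoef R k un_oo)).
    by rewrite !inE negb_or eq_sym oo_o o_s.
  by apply: Rgen_trivial (Rgen_Rpass_inv R k o_t); rewrite !inE negb_or eq_sym o_b b_t.
- move=> k u v kob oku okv ub vo; have vo' : v o = l by move/agreesP: okv; apply.
  apply: (contract_right b_o _ _ _ _ vo' vo ub).
  + apply/trivial_scale/(Rgen_trivial _ (Rgen_ucoef R k un_oo)).
    by rewrite !inE negb_or eq_sym oo_o o_s.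
  + by apply: Rgen_trivial (Rgen_Rpass_inv R k o_t); rewrite !inE negb_or eq_sym o_b b_t.
  + by apply: Rgen_trivial (Rgen_Rpass_inv R k b_t); rewrite !inE negb_or o_b o_t.
  + exact: swap_Rpass_inv.
Qed.

End Step.

End Halves.

(** * All contractions give the same term *)

Section Normal.
Variables (K : realType) (N : nat) (R : Rmatrix K N).
Hypothesis hU : unitarity R.
Hypothesis hYB : yang_baxter R.
Local Notation I := 'I_N.
Local Notation C := K[i].
Local Notation "''V_' L" := {ffun L -> I} (at level 8, L at level 2).

Lemma placeZ (L L' : finType) (f : L -> L') c (A : Op K N L) :
  place f (c *: A) = c *: place f A.
Proof.
apply: op_ext => u v; rewrite entryZ !entry_place.
by case: ifP => _; rewrite ?entryZ ?mulr0.
Qed.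

(* [oo] is the space infinity and [o] the space of the generator multiplying the
   vertex operator. *)
Definition lab (n : nat) : finType := option (option 'I_n).
Definition oo {n} : lab n := None.
Definition o {n} : lab n := Some None.
Definition inn n (i : 'I_n) : lab n := Some (Some i).
Definition inners n : seq (lab n) := map (@inn n) (enum 'I_n).

Definition ends n (x y : option I) (a : lab n) : option I :=
  match a with None => x | Some None => y | Some (Some _) => None end.

Lemma inn_inj n : injective (@inn n).
Proof. by move=> x y []. Qed.

Lemma o_inners n (s : seq 'I_n) : o \notin map (@inn n) s.
Proof. by apply/mapP => -[]. Qed.

Lemma oo_inners n (s : seq 'I_n) : oo \notin map (@inn n) s.
Proof. by apply/mapP => -[]. Qed.

Lemma uniq_inners n : uniq [:: oo, o & inners n].
Proof.
by rewrite /= inE negb_or oo_inners o_inners map_inj_uniq ?enum_uniq //; apply: inn_inj.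
Qed.

Section Params.
Variables (koo q : K).

Definition par n (a : lab n) : param K 'I_n :=
  match a with
  | None => inl koo | Some None => inl q | Some (Some i) => inr i
  end.

(** After the contraction at [j] the surviving letter labelled [inn j] carries the fixed parameter:
    it is the new [o]. The old [o] has left the word and is the one label outside the image. *)
Definition contract_lab n (j : 'I_n.+1) (a : lab n) : lab n.+1 :=
  match a with
  | None => oo | Some None => inn j | Some (Some i) => inn (lift j i)
  end.

Lemma contract_lab_inj n (j : 'I_n.+1) : injective (contract_lab j).
Proof.
move=> [[x|]|] [[y|]|] //=.
- by move=> /inn_inj /lift_inj ->.
- by move=> /inn_inj /eqP; rewrite eq_sym (negbTE (neq_lift _ _)).
- by move=> /inn_inj /eqP; rewrite (negbTE (neq_lift _ _)).
Qed.

Lemma codom_contract_lab n (j : 'I_n.+1) a : a \notin codom (contract_lab j) -> a = o.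
Proof.
case: a => [[i|]|] //.
  case: (unliftP j i) => [i' ->|->].
    by move/negP; case; apply/codomP; exists (inn i').
  by move/negP; case; apply/codomP; exists o.
by move/negP; case; apply/codomP; exists oo.
Qed.

(** Both lists are increasing and have the same elements. *)
Lemma enum_lift n (j : 'I_n.+1) s2 t : enum 'I_n.+1 = s2 ++ j :: t ->
  map (lift j) (enum 'I_n) = s2 ++ t.
Proof.
move=> E; have un : uniq (s2 ++ j :: t) by rewrite -E enum_uniq.
have sorted_enum m : sorted ltn (map val (enum 'I_m)).
  by rewrite val_enum_ord iota_ltn_sorted.
apply: (inj_map val_inj); apply: (irr_sorted_eq ltn_trans ltnn).
- rewrite sorted_map; have := sorted_enum n; rewrite !sorted_map.
  apply: sub_sorted => x y /=; rewrite /bump => xy.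
  case: (leqP j x) => jx; case: (leqP j y) => jy; rewrite ?add0n ?add1n ?ltnS //.
    by have := leq_ltn_trans jx (ltn_trans xy jy); rewrite ltnn.
  exact: ltnW.
- have := sorted_enum n.+1; rewrite E; apply: subseq_sorted; first exact: ltn_trans.
  by apply: map_subseq; apply: cat_subseq => //; exact: subseq_cons.
move=> x; apply/mapP/mapP => -[i Hi ->].
  move/mapP: Hi => [i' _ Ei]; exists i => //.
  have : i \in enum 'I_n.+1 by rewrite mem_enum.
  rewrite E !mem_cat inE => /or3P[->|/eqP Eij|->]; rewrite ?orbT //.
  by have := neq_lift j i'; rewrite -Ei Eij eqxx.
exists i => //; apply/mapP; have [i' E'|E'] := unliftP j i.
  by exists i'; rewrite ?mem_enum.
move: un; rewrite cat_uniq -E' /= => /and3P[_ /norP[i2 _] /andP[it _]].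
by move: Hi; rewrite mem_cat (negbTE i2) (negbTE it).
Qed.

Lemma unlift_bij n (j : 'I_n.+1) : bijective (unlift j).
Proof.
exists (fun x => if x is Some i then lift j i else j) => [i|[i|]].
- by case: unliftP.
- by rewrite liftK.
- by rewrite unlift_none.
Qed.

Section Iterate.
Variables (n : nat) (c : C) (i j l : I).

(** One contraction of the term of order [m.+1]; it has m pairs left besides the generator, hence
    the shift of index when it is compared with order m. *)
Definition cross1 m : zfmod R :=
  BR R (@par m) (cres (inners m) ++ anns (rcons (inners m) o))
    (ends (Some i) (Some l)) (ends (Some j) None)
    (fun k => c *: (Rab R k o oo *m ucoef R k oo (rcons (inners m) o))).

Definition cross2 m : zfmod R :=
  BR R (@par m) (cres (rcons (inners m) o) ++ anns (inners m))
    (ends (Some i) None) (ends (Some j) (Some l))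
    (fun k => c *: ucoef R k oo (rcons (inners m) o)).

Variables (s2 t : seq 'I_n.+1) (b : 'I_n.+1).
Hypothesis E : enum 'I_n.+1 = s2 ++ b :: t.

Let Em : inners n.+1 = map (@inn _) s2 ++ inn b :: map (@inn _) t.
Proof. by rewrite /inners E map_cat. Qed.

Let parE : elimp (unlift b) (inl q) \o @par n.+1 \o contract_lab b = @par n.
Proof.
apply/funext => -[[x|]|] //=; first by rewrite /elimp /= liftK.
by rewrite /elimp /= unlift_none.
Qed.

Let mapE : map (contract_lab b) (inners n) = map (@inn _) s2 ++ map (@inn _) t.
Proof.
rewrite -map_cat -(enum_lift E) /inners -!map_comp.
by apply: eq_map.
Qed.

Let relabC m : map (relab (contract_lab b)) (cres m) = cres (map (contract_lab b) m).
Proof. by rewrite /cres -!map_comp -map_rev -map_comp. Qed.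

Let relabA m : map (relab (contract_lab b)) (anns m) = anns (map (contract_lab b) m).
Proof. by rewrite /anns -!map_comp. Qed.

(* By covariance, the contraction is the same for every label [b]. *)
Lemma half1_contraction :
  BR R (elimp (unlift b) (inl q) \o @par n.+1)
    (cres (map (@inn _) s2 ++ map (@inn _) t) ++
     anns (map (@inn _) s2 ++ rcons (map (@inn _) t) (inn b)))
    (setc (ends (Some i) (Some l)) (inn b) l) (setc (ends (Some j) None) o l)
    (fun k => c *: (Rab R k (inn b) oo *m
        ucoef R k oo (map (@inn _) s2 ++ rcons (map (@inn _) t) (inn b)))) =
  cross1 n.
Proof.
have ET : map (contract_lab b) (rcons (inners n) o) = map (@inn _) s2 ++ rcons (map (@inn
  _) t) (inn b).
  by rewrite map_rcons mapE rcons_cat.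
rewrite -ET -mapE -relabC -relabA -map_cat.
(* The old [o] is pinned to [l] in the row by [ends] and in the column by the contraction, as needed
   to drop it. *)
rewrite (@BR_relabel _ _ R _ _ _ (contract_lab b) (elimp (unlift b) (inl q) \o @par n.+1)
   (@contract_lab_inj _ b) [ffun=> l] _ _ _ _ (fun k => c *: (Rab R k o oo *m ucoef R k
     oo (rcons (inners n) o)))).
- rewrite parE /cross1; congr (BR R _ _ _ _ _); apply/funext => -[[x|]|] //=.
  + by rewrite /setc (inj_eq (@inn_inj _)) eq_sym (negbTE (neq_lift _ _)).
  + by rewrite /setc eqxx.
- by move=> a /codom_contract_lab ->; rewrite ffunE.
- by move=> a /codom_contract_lab ->; rewrite /setc eqxx ffunE.
move=> k; have fI := @contract_lab_inj _ b.
by rewrite placeZ (place_mul fI) (place_Rab R _ _ _ fI) (place_ucoef R _ _ _ fI).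
Qed.

Lemma half2_contraction :
  BR R (elimp (unlift b) (inl q) \o @par n.+1)
    (cres (map (@inn _) s2 ++ rcons (map (@inn _) t) (inn b)) ++
     anns (map (@inn _) s2 ++ map (@inn _) t))
    (setc (ends (Some i) None) o l) (setc (ends (Some j) (Some l)) (inn b) l)
    (fun k => c *: ucoef R k oo (map (@inn _) s2 ++ rcons (map (@inn _) t) (inn b))) =
  cross2 n.
Proof.
have ET : map (contract_lab b) (rcons (inners n) o) = map (@inn _) s2 ++ rcons (map (@inn
  _) t) (inn b).
  by rewrite map_rcons mapE rcons_cat.
rewrite -ET -mapE -relabC -relabA -map_cat.
rewrite (@BR_relabel _ _ R _ _ _ (contract_lab b) (elimp (unlift b) (inl q) \o @par n.+1)
   (@contract_lab_inj _ b) [ffun=> l] _ _ _ _ (fun k => c *: (ucoef R k oo (rcons (inners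
     n) o)))).
- rewrite parE /cross2; congr (BR R _ _ _ _ _); apply/funext => -[[x|]|] //=.
  + by rewrite /setc (inj_eq (@inn_inj _)) eq_sym (negbTE (neq_lift _ _)).
  + by rewrite /setc eqxx.
- by move=> a /codom_contract_lab ->; rewrite /setc eqxx ffunE.
- by move=> a /codom_contract_lab ->; rewrite ffunE.
by move=> k; have fI := @contract_lab_inj _ b; rewrite placeZ (place_ucoef R _ _ _ fI).
Qed.

End Iterate.

End Params.
End Normal.

(** * Normal ordering and the cancellation between consecutive orders *)

Section Ordered.
Variables (K : realType) (N : nat) (R : Rmatrix K N).
Hypothesis hU : unitarity R.
Hypothesis hYB : yang_baxter R.
Local Notation I := 'I_N.
Local Notation C := K[i].
Local Notation "''V_' L" := {ffun L -> I} (at level 8, L at level 2).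
Variables (koo q : K) (i j l : I).
Local Notation P := (@par K koo q _).

Lemma elim_right n (b : 'I_n.+1) :
  eliminable N (unlift b) (inl q) (P o) (P (inn b)).
Proof. by move=> w c /=; rewrite unlift_none; exact: (@dirac_right K N _ (inl q) w c). Qed.

Lemma elim_left n (b : 'I_n.+1) :
  eliminable N (unlift b) (inl q) (P (inn b)) (P o).
Proof. by move=> w c /=; rewrite unlift_none; exact: (@dirac_left K N _ (inl q) w c). Qed.

Lemma elim_eq n (b : 'I_n.+1) :
  elimp (unlift b) (inl q) (P o) = elimp (unlift b) (inl q) (P (inn b)).
Proof. by rewrite /elimp /= unlift_none. Qed.

(** The part of order m of [R a_o T] in which [a_o] has crossed all the creators and all the
    annihilators without contraction. *)
Definition ord1 c m : zfmod R :=
  BR R P (cres (inners m) ++ anns (rcons (inners m) o))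
    (ends (Some i) (Some l)) (ends (Some j) None)
    (fun k => c *: (Rab R k o oo *m Rpass R k o (inners m) *m ucoef R k oo (inners m) *m
      Rpass_inv R k o (inners m))).

Definition ord2 c m : zfmod R :=
  BR R P (cres (rcons (inners m) o) ++ anns (inners m))
    (ends (Some i) None) (ends (Some j) (Some l))
    (fun k => c *: (Rpass R k o (inners m) *m ucoef R k oo (inners m) *m Rpass_inv R k o
      (inners m))).

(** The generator has crossed the creators of [t] and has those of [s2] ahead. Each of the latter
    adds one copy of the same contraction term, whence the multiplicity [size s2]. *)
Lemma half1_sum n c s2 t : enum 'I_n.+1 = s2 ++ t ->
  BR R P (cres (map (@inn _) t) ++ (false, o) :: cres (map (@inn _) s2) ++ anns (inners
    n.+1))
    (ends (Some i) (Some l)) (ends (Some j) None)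
    (fun k => Rab R k o oo *m Rpass R k o (map (@inn _) t) *m (c *: ucoef R k oo (inners
      n.+1))) =
  BR R P (cres (inners n.+1) ++ (false, o) :: anns (inners n.+1))
    (ends (Some i) (Some l)) (ends (Some j) None)
    (fun k => Rab R k o oo *m Rpass R k o (inners n.+1) *m (c *: ucoef R k oo (inners
      n.+1))) +
  cross1 R koo q c i j l n *+ size s2.
Proof.
elim/last_ind: s2 t => [|s2 b IH] t E.
  have -> : map (@inn _) t = inners n.+1 by rewrite /inners E.
  by rewrite mulr0n addr0.
rewrite cat_rcons in E.
have Em : inners n.+1 = map (@inn _) s2 ++ inn b :: map (@inn _) t.
  by rewrite /inners E map_cat.
have un := uniq_inners n.+1; rewrite Em in un.
rewrite map_rcons [in LHS]Em.
rewrite (half1_step (l := l) hU hYB (unlift_bij b) _ un (elim_right b) (elim_eq b)) //;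
  first last.
- by move=> a; rewrite -Em => /mapP[x _ ->].
rewrite (half1_contraction _ _ _ _ _ _ _ E) -Em.
rewrite size_rcons mulrSr addrA; congr (_ + _).
exact: IH E.
Qed.

Lemma half2_sum n c s2 t : enum 'I_n.+1 = s2 ++ t ->
  BR R P (cres (inners n.+1) ++ anns (map (@inn _) s2) ++ (true, o) :: anns (map (@inn _)
    t))
    (ends (Some i) None) (ends (Some j) (Some l))
    (fun k => c *: ucoef R k oo (inners n.+1) *m Rpass_inv R k o (map (@inn _) t)) =
  BR R P (cres (inners n.+1) ++ (true, o) :: anns (inners n.+1))
    (ends (Some i) None) (ends (Some j) (Some l))
    (fun k => c *: ucoef R k oo (inners n.+1) *m Rpass_inv R k o (inners n.+1)) +
  cross2 R koo q c i j l n *+ size s2.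
Proof.
elim/last_ind: s2 t => [|s2 b IH] t E.
  have -> : map (@inn _) t = inners n.+1 by rewrite /inners E.
  by rewrite mulr0n addr0.
rewrite cat_rcons in E.
have Em : inners n.+1 = map (@inn _) s2 ++ inn b :: map (@inn _) t.
  by rewrite /inners E map_cat.
have un := uniq_inners n.+1; rewrite Em in un.
rewrite map_rcons [in LHS]Em.
rewrite (half2_step (l := l) hU hYB (unlift_bij b) _ un (elim_left b) (esym (elim_eq b)))
  //; first last.
- by move=> a; rewrite -Em => /mapP[x _ ->].
- by move=> a; rewrite -Em => /mapP[x _ ->].
rewrite (half2_contraction _ _ _ _ _ _ _ E) -Em.
rewrite size_rcons mulrSr addrA; congr (_ + _).
exact: IH E.
Qed.

Lemma ord1E c m :
  BR R P (cres (inners m) ++ (false, o) :: anns (inners m))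
    (ends (Some i) (Some l)) (ends (Some j) None)
    (fun k => Rab R k o oo *m Rpass R k o (inners m) *m (c *: ucoef R k oo (inners m))) =
  ord1 c m.
Proof.
rewrite -[cres _ ++ _](_ : cres (inners m) ++ anns (o :: inners m) ++ [::] = _); last first.
  by rewrite cats0.
rewrite /ord1 -[anns (rcons _ _)]cats0.
rewrite [RHS](BR_swaps_ann _ _ _ (swaps_Rpass R o (inners m))).
- apply: BR_ext => k u v _ _; congr entry.
  rewrite -scalemxAl -scalemxAr -!mulmxA RpassVK //; last exact: o_inners.
  by rewrite mulmx1.
- apply: uniq_sel; rewrite !selE /= ?cats0 ?rev_uniq; have := uniq_inners m => /=
  /and3P[_] //.
  by move=> -> ->.
- by move=> a; rewrite inE => /orP[/eqP ->//|/mapP[x _ ->]].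
Qed.

Lemma ord2E c m :
  BR R P (cres (inners m) ++ (true, o) :: anns (inners m))
    (ends (Some i) None) (ends (Some j) (Some l))
    (fun k => c *: ucoef R k oo (inners m) *m Rpass_inv R k o (inners m)) =
  ord2 c m.
Proof.
rewrite -cat_rcons -cres_cons /ord2 -[cres _ ++ _ in LHS]cat0s -[cres _ ++ _ in RHS]cat0s.
rewrite -[LHS](BR_swaps_cre hU _ _ _ (swaps_Rpass R o (inners m))).
- by apply: BR_ext => k u v _ _; rewrite -!scalemxAl -!scalemxAr !mulmxA.
- apply: uniq_sel; rewrite !selE /= ?cats0 ?rev_uniq; have := uniq_inners m => /=
  /and3P[_] //.
  by move=> -> ->.
- by move=> a; rewrite inE => /orP[/eqP ->//|/mapP[x _ ->]].
Qed.

Lemma half1_normal c m :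
  BR R P ((false, o) :: cres (inners m) ++ anns (inners m))
    (ends (Some i) (Some l)) (ends (Some j) None)
    (fun k => Rab R k o oo *m (c *: ucoef R k oo (inners m))) =
  ord1 c m + (if m is n.+1 then cross1 R koo q c i j l n *+ n.+1 else 0).
Proof.
case: m => [|n].
  rewrite addr0 -ord1E /inners; have -> : enum 'I_0 = [::].
    by apply/size0nil; rewrite size_enum_ord.
  by apply: BR_ext => k u v _ _ /=; rewrite mulmx1.
rewrite -ord1E -[X in cross1 _ _ _ _ _ _ _ _ *+ X]size_enum_ord.
rewrite -(half1_sum c (esym (cats0 _))).
by apply: BR_ext => k u v _ _ /=; rewrite mulmx1.
Qed.

Lemma half2_normal c m :
  BR R P (cres (inners m) ++ rcons (anns (inners m)) (true, o))
    (ends (Some i) None) (ends (Some j) (Some l))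
    (fun k => c *: ucoef R k oo (inners m)) =
  ord2 c m + (if m is n.+1 then cross2 R koo q c i j l n *+ n.+1 else 0).
Proof.
case: m => [|n].
  rewrite addr0 -ord2E /inners; have -> : enum 'I_0 = [::].
    by apply/size0nil; rewrite size_enum_ord.
  by apply: BR_ext => k u v _ _ /=; rewrite mulmx1.
rewrite -ord2E -[X in cross2 _ _ _ _ _ _ _ _ *+ X]size_enum_ord.
rewrite -(half2_sum c (esym (cats0 _))) -cats1.
by apply: BR_ext => k u v _ _ /=; rewrite mulmx1.
Qed.

(** By covariance [o] moves to the front, where the definition of [ucoef] applies; moving it back
    strips the passes from the term with [Rab oo o]. The well-bred relations for U reduce to this
    identity. *)
Lemma ucoef_rcons m (k : lab m -> K) :
  ucoef R k oo (rcons (inners m) o) =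
  Rpass R k o (inners m) *m ucoef R k oo (inners m) *m Rpass_inv R k o (inners m) -
  Rab R k oo o *m ucoef R k oo (inners m).
Proof.
have un := uniq_inners m; have os := o_inners (enum 'I_m).
rewrite (ucoef_Rpass hU hYB k (s2 := [::]) un) /= mulmxBr mulmxBl; congr (_ - _).
rewrite -!mulmxA RpassK // mulmx1 (mulmxA (Rpass _ _ _ _)) RpassK //.
by rewrite mul1mx.
Qed.

(** Multiplying [ucoef_rcons] by [Rab o oo] leaves U alone by unitarity: ordered term and
    contraction combine into the term of order m of the series times [a_o]. *)
Lemma ord1_cross c m :
  ord1 c m - cross1 R koo q c i j l m =
  BR R P (cres (inners m) ++ anns (rcons (inners m) o))
    (ends (Some i) (Some l)) (ends (Some j) None) (fun k => c *: ucoef R k oo (inners m)).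
Proof.
apply/eqP; rewrite subr_eq BRD; apply/eqP; apply: BR_ext => k u v _ _.
congr entry; rewrite ucoef_rcons mulmxBr !mulmxA Rab_unit // mul1mx.
by rewrite -scalerDr addrC subrK.
Qed.

(** The remainder of [ucoef_rcons] is the R-matrix with infinity that the relation for [a^+_o]
    prescribes on the other side. *)
Lemma ord2_cross c m :
  ord2 c m - cross2 R koo q c i j l m =
  BR R P (cres (rcons (inners m) o) ++ anns (inners m))
    (ends (Some i) None) (ends (Some j) (Some l))
    (fun k => Rab R k oo o *m (c *: ucoef R k oo (inners m))).
Proof.
apply/eqP; rewrite subr_eq BRD; apply/eqP; apply: BR_ext => k u v _ _.
congr entry; rewrite ucoef_rcons -scalemxAr -scalerDr.
by rewrite addrC subrK.
Qed.

End Ordered.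

(** * From brackets back to products of words *)

Section Convert.
Variables (K : realType) (N : nat) (R : Rmatrix K N).
Local Notation I := 'I_N.
Local Notation C := K[i].
Local Notation "''V_' L" := {ffun L -> I} (at level 8, L at level 2).

Definition ext_ffun n (i l : I) (u : {ffun 'I_n -> I}) : 'V_(lab n) :=
  [ffun a : lab n => match a with
                     | None => i | Some None => l | Some (Some x) => u x
                     end].

Lemma sum_ends2 (G : zmodType) n (i l : I) (F : 'V_(lab n) -> G) :
  \sum_(w | agrees (ends (Some i) (Some l)) w) F w = \sum_u F (ext_ffun i l u).
Proof.
rewrite (reindex_onto (ext_ffun i l) (fun w : 'V_(lab n) => [ffun x => w (inn x)])) /=.
  apply: eq_bigl => u; apply/andP; split.
    by apply/agreesP => -[[x|]|] y //= [<-]; rewrite ffunE.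
  by apply/eqP/ffunP => x; rewrite !ffunE.
move=> w /agreesP H; apply/ffunP => -[[x|]|]; rewrite !ffunE //.
  by apply/esym/H.
by apply/esym/H.
Qed.

Lemma sum_ends1 (G : zmodType) n (i : I) (F : 'V_(lab n) -> G) :
  \sum_(w | agrees (ends (Some i) None) w) F w = \sum_l \sum_u F (ext_ffun i l u).
Proof.
rewrite (partition_big (fun w : 'V_(lab n) => w o) xpredT) //=; apply: eq_bigr => l _.
rewrite -sum_ends2; apply: eq_bigl => w; apply/andP/agreesP => [[/agreesP H /eqP wl]|H].
  by move=> [[x|]|] y //= [<-] //; apply: H.
by split; [apply/agreesP => -[[x|]|] y //= [<-] //; exact: H | apply/eqP/H].
Qed.

Section Word.
Variables (koo q : K) (n : nat) (i j : I).
Local Notation P := (@par K koo q n).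
Implicit Types (u v : {ffun 'I_n -> I}).

Definition creW u : seq (letter K N 'I_n) := rev [seq Cre (u a) (inr a) | a <- enum 'I_n].
Definition annW v : seq (letter K N 'I_n) := [seq Ann (v a) (inr a) | a <- enum 'I_n].

Lemma mkl_cres u v l m : map (mkl P (ext_ffun i l u) (ext_ffun j m v)) (cres (inners n))
  = creW u.
Proof.
rewrite /cres /creW map_rev -!map_comp map_rev; congr rev.
by rewrite -map_comp; apply: eq_map => a; rewrite /mkl /= ffunE.
Qed.

Lemma mkl_anns u v l m : map (mkl P (ext_ffun i l u) (ext_ffun j m v)) (anns (inners n))
  = annW v.
Proof.
by rewrite /anns /annW -!map_comp; apply: eq_map => a; rewrite /mkl /= ffunE.
Qed.

Definition vker (c : C) u v (k : 'I_n -> K) : C :=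
  c * entry (uvertex R (with_oo koo k)) [ffun x => with_oo i u x] [ffun x => with_oo j v x].

(** The kernel does not touch the copy [o], so its indices there have to agree. *)
Lemma entry_ucoef c k u v l m :
  entry (c *: ucoef R (kv P k) oo (inners n)) (ext_ffun i l u) (ext_ffun j m v) =
  (l == m)%:R * vker c u v k.
Proof.
rewrite entryZ /vker mulrCA; congr (_ * _).
have sI : injective (@Some (option 'I_n)) by apply: Some_inj.
pose f : option 'I_n -> lab n := omap Some.
have fI : injective f by apply: omap_inj; apply: Some_inj.
have -> : ucoef R (kv P k) oo (inners n) = place f (uvertex R (with_oo koo k)).
  have -> : with_oo koo k = kv P k \o f by apply/funext => -[x|].
  rewrite (place_ucoef R _ _ _ fI) /somes /inners.
  by have -> : map f (map Some (enum (ordinal n))) = map (@inn n) (enum (ordinal n)) by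
    rewrite -map_comp; apply: eq_map.
rewrite entry_place.
have pE i' l' w : pull f (ext_ffun i' l' w) = [ffun x => with_oo i' w x].
  by apply/ffunP => -[x|]; rewrite !ffunE.
rewrite !pE; case: offP => H.
  have := H o; rewrite !ffunE /= => -> //; last by apply/codomP => -[[x|]].
  by rewrite eqxx mul1r.
case: eqP => lm; rewrite ?mul0r //; case: H => -[[x|]|].
- by move/negP; case; apply/codomP; exists (Some x).
- by rewrite !ffunE /= lm.
- by move/negP; case; apply/codomP; exists None.
Qed.

Variable (l : I) (c : C).

Lemma BR_left1 :
  BR R P (cres (inners n) ++ anns (rcons (inners n) o)) (ends (Some i) (Some l)) (ends
    (Some j) None)
    (fun k => c *: ucoef R k oo (inners n)) =
  \sum_u \sum_v br R (creW u ++ annW v ++ [:: Ann l (inl q)]) (vker c u v).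
Proof.
rewrite /BR sum_ends2; apply: eq_bigr => u _; rewrite sum_ends1 exchange_big.
apply: eq_bigr => v _; rewrite (bigD1 l) //= [X in _ + X]big1 ?addr0.
  rewrite /anns map_rcons -cats1 !map_cat /= mkl_cres mkl_anns /mkl /= ffunE.
  by apply: br_ext => k; rewrite entry_ucoef eqxx mul1r.
move=> m ml; rewrite -[RHS](br0 R (map (mkl P (ext_ffun i l u) (ext_ffun j m v)) (cres
  (inners n) ++ anns (rcons (inners n) o)))).
by apply: br_ext => k; rewrite entry_ucoef eq_sym (negbTE ml) mul0r.
Qed.

Lemma BR_left2 :
  BR R P (cres (inners n) ++ rcons (anns (inners n)) (true, o)) (ends (Some i) None)
    (ends (Some j) (Some l))
    (fun k => c *: ucoef R k oo (inners n)) =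
  \sum_u \sum_v br R (creW u ++ annW v ++ [:: Cre l (inl q)]) (vker c u v).
Proof.
rewrite /BR sum_ends1 exchange_big; apply: eq_bigr => u _.
rewrite (bigD1 l) //= [X in _ + X]big1 ?addr0.
  rewrite sum_ends2; apply: eq_bigr => v _.
  rewrite -cats1 !map_cat /= mkl_cres mkl_anns /mkl /= ffunE.
  by apply: br_ext => k; rewrite entry_ucoef eqxx mul1r.
move=> m ml; rewrite sum_ends2; apply: big1 => v _.
rewrite -[RHS](br0 R (map (mkl P (ext_ffun i m u) (ext_ffun j l v)) (cres (inners n) ++
  rcons (anns (inners n)) (true, o)))).
by apply: br_ext => k; rewrite entry_ucoef (negbTE ml) mul0r.
Qed.

End Word.

Section Word2.
Variables (koo q : K) (n : nat) (i j l : I) (c : C).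
Local Notation P := (@par K koo q n).

Lemma updU_ext (a b i' l' : I) (u : {ffun 'I_n -> I}) :
  upd (upd (ext_ffun i' l' u) o a) oo b = ext_ffun b a u.
Proof. by apply/ffunP => -[[x|]|]; rewrite !ffunE. Qed.

Lemma BR_right1 :
  BR R P ((false, o) :: cres (inners n) ++ anns (inners n)) (ends (Some i) (Some l))
    (ends (Some j) None)
    (fun k => Rab R k o oo *m (c *: ucoef R k oo (inners n))) =
  \sum_i' \sum_l' \sum_(u : {ffun 'I_n -> I}) \sum_(v : {ffun 'I_n -> I}) br R (Ann l'
    (inl q) :: creW u ++ annW v)
    (fun k => Rent R q koo l i l' i' * vker koo i' j c u v k).
Proof.
rewrite /BR sum_ends2.
transitivity (\sum_(u : {ffun 'I_n -> I}) \sum_m \sum_(v : {ffun 'I_n -> I}) \sum_i'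
  br R (Ann m (inl q) :: creW u ++ annW v)
    (fun k => Rent R q koo l i m i' * vker koo i' j c u v k)).
  apply: eq_bigr => u _; rewrite sum_ends1; apply: eq_bigr => m _; apply: eq_bigr => v _.
  rewrite -br_sum /= map_cat mkl_cres mkl_anns /mkl /= ffunE; apply: br_ext => k.
  rewrite entry_Rab_mul // (bigD1 m) //= [X in _ + X]big1 ?addr0.
    apply: eq_bigr => i' _; rewrite updU_ext entry_ucoef eqxx mul1r.
    by rewrite /ext_ffun !ffunE.
  move=> m' m'm; apply: big1 => i' _; rewrite updU_ext entry_ucoef.
  by rewrite (negbTE m'm) mul0r mulr0.
under eq_bigr => u _ do under eq_bigr => m _ do rewrite exchange_big /=.
under eq_bigr => u _ do rewrite exchange_big /=.
rewrite exchange_big /=; apply: eq_bigr => i' _; exact: exchange_big.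
Qed.

Lemma BR_right2 :
  BR R P (cres (rcons (inners n) o) ++ anns (inners n)) (ends (Some i) None) (ends (Some
    j) (Some l))
    (fun k => Rab R k oo o *m (c *: ucoef R k oo (inners n))) =
  \sum_i' \sum_l' \sum_(u : {ffun 'I_n -> I}) \sum_(v : {ffun 'I_n -> I}) br R (Cre l'
    (inl q) :: creW u ++ annW v)
    (fun k => Rent R koo q i l' i' l * vker koo i' j c u v k).
Proof.
rewrite /BR sum_ends1.
transitivity (\sum_m \sum_(u : {ffun 'I_n -> I}) \sum_(v : {ffun 'I_n -> I}) \sum_i'
  br R (Cre m (inl q) :: creW u ++ annW v)
    (fun k => Rent R koo q i m i' l * vker koo i' j c u v k)).
  apply: eq_bigr => m _; apply: eq_bigr => u _; rewrite sum_ends2; apply: eq_bigr => v _.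
  rewrite -br_sum cres_rcons /= map_cat mkl_cres mkl_anns /mkl /= ffunE; apply: br_ext => k.
  rewrite entry_Rab_mul //; apply: eq_bigr => i' _.
  rewrite (bigD1 l) //= [X in _ + X]big1 ?addr0.
    by rewrite updC // updU_ext entry_ucoef eqxx mul1r /ext_ffun !ffunE.
  move=> m' m'm; rewrite updC // updU_ext entry_ucoef.
  by rewrite (negbTE m'm) mul0r mulr0.
under eq_bigr => m _ do under eq_bigr => u _ do rewrite exchange_big /=.
under eq_bigr => m _ do rewrite exchange_big /=.
exact: exchange_big.
Qed.

End Word2.
End Convert.

(** * The series with coefficients U is well-bred *)

Section UWellBred.
Variables (K : realType) (N : nat) (R : Rmatrix K N).
Hypothesis hU : unitarity R.
Hypothesis hYB : yang_baxter R.
Local Notation I := 'I_N.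
Local Notation C := K[i].

Definition vsign (m : nat) : C := (-1) ^+ m / m`!%:R.

Lemma vsignS m : vsign m.+1 *+ m.+1 = - vsign m.
Proof.
rewrite -mulr_natr /vsign exprS factS natrM mulN1r !mulNr; congr (- _).
rewrite -mulrA; congr (_ * _); rewrite invfM mulrAC mulVf ?mul1r //.
by rewrite pnatr_eq0.
Qed.

Definition vterm koo (i j : I) m (u v : {ffun 'I_m -> I}) : term K N :=
  Term (creW K u ++ annW K v) (vker R koo i j (vsign m) u v).

(** The term of order 0 is a constant over [void], whereas the general formula gives it variables in
    ['I_0]; the hypothesis on [Phi] bridges the two types. *)
Lemma cls_vertex koo i j m (Phi : term K N -> term K N) :
  (forall a, cls R [:: Phi (@Term K N void [::] (fun=> a))] =
             cls R [:: Phi (@Term K N 'I_0 [::] (fun=> a))]) ->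
  cls R [seq Phi t | t <- vertex (uvertex R) koo i j m] =
  \sum_(u : {ffun 'I_m -> I}) \sum_(v : {ffun 'I_m -> I}) cls R [:: Phi (vterm koo i j u
    v)].
Proof.
case: m => [|m] HPhi.
  pose u0 : {ffun 'I_0 -> I} := [ffun x : 'I_0 => i].
  have uE (u : {ffun 'I_0 -> I}) : u = u0 by apply/ffunP => -[].
  rewrite (big_pred1 u0) => [|u]; last by rewrite /= (uE u) eqxx.
  rewrite (big_pred1 u0) => [|u]; last by rewrite /= (uE u) eqxx.
  rewrite /= HPhi /vterm.
  have E0 : enum 'I_0 = [::] by apply/size0nil; rewrite size_enum_ord.
  rewrite /creW /annW E0 /=; congr (cls R [:: Phi (Term _ _)]).
  apply/funext => k; rewrite /vker /vsign expr0 fact0 divr1 mul1r.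
  rewrite /uvertex /somes E0 /= entry_id; congr ((_ : bool)%:R).
  apply/eqP/eqP => [->//|/ffunP/(_ None)]; by rewrite !ffunE.
rewrite /vertex /escale /sandwich -map_comp map_allpairs cls_flatten big_enum.
by apply: eq_bigr => u _; rewrite cls_map big_enum.
Qed.

Definition void_ext (X : Type) (s : X + void) : X :=
  match s with inl x => x | inr v => match v with end end.

Definition ext_void (X : Type) (s : void + X) : X :=
  match s with inr x => x | inl v => match v with end end.

Lemma void_ext_bij X : bijective (@void_ext X).
Proof. by exists inl => [[x|[]]|x]. Qed.

Lemma ext_void_bij X : bijective (@ext_void X).
Proof. by exists inr => [[[]|x]|x]. Qed.

Lemma lrename_comp (X Y Z : Type) (f : Y -> Z) (g : X -> Y) (l : letter K N X) :
  lrename f (lrename g l) = lrename (f \o g) l.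
Proof. by case: l => [i [q|x]|i [q|x]]. Qed.

Lemma lrename_id (X : Type) (f : X -> X) (l : letter K N X) :
  f =1 id -> lrename f l = l.
Proof. by move=> fE; case: l => [i [q|x]|i [q|x]] //=; rewrite /lrename /= fE. Qed.

Lemma cls_tmul_r (X : finType) w (c : (X -> K) -> C) y :
  cls R [:: tmul (Term w c) (@Term K N void [:: y] (fun=> 1))] =
  br R (w ++ [:: lrename (of_void X) y]) c.
Proof.
rewrite [LHS](br_rename R _ _ (void_ext_bij X)) map_cat /= -map_comp.
have -> : map (lrename (@void_ext X) \o lrename inl) w = w.
  rewrite -[RHS]map_id; apply: eq_map => l /=.
  by rewrite lrename_comp lrename_id.
rewrite lrename_comp.
have -> : lrename (@void_ext X \o inr) y = lrename (of_void X) y.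
  by case: y => [i [q|[]]|i [q|[]]].
by apply: br_ext => k /=; rewrite mulr1.
Qed.

Lemma cls_tmul_l (X : finType) w (c : (X -> K) -> C) y r :
  cls R [:: Term (tword (tmul (@Term K N void [:: y] (fun=> 1)) (Term w c)))
     (fun k => r * @tker _ _ (tmul (@Term K N void [:: y] (fun=> 1)) (Term w c)) k)] =
  br R (lrename (of_void X) y :: w) (fun k => r * c k).
Proof.
rewrite [LHS](br_rename R _ _ (ext_void_bij X)) /= -map_comp.
have -> : map (lrename (@ext_void X) \o lrename inr) w = w.
  rewrite -[RHS]map_id; apply: eq_map => l /=.
  by rewrite lrename_comp lrename_id.
rewrite lrename_comp.
have -> : lrename (@ext_void X \o inl) y = lrename (of_void X) y.
  by case: y => [i [q|[]]|i [q|[]]].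
by apply: br_ext => k /=; rewrite mul1r.
Qed.

Lemma void_I0_bij : bijective (of_void 'I_0).
Proof.
have [f] : inhabited ('I_0 -> void) by constructor; case.
by exists f => [[]|[]].
Qed.

Lemma emul_r (e : expr K N) t : emul e [:: t] = [seq tmul s t | s <- e].
Proof. by rewrite /emul; elim: e => [|s e IH] //=; rewrite IH. Qed.

Lemma emul_l (e : expr K N) t : emul [:: t] e = [seq tmul t s | s <- e].
Proof. by rewrite /emul /= cats0. Qed.

Lemma emul_vertex koo i j m (y : letter K N void) :
  cls R (emul (vertex (uvertex R) koo i j m) [:: @Term K N void [:: y] (fun=> 1)]) =
  \sum_(u : {ffun 'I_m -> I}) \sum_(v : {ffun 'I_m -> I}) br R (creW K u ++ annW K v ++
    [:: lrename (of_void _) y])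
                  (vker R koo i j (vsign m) u v).
Proof.
rewrite emul_r (@cls_vertex _ _ _ _ (fun s => tmul s _)).
  by apply: eq_bigr => u _; apply: eq_bigr => v _; rewrite cls_tmul_r catA.
move=> a; rewrite !cls_tmul_r (br_rename R _ _ void_I0_bij) /= lrename_comp.
by congr (br R [:: _]); case: y => [l [q|[]]|l [q|[]]].
Qed.

Lemma emul_vertex_l r koo i j m (y : letter K N void) :
  cls R (escale r (emul [:: @Term K N void [:: y] (fun=> 1)] (vertex (uvertex R) koo i j
    m))) =
  \sum_(u : {ffun 'I_m -> I}) \sum_(v : {ffun 'I_m -> I}) br R (lrename (of_void _) y ::
    creW K u ++ annW K v)
                  (fun k => r * vker R koo i j (vsign m) u v k).
Proof.
rewrite emul_l /escale -map_comp (@cls_vertex _ _ _ _ (fun s =>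
  Term (tword (tmul _ s)) (fun k => r * @tker _ _ (tmul _ s) k))).
  by apply: eq_bigr => u _; apply: eq_bigr => v _; rewrite cls_tmul_l.
move=> a; rewrite !cls_tmul_l (br_rename R _ _ void_I0_bij) /= lrename_comp.
by congr (br R [:: _]); case: y => [l [q|[]]|l [q|[]]].
Qed.

Lemma zfeq_in_ideal p q (e : expr K N) : (p <= q)%N -> in_ideal q e -> in_ideal p e.
Proof.
move=> pq; apply: sub_all => t /andP[H1 H2]; rewrite (leq_trans pq H1) /=.
by move: H2; rewrite -(subnKC pq) takeD all_cat => /andP[].
Qed.

Lemma all_is_ann (X : Type) (T : Type) (F : T -> I) (G : T -> param K X) (s : seq T) :
  all (@is_ann K N X) [seq Ann (F a) (G a) | a <- s].
Proof. by elim: s. Qed.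

Lemma all_flatten (T : Type) (a : pred T) (ss : seq (seq T)) :
  all a (flatten ss) = all (all a) ss.
Proof. by elim: ss => //= s ss IH; rewrite all_cat IH. Qed.

Lemma cls_flatten2 (F : I -> I -> expr K N) :
  cls R (flatten [seq F x y | x <- enum I, y <- enum I]) =
  \sum_x \sum_y cls R (F x y).
Proof.
rewrite -[X in flatten X]map_id cls_flatten big_flatten big_map big_enum.
by apply: eq_bigr => x _; rewrite big_map big_enum.
Qed.

(** A n is the ordered term of order n and B n the contractions of order n+1. They are counted with
    order n on one side and one order later on the other, so the partial sums differ by the last B
    only. *)
Lemma telescope_shift (G : zmodType) (A B S S' : nat -> G) M :
  (forall n, S n = A n - B n) ->
  (forall n, S' n = A n + (if n is m.+1 then - B m else 0)) ->
  \sum_(n < M.+1) S n = \sum_(n < M.+1) S' n - B M.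
Proof.
move=> HS HS'; elim: M => [|M IH]; first by rewrite !big_ord1 HS HS' addr0.
rewrite big_ord_recr [in RHS]big_ord_recr /= IH HS HS'.
by rewrite !addrA; congr (_ - _); rewrite addrAC.
Qed.

Section BRExpr.
Variables (X L : finType) (P : L -> param K X).

(** An expression in the class of the bracket: membership in the ideal is a property of expressions,
    not of classes. *)
Definition BR_expr lw cu cv (M : (L -> K) -> Op K N L) : expr K N :=
  [seq Term (map (mkl P u v) lw) (fun k => entry (M (kv P k)) u v)
  | u <- enum (@agrees N L cu), v <- enum (@agrees N L cv)].

Lemma cls_BR_expr lw cu cv M : cls R (BR_expr lw cu cv M) = BR R P lw cu cv M.
Proof.
rewrite cls_flatten big_enum_cond /=.
apply: eq_big => [u|u _]; first by rewrite andbT.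
by rewrite cls_map big_enum_cond; apply: eq_bigl => v; rewrite andbT.
Qed.

Lemma BR_expr_ideal lw s cu cv M : in_ideal (size s) (BR_expr (lw ++ anns s) cu cv M).
Proof.
rewrite /in_ideal /BR_expr all_flatten all_map; apply/allP => u _ /=.
rewrite all_map; apply/allP => v _ /=.
have -> : map (mkl P u v) (lw ++ anns s) =
          map (mkl P u v) lw ++ [seq Ann (v a) (P a) | a <- s].
  by rewrite map_cat /anns -map_comp.
set w := map (mkl P u v) lw.
rewrite size_cat size_map leq_addl rev_cat take_cat size_rev size_map ltnn subnn.
by rewrite take0 cats0 all_rev all_is_ann.
Qed.

End BRExpr.

Lemma cls_psum (S : fseries K N) M : cls R (psum S M) = \sum_(n < M) cls R (S n).
Proof.
rewrite /psum cls_flatten -(big_mkord xpredT (fun n => cls R (S n))).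
by rewrite /index_iota subn0.
Qed.

Lemma BR_opp (X L : finType) (P : L -> param K X) lw cu cv
    (M : (L -> K) -> Op K N L) :
  BR R P lw cu cv (fun k => - M k) = - BR R P lw cu cv M.
Proof.
apply/eqP; rewrite -addr_eq0 BRD -[X in _ == X](BR0 R P lw cu cv).
by apply/eqP; apply: BR_ext => k u v _ _; rewrite addNr.
Qed.

Lemma BR_scaleN (X L : finType) (P : L -> param K X) lw cu cv m
    (M : (L -> K) -> Op K N L) :
  BR R P lw cu cv (fun k => vsign m.+1 *: M k) *+ m.+1 =
  - BR R P lw cu cv (fun k => vsign m *: M k).
Proof.
rewrite BR_muln -BR_opp; apply: BR_ext => k u v _ _; congr entry.
by rewrite scalerA mulr_natl vsignS scaleNr.
Qed.

Lemma uvertex_well_bred : well_bred R (vertex (uvertex R)).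
Proof.
(* The sums now run over the orders 0..M with M > p, and the boundary term has at least M
   annihilators on its right. *)
split => koo q i j l p; exists p.+2 => -[//|M] pM.
- exists [::].
  exists (BR_expr (@par K koo q M) (cres (inners M) ++ anns (rcons (inners M) o))
    (ends (Some i) (Some l)) (ends (Some j) None)
    (fun k => - (vsign M *: (Rab R k o oo *m ucoef R k oo (rcons (inners M) o))))).
  split=> //.
    apply: zfeq_in_ideal (BR_expr_ideal _ _ _ _ _ _).
    rewrite size_rcons /inners size_map size_enum_ord.
    exact: leq_trans (leqnSn p) (ltnW pM).
  apply/cls_eq; rewrite cats0 clsD cls_BR_expr !cls_psum.
  rewrite BR_opp.
  apply: (@telescope_shift _ (fun n => ord1 R koo q i j l (vsign n) n)
    (fun n => cross1 R koo q (vsign n) i j l n)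
    (fun n => cls R (emul (vertex (uvertex R) koo i j n) (ann l q)))
    (fun n => cls R (flatten
      [seq escale (Rent R q koo l i l' i')
             (emul (ann l' q) (vertex (uvertex R) koo i' j n))
      | i' <- enum 'I_N, l' <- enum 'I_N]))) => n.
    by rewrite ord1_cross // BR_left1 /ann emul_vertex.
  rewrite cls_flatten2.
  transitivity (BR R (@par K koo q n) ((false, o) :: cres (inners n) ++ anns (inners n))
    (ends (Some i) (Some l)) (ends (Some j) None)
    (fun k => Rab R k o oo *m (vsign n *: ucoef R k oo (inners n)))).
    rewrite BR_right1; apply: eq_bigr => i' _.
    by apply: eq_bigr => l' _; rewrite /ann emul_vertex_l.
  rewrite half1_normal //; congr (_ + _); case: n => // n.
  exact: BR_scaleN.
(* For the creator it is the left-hand side [L a^+] that has to be normal ordered, so the boundary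
   term is added on the left. *)
- exists (BR_expr (@par K koo q M) (cres (rcons (inners M) o) ++ anns (inners M))
    (ends (Some i) None) (ends (Some j) (Some l))
    (fun k => - (vsign M *: ucoef R k oo (rcons (inners M) o)))).
  exists [::]; split=> //.
    apply: zfeq_in_ideal (BR_expr_ideal _ _ _ _ _ _).
    by rewrite /inners size_map size_enum_ord; exact: ltnW.
  apply/cls_eq; rewrite cats0 clsD cls_BR_expr !cls_psum.
  rewrite BR_opp; apply: esym.
  apply: (@telescope_shift _ (fun n => ord2 R koo q i j l (vsign n) n)
    (fun n => cross2 R koo q (vsign n) i j l n)
    (fun n => cls R (flatten
      [seq escale (Rent R koo q i l' i' l)
             (emul (cre l' q) (vertex (uvertex R) koo i' j n))
      | i' <- enum 'I_N, l' <- enum 'I_N]))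
    (fun n => cls R (emul (vertex (uvertex R) koo i j n) (cre l q)))) => n.
    rewrite ord2_cross // BR_right2 cls_flatten2.
    apply: eq_bigr => i' _.
    by apply: eq_bigr => l' _; rewrite /cre emul_vertex_l.
  rewrite /cre emul_vertex -BR_left2 half2_normal //; congr (_ + _).
  by case: n => // n; exact: BR_scaleN.
Qed.

End UWellBred.

(** * Sandwiches, and the recursion as an identity of operators *)

Section SameOperator.
Variables (K : realType) (N : nat) (R : Rmatrix K N).
Hypothesis hU : unitarity R.
Hypothesis hYB : yang_baxter R.
Local Notation I := 'I_N.
Local Notation C := K[i].
Local Notation "''V_' L" := {ffun L -> I} (at level 8, L at level 2).

Lemma BR_sum (X L : finType) (P : L -> param K X) lw cu cv (T : finType)
    (M : T -> (L -> K) -> Op K N L) :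
  BR R P lw cu cv (fun k => \sum_t M t k) = \sum_t BR R P lw cu cv (M t).
Proof.
elim: (index_enum T) => [|t r IH].
  rewrite big_nil -[RHS](BR0 R P lw cu cv); apply: BR_ext => k u v _ _.
  by rewrite big_nil.
rewrite big_cons -IH BRD; apply: BR_ext => k u v _ _.
by rewrite big_cons.
Qed.

Lemma BR_rename (X Y L : finType) (f : X -> Y) (P : L -> param K X) lw cu cv
    (M : (L -> K) -> Op K N L) : bijective f ->
  BR R P lw cu cv M = BR R (psubst (fun x => inr (f x)) \o P) lw cu cv M.
Proof.
move=> fB; apply: eq_bigr => u _; apply: eq_bigr => v _.
rewrite (br_rename R _ _ fB) -map_comp.
have -> : map (lrename f \o mkl P u v) lw =
          map (mkl (psubst (fun x => inr (f x)) \o P) u v) lw.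
  by apply: eq_map => -[[] a].
apply: br_ext => k; congr (entry (M _) _ _); apply/funext => a.
by rewrite /kv /=; case: (P a).
Qed.

Section Sandwich.
Variables (koo : K) (n : nat) (i j : I).

Definition spar (a : option 'I_n) : param K 'I_n :=
  if a is Some x then inr x else inl koo.

Definition at_oo (x : I) (a : option 'I_n) : option I := if a is None then Some x else None.

Definition sandwich_br w (M : coef K N n) : zfmod R := BR R spar (cres w ++ anns w)
  (at_oo i) (at_oo j) M.

Lemma sum_at_oo (G : zmodType) x (F : 'V_(option 'I_n) -> G) :
  \sum_(w | agrees (at_oo x) w) F w =
  \sum_(u : {ffun 'I_n -> I}) F [ffun a => with_oo x u a].
Proof.
rewrite (reindex_onto (fun u : {ffun 'I_n -> I} => [ffun a => with_oo x u a])
   (fun w : 'V_(option 'I_n) => [ffun a => w (Some a)])) /=.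
  apply: eq_bigl => u; apply/andP; split.
    by apply/agreesP => -[a|] y //= [<-]; rewrite ffunE.
  by apply/eqP/ffunP => a; rewrite !ffunE.
move=> w /agreesP H; apply/ffunP => -[a|]; rewrite !ffunE.
  by rewrite /= ffunE.
by apply/esym/H.
Qed.

Lemma cls_sandwich (T : coef K N n) : cls R (sandwich T koo i j) = sandwich_br (somes n) T.
Proof.
rewrite cls_flatten big_enum /sandwich_br /BR sum_at_oo; apply: eq_bigr => u _.
rewrite cls_map big_enum sum_at_oo; apply: eq_bigr => v _.
rewrite -/(br R _ _) map_cat; congr (br R (_ ++ _) _).
- rewrite /cres !map_rev -!map_comp; congr rev.
  by apply: eq_map => a; rewrite /mkl /= ffunE.
- by rewrite /anns -!map_comp; apply: eq_map => a; rewrite /mkl /= ffunE.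
apply/funext => k; congr (entry (T _) _ _).
by apply/funext => -[a|].
Qed.

(** Reordering the annihilators multiplies the kernel by [Mx] on the right, and reordering the
    creators removes [Mx] on the left: together they conjugate it. *)
Lemma sandwich_br_swaps w s Mx (M : coef K N n) : swaps R w s Mx -> uniq w -> None \notin
  w ->
  sandwich_br w (fun k => invmx (Mx k) *m M k *m Mx k) = sandwich_br s M.
Proof.
move=> H uw nw; have dwN x (a : option 'I_n) : a \in w -> at_oo x a = None.
  by case: a nw => // /negP.
have un : uniq (cres w ++ anns w ++ [::]).
  by apply: uniq_sel; rewrite !selE /= ?cats0 ?rev_uniq.
have pw : perm_eq w s := reorder_perm (swaps_reorder (fun=> 0) H).
have un' : uniq ([::] ++ cres w ++ anns s).
  by apply: uniq_sel; rewrite !selE /= ?cats0 ?rev_uniq // -(perm_uniq pw).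
rewrite /sandwich_br -[anns w]cats0 -(BR_swaps_ann _ _ _ H un (dwN j)) cats0.
rewrite -[cres w ++ _]cat0s -(BR_swaps_cre hU _ _ _ H un' (dwN i)).
apply: BR_ext => k u v _ _; congr entry.
by rewrite mulmxA mulmxV ?mul1mx // (reorder_unit hU hYB (swaps_reorder _ H)).
Qed.

Lemma sandwich_br_perm (s : 'S_n) (M : coef K N n) :
  sandwich_br [seq Some (s a) | a <- enum 'I_n] (Tplace M s) = sandwich_br (somes n) M.
Proof.
have sI : injective (omap s) by apply: omap_inj; apply: perm_inj.
have codomT a : a \in codom (omap s).
  case: a => [a|]; last by apply/codomP; exists None.
  by apply/codomP; exists (Some ((s^-1)%g a)); rewrite /= permKV.
have mapE : [seq Some (s a) | a <- enum 'I_n] = map (omap s) (somes n).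
  by rewrite /somes -[RHS]map_comp.
rewrite /sandwich_br.
have -> : cres [seq Some (s a) | a <- enum 'I_n] ++ anns [seq Some (s a) | a <- enum 'I_n] =
  map (relab (omap s)) (cres (somes n) ++ anns (somes n)).
  by rewrite mapE map_cat /cres /anns -!map_rev -!map_comp.
rewrite (@BR_relabel _ _ R _ _ _ (omap s) spar sI [ffun=> i] _ _ _ _ M).
- rewrite [RHS](BR_rename _ _ _ _ (f := s)); last first.
    by exists (s^-1)%g => x; rewrite ?permK ?permKV.
  by congr (BR R _ _ _ _ _); apply/funext => -[a|].
- by move=> a; rewrite codomT.
- by move=> a; rewrite codomT.
by [].
Qed.

(** Renaming the integration variables by [s] permutes the copies of the kernel, and reordering both
    halves conjugates it back. Applied to each summand of the recursion, this leaves a single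
    operator per sum. *)
Lemma sandwich_br_conj (s : 'S_n) (M : coef K N n) :
  sandwich_br (somes n) (fun k => invmx (Rsigma R k s) *m Tplace M s k *m Rsigma R k s) =
  sandwich_br (somes n) M.
Proof.
rewrite -[RHS](sandwich_br_perm s) (sandwich_br_swaps (Mx := fun k => Rsigma R k s)
  (Tplace M s)
  (exchange_swaps R (perm_somes s))) //.
- exact: uniq_somes.
- exact: None_somes.
Qed.

End Sandwich.

Lemma pperm_max n (x : 'I_n) : pperm ord_max (lift ord_max x) = lift ord0 x :> 'I_n.+1.
Proof. by rewrite /pperm lift_perm_lift perm1. Qed.

Lemma Tplace_comp n m (p : nat) (T : coef K N n) (f : 'I_n -> 'I_m) (s : 'I_m -> 'I_p) :
  injective s -> forall k, Tplace (Tplace T f) s k = Tplace T (s \o f) k.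
Proof.
move=> sI k; rewrite /Tplace place_place; last exact: omap_inj.
have -> : (k \o omap s) \o omap f = k \o omap (s \o f).
  by apply/funext => -[a|].
by apply: place_ext => -[a|].
Qed.

Section Recursion.
Variables (koo : K) (n : nat) (i j : I) (T : coef K N n).
Local Notation W := (sandwich_br koo i j).

(** The two operators to which the sums of the recursion reduce. In [tailm] the letter paired with
    infinity comes last, because [pperm ord_max] sends the last position to 0: renaming by
    [pperm ord_max * s] puts [s ord0] there. *)
Definition tail0 : coef K N n.+1 := Tplace T (lift ord0).
Definition tailm : coef K N n.+1 := fun k =>
  Rab R k None (Some ord_max) *m Tplace T (lift ord_max) k.

(** The hypothesis is required for every scalar c because the classes form only an abelian group:
    the factor 1/f is distributed inside the kernels, and the f equal terms are then collected
    there. *)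
Lemma sandwich_br_mean m (F : finType) f (M : F -> coef K N m) (X : coef K N m) :
  (forall c t, W (somes m) (fun k => c *: M t k) = W (somes m) (fun k => c *: X k)) ->
  #|F| = f -> (0 < f)%N ->
  W (somes m) (fun k => f%:R^-1 *: \sum_t M t k) = W (somes m) X.
Proof.
move=> H Ff F0; transitivity (W (somes m) (fun k => \sum_t f%:R^-1 *: M t k)).
  by apply: BR_ext => k u v _ _; rewrite scaler_sumr.
rewrite /sandwich_br BR_sum; under eq_bigr do rewrite -/(sandwich_br _ _ _ _ _) H.
rewrite sumr_const Ff BR_muln; apply: BR_ext => k u v _ _; congr entry.
by rewrite scalerA mulfV ?scale1r // pnatr_eq0 -lt0n.
Qed.

Lemma sandwich_br_vertex_coefS :
  W (somes n.+1) (vertex_coefS R T) = W (somes n.+1) tail0 - W (somes n.+1) tailm.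
Proof.
have tailE (s : 'S_n.+1) k : Ttail T s k = Tplace tail0 s k.
  rewrite /Ttail /tail0 Tplace_comp //; exact: perm_inj.
have conjZ (s : 'S_n.+1) c (X : coef K N n.+1) :
    W (somes n.+1) (fun k => c *: (invmx (Rsigma R k s) *m Tplace X s k *m Rsigma R k s)) =
    W (somes n.+1) (fun k => c *: X k).
  rewrite -[RHS](sandwich_br_conj koo i j s); apply: BR_ext => k u v _ _; congr entry.
  by rewrite /Tplace placeZ -scalemxAr -scalemxAl.
apply/eqP; rewrite eq_sym subr_eq; apply/eqP.
pose M1 (t : 'I_n.+1) k :=
  invmx (Rsigma R k (pperm t)) *m Ttail T (pperm t) k *m Rsigma R k (pperm t).
pose M2 (s : 'S_n.+1) k := invmx (Rsigma R k (pperm ord_max * s)%g) *m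
  Rab R k None (Some (s ord0)) *m Ttail T s k *m Rsigma R k (pperm ord_max * s)%g.
have E1 : W (somes n.+1) (fun k => n.+1%:R^-1 *: \sum_t M1 t k) = W (somes n.+1) tail0.
  apply: (@sandwich_br_mean _ _ _ M1 tail0 _ (card_ord _) (ltn0Sn _)) => c t.
  rewrite -[RHS](conjZ (pperm t)).
  by apply: BR_ext => k u v _ _; rewrite /M1 tailE.
have M2E (s : 'S_n.+1) k : Rab R k None (Some (s ord0)) *m Ttail T s k =
    Tplace tailm (pperm ord_max * s)%g k.
  set t := (pperm ord_max * s)%g.
  have tI : injective (omap t) by apply: omap_inj; apply: perm_inj.
  rewrite [RHS]/Tplace /tailm (place_mul tI) (place_Rab R _ _ _ tI) /=.
  have -> : t ord_max = s ord0 by rewrite /t permM /pperm lift_perm_id.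
  congr (_ *m _).
  rewrite -/(Tplace (Tplace T (lift ord_max)) t k) Tplace_comp; last exact: perm_inj.
  rewrite /Ttail; congr (Tplace T _ k).
  by apply/funext => a; rewrite /= /t permM pperm_max.
have E2 : W (somes n.+1) (fun k => (n.+1)`!%:R^-1 *: \sum_s M2 s k) = W (somes n.+1) tailm.
  apply: (@sandwich_br_mean _ _ _ M2 tailm _ (card_Sn _) (fact_gt0 _)) => c s.
  rewrite -[RHS](conjZ (pperm ord_max * s)%g).
  apply: BR_ext => k u v _ _; rewrite -M2E /M2.
  by rewrite mulmxA.
rewrite -E1 -E2 /sandwich_br BRD; apply: BR_ext => k u v _ _; congr entry.
by rewrite /vertex_coefS subrK.
Qed.

End Recursion.

Lemma somesS n : somes n.+1 = Some ord0 :: map (omap (lift ord0)) (somes n).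
Proof. by rewrite /somes enum_ordSl /= -!map_comp. Qed.

Lemma uvertex_recursion n : same_operator R (@uvertex _ _ R n.+1) (vertex_coefS R
  (uvertex R (n := n))).
Proof.
move=> koo i j; apply/cls_eq; rewrite !cls_sandwich sandwich_br_vertex_coefS.
set s := map (omap (lift ord0)) (somes n).
have lI : injective (omap (lift (@ord0 n))) by apply: omap_inj; apply: lift_inj.
have mI : injective (omap (lift (@ord_max n))) by apply: omap_inj; apply: lift_inj.
have sE : somes n.+1 = Some ord0 :: s by rewrite somesS.
have E0 k : tail0 (uvertex R (n := n)) k = ucoef R k None s.
  by rewrite /tail0 /Tplace /uvertex (place_ucoef R _ _ _ lI).
have un : uniq (None :: Some ord0 :: s) by rewrite -sE /= None_somes uniq_somes.
have os : Some ord0 \notin s by case/and3P: un.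
apply/eqP; rewrite eq_sym subr_eq; apply/eqP.
have pm : pperm (@ord_max n) ord_max = ord0 by rewrite /pperm lift_perm_id.
have mE k : invmx (Rpass R k (Some ord0) s) = Rpass_inv R k (Some ord0) s.
  by apply: invmx_eq; exact: RpassK.
have tE k : Tplace (tailm (uvertex R (n := n))) (pperm ord_max) k =
    Rab R k None (Some ord0) *m ucoef R k None s.
  have tI : injective (omap (pperm (@ord_max n))) by apply: omap_inj; apply: perm_inj.
  rewrite /Tplace /tailm (place_mul tI) (place_Rab R _ _ _ tI) [omap _ (Some _)]/= pm
    [omap _ None]/=.
  congr (_ *m _).
  rewrite -/(Tplace (Tplace (uvertex R (n := n)) (lift ord_max)) (pperm ord_max) k).
  rewrite Tplace_comp; last exact: perm_inj.
  rewrite -E0 /tail0; congr (Tplace _ _ k).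
  by apply/funext => a; rewrite /= pperm_max.
(* Renamed by [pperm ord_max], [tailm] acts on the word 1..n,0. Bringing 0 to the front conjugates
   it by [Rpass], which is the second term in the definition of [ucoef]. *)
have -> : sandwich_br koo i j (somes n.+1) (tailm (uvertex R (n := n))) =
  sandwich_br koo i j (somes n.+1) (fun k => Rpass_inv R k (Some ord0) s *m
     (Rab R k None (Some ord0) *m ucoef R k None s) *m Rpass R k (Some ord0) s).
  rewrite -(sandwich_br_perm _ _ _ (pperm ord_max)) [in RHS]sE.
  have -> : [seq Some (pperm ord_max a) | a <- enum 'I_n.+1] = rcons s (Some ord0).
    rewrite enum_ordSr map_rcons pm /s /somes -!map_comp; congr rcons.
    apply: eq_map => a /=; congr Some; rewrite -pperm_max.
    by congr (fun_of_perm _ _); apply: val_inj; rewrite /= /bump leqNgt ltn_ord add0n.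
  rewrite -(sandwich_br_swaps _ _ _ _ (swaps_Rpass R (Some ord0) s)); first last.
  - by case/andP: un.
  - by case/andP: un.
  by apply: BR_ext => k u v _ _; rewrite tE mE.
rewrite /sandwich_br BRD; apply: BR_ext => k u v _ _; congr entry.
rewrite E0 /uvertex sE /= !mulmxA.
by rewrite subrK.
Qed.

End SameOperator.

(** * Annihilation and creation operators on the Fock space *)

Section Fock.
Variables (K : realType) (N : nat) (R : Rmatrix K N).
Hypothesis hU : unitarity R.
Hypothesis hYB : yang_baxter R.
Local Notation I := 'I_N.
Local Notation C := K[i].
Local Notation "''V_' L" := {ffun L -> I} (at level 8, L at level 2).

Lemma Rent_unit (x y : K) (a b i j : I) :
  \sum_i1 \sum_j1 Rent R x y a b i1 j1 * Rent R y x j1 i1 j i = ((a == i) && (b == j))%:R.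
Proof.
pose L : finType := 'I_2; pose p : L := ord0; pose q : L := ord_max.
pose k : L -> K := duo x y.
pose st (u v : I) : 'V_L := [ffun z => duo u v z].
have pq : p != q by []. have qp : q != p by [].
have stp u v : st u v p = u by rewrite ffunE.
have stq u v : st u v q = v by rewrite ffunE.
have := congr1 (fun M => entry M (st a b) (st i j)) (Rab_unit hU k pq).
rewrite entry_Rab_mul // entry_id /=.
have -> : (st a b == st i j) = (a == i) && (b == j).
  apply/eqP/andP => [/ffunP E|[/eqP -> /eqP ->] //].
  by have := E p; have := E q; rewrite !stp !stq => -> ->; rewrite !eqxx.
move=> <-; apply: eq_bigr => i1 _; apply: eq_bigr => j1 _.
rewrite entry_Rab; have -> : off (duo q p) (upd (upd (st a b) p i1) q j1) (st i j).
  by apply/offP => -[[|[|//]] z]; rewrite codom_duo.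
by rewrite !stp !stq upd_same (upd_other _ _ pq) upd_same.
Qed.

Lemma Rent_YB (x y z : K) (a b c a' b' c' : I) :
  \sum_a1 \sum_b1 \sum_c1
    Rent R x y a b a1 b1 * Rent R x z a1 c a' c1 * Rent R y z b1 c1 b' c' =
  \sum_a1 \sum_b1 \sum_c1
    Rent R y z b c b1 c1 * Rent R x z a c1 a1 c' * Rent R x y a1 b1 a' b'.
Proof.
pose L : finType := 'I_3.
pose l1 : L := @Ordinal 3 0 isT; pose l2 : L := @Ordinal 3 1 isT; pose l3 : L := @Ordinal
  3 2 isT.
pose k : L -> K := trio x y z.
pose st (u v w : I) : 'V_L := [ffun l => trio u v w l].
have h12 : l1 != l2 by []. have h13 : l1 != l3 by []. have h23 : l2 != l3 by [].
have upd1 u v w i : upd (st u v w) l1 i = st i v w.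
  by apply/ffunP => -[[|[|[|//]]] ?]; rewrite !ffunE.
have upd2 u v w i : upd (st u v w) l2 i = st u i w.
  by apply/ffunP => -[[|[|[|//]]] ?]; rewrite !ffunE.
have upd3 u v w i : upd (st u v w) l3 i = st u v i.
  by apply/ffunP => -[[|[|[|//]]] ?]; rewrite !ffunE.
have st1 u v w : st u v w l1 = u by rewrite ffunE.
have st2 u v w : st u v w l2 = v by rewrite ffunE.
have st3 u v w : st u v w l3 = w by rewrite ffunE.
have off12 u v w u' v' w' : off (duo l1 l2) (st u v w) (st u' v' w') = (w == w').
  apply/offP/eqP => [/(_ l3)|E l]; first by rewrite !st3 codom_duo => ->.
  rewrite codom_duo negb_or; case: l => -[|[|[|//]]] ?; rewrite ?andbF //= => _.
  by rewrite !ffunE.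
have off23 u v w u' v' w' : off (duo l2 l3) (st u v w) (st u' v' w') = (u == u').
  apply/offP/eqP => [/(_ l1)|E l]; first by rewrite !st1 codom_duo => ->.
  rewrite codom_duo negb_or; case: l => -[|[|[|//]]] ?; rewrite ?andbF //= => _.
  by rewrite !ffunE.
have := congr1 (fun M => entry M (st a b c) (st a' b' c')) (Rab_YB hYB k h12 h13 h23).
rewrite -!mulmxA !entry_Rab_mul //.
under eq_bigr => i1 _ do under eq_bigr => j1 _ do rewrite upd1 upd2 entry_Rab_mul //.
under [X in _ = X]eq_bigr => i1 _ do under eq_bigr => j1 _ do rewrite upd2 upd3
  entry_Rab_mul //.
rewrite !st1 !st2 !st3 => E.
transitivity (\sum_i1 \sum_j1 Rent R x y a b i1 j1 *
  \sum_i \sum_j Rent R x z i1 c i j *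
     (if i == a' then Rent R y z j1 j b' c' else 0)).
  apply: eq_bigr => i1 _; apply: eq_bigr => j1 _.
  rewrite [in RHS](bigD1 a') //= [X in _ = _ * (_ + X)]big1 ?addr0; last first.
    by move=> i /negbTE ia; apply: big1 => j _; rewrite ia mulr0.
  by rewrite mulr_sumr; apply: eq_bigr => j _; rewrite eqxx mulrA.
transitivity (\sum_i1 \sum_j1 Rent R y z b c i1 j1 *
  \sum_i \sum_j Rent R x z a j1 i j *
     (if j == c' then Rent R x y i i1 a' b' else 0)); last first.
  rewrite [RHS]exchange_big; apply: eq_bigr => i1 _ /=.
  rewrite [RHS]exchange_big; apply: eq_bigr => j1 _ /=.
  rewrite mulr_sumr; apply: eq_bigr => i _.
  rewrite [in LHS](bigD1 c') //= [X in _ * (_ + X) = _]big1 ?addr0; last first.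
    by move=> j /negbTE jc; rewrite jc mulr0.
  by rewrite eqxx mulrA.
move: E.
under [X in X = _ -> _]eq_bigr => i1 _ do under eq_bigr => j1 _ do
  (under eq_bigr => i _ do under eq_bigr => j _ do
     rewrite upd1 upd3 entry_Rab off23 !st1 !st2 !st3).
under [X in _ = X -> _]eq_bigr => i1 _ do under eq_bigr => j1 _ do
  (under eq_bigr => i _ do under eq_bigr => j _ do
     rewrite upd1 upd3 entry_Rab off12 !st1 !st2 !st3).
exact.
Qed.

(* Points (k, m) with different [m] carry the same spectral parameter [k].  A state
   phi is recorded by its values phi [x1; x2; ...; xr] = <0| a_xr ... a_x2 a_x1 |phi>. *)
Definition pt : choiceType := (K * nat)%type.
Definition ix : Type := (I * pt)%type.
Definition state : Type := seq ix -> C.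
Implicit Types (phi psi : state) (w : seq ix) (p q : pt).

Definition an (i : I) p phi : state := fun w => phi ((i, p) :: w).

(* The value <0| a_w a^+_q |phi> computed by moving a^+_q to the left vacuum. *)
Fixpoint cr_rec w (j : I) q phi : C :=
  if w is (i, p) :: w' then
    \sum_i' \sum_j' Rent R p.1 q.1 i j' i' j * cr_rec w' j' q (an i' p phi) +
    ((i == j) && (p == q))%:R * phi w'
  else 0.

Definition cr j q phi : state := fun w => cr_rec w j q phi.

Lemma cr_cons i p w j q phi : cr j q phi ((i, p) :: w) =
  \sum_i' \sum_j' Rent R p.1 q.1 i j' i' j * cr j' q (an i' p phi) w +
  ((i == j) && (p == q))%:R * phi w.
Proof. by []. Qed.

Lemma cr_ext j q phi psi : phi =1 psi -> cr j q phi =1 cr j q psi.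
Proof.
move=> E w; elim: w j phi psi E => [//|[i p] w IH] j phi psi E.
rewrite !cr_cons E; congr (_ + _); apply: eq_bigr => i' _; apply: eq_bigr => j' _.
by congr (_ * _); apply: IH => w'; rewrite /an E.
Qed.

Lemma cr_sum (T : Type) (r : seq T) (a : T -> C) (F : T -> state) j q w :
  cr j q (fun w => \sum_(t <- r) a t * F t w) w = \sum_(t <- r) a t * cr j q (F t) w.
Proof.
elim: w j F => [|[i p] w IH] j F.
  by rewrite /cr /= big1 // => t _; rewrite mulr0.
rewrite cr_cons; under [in RHS]eq_bigr do rewrite cr_cons mulrDr.
rewrite big_split /=; congr (_ + _); last first.
  by rewrite mulr_sumr; apply: eq_bigr => t _; rewrite mulrCA.
under [in RHS]eq_bigr do rewrite mulr_sumr.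
rewrite [RHS]exchange_big; apply: eq_bigr => i' _ /=.
under [in RHS]eq_bigr do rewrite mulr_sumr.
rewrite [RHS]exchange_big; apply: eq_bigr => j' _ /=.
rewrite (IH _ (fun t => an i' p (F t))) mulr_sumr.
by apply: eq_bigr => t _; rewrite mulrCA.
Qed.

Lemma cr0 j q phi w : phi =1 (fun=> 0) -> cr j q phi w = 0.
Proof.
move=> E; rewrite (cr_ext _ _ E); elim: w j {E} => [//|[i p] w IH] j.
rewrite cr_cons mulr0 addr0 big1 // => i' _; rewrite big1 // => j' _.
by rewrite [cr _ _ _ _]IH mulr0.
Qed.

Lemma cr_sum2 (a : I -> I -> C) (F : I -> I -> state) j q w :
  cr j q (fun w => \sum_s \sum_t a s t * F s t w) w =
  \sum_s \sum_t a s t * cr j q (F s t) w.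
Proof.
rewrite pair_big -(cr_sum _ (fun z => a z.1 z.2) (fun z => F z.1 z.2)).
by apply: cr_ext => w'; rewrite pair_big.
Qed.

Lemma cr_sum2D (a : I -> I -> C) (F : I -> I -> state) b G j q w :
  cr j q (fun w => \sum_s \sum_t a s t * F s t w + b * G w) w =
  \sum_s \sum_t a s t * cr j q (F s t) w + b * cr j q G w.
Proof.
have := cr_sum (None :: map Some (index_enum (I * I)%type))
  (fun o => if o is Some z then a z.1 z.2 else b)
  (fun o => if o is Some z then F z.1 z.2 else G) j q w.
rewrite big_cons big_map /= -(pair_big xpredT xpredT (fun s t => a s t * cr j q (F s t)
  w)) /= addrC => <-.
apply: cr_ext => w'; rewrite big_cons big_map addrC; congr (_ + _).
by rewrite pair_big.
Qed.

Lemma sum_nest3 (P Q T : finType) (X : P -> C) (Y : P -> Q -> C) (Z : P -> Q -> T -> C) :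
  \sum_s X s * (\sum_t Y s t * (\sum_r Z s t r)) =
  \sum_(z : P * Q * T) X z.1.1 * (Y z.1.1 z.1.2 * Z z.1.1 z.1.2 z.2).
Proof.
rewrite -(pair_big xpredT xpredT (fun (st : P * Q) r => X st.1 * (Y st.1 st.2 * Z st.1
  st.2 r))) /=.
rewrite -(pair_big xpredT xpredT (fun s t => \sum_r X s * (Y s t * Z s t r))) /=.
apply: eq_bigr => s _; rewrite mulr_sumr; apply: eq_bigr => t _.
by rewrite !mulr_sumr.
Qed.

(** Yang-Baxter contracted with a function of the three remaining indices, the sums being nested as
    unfolding two creators nests them. After reindexing, [e] collects the arguments of [G] and [m]
    the three indices internal to Yang-Baxter. *)
Lemma Rent_YB_rows (x y z : K) (a b' c' : I) (G : I -> I -> I -> C) :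
  \sum_c1 \sum_b1 Rent R y z b1 c1 b' c' *
    (\sum_a1 \sum_b Rent R x y a b a1 b1 *
      (\sum_a' \sum_c Rent R x z a1 c a' c1 * G a' b c)) =
  \sum_a1 \sum_c1 Rent R x z a c1 a1 c' *
    (\sum_a' \sum_b1 Rent R x y a1 b1 a' b' *
      (\sum_c \sum_b Rent R y z b c b1 c1 * G a' b c)).
Proof.
under eq_bigr => c1 _ do under eq_bigr => b1 _ do rewrite pair_big /=.
rewrite pair_big /=; under eq_bigr => s _ do under [X in _ * X]eq_bigr => t _ do rewrite
  pair_big /=.
under [RHS]eq_bigr => c1 _ do under eq_bigr => b1 _ do rewrite pair_big /=.
rewrite [RHS]pair_big /=; under [RHS]eq_bigr => s _ do under [X in _ * X]eq_bigr => t _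
  do rewrite pair_big /=.
rewrite !sum_nest3.
pose Y3 := (I * I * I)%type.
transitivity (\sum_(e : Y3) \sum_(m : Y3) G e.1.1 e.1.2 e.2 *
  (Rent R x y a e.1.2 m.1.1 m.1.2 * Rent R x z m.1.1 e.2 e.1.1 m.2 * Rent R y z m.1.2 m.2
    b' c')).
  rewrite pair_big /= (reindex (fun f : Y3 * Y3 =>
    ((f.2.2, f.2.1.2), (f.2.1.1, f.1.1.2), (f.1.1.1, f.1.2)))) /=; last first.
    exists (fun z => ((z.2.1, z.1.2.2, z.2.2), (z.1.2.1, z.1.1.2, z.1.1.1))).
      by move=> [[[a1 a2] a3] [[a4 a5] a6]].
    by move=> [[[a1 a2] [a3 a4]] [a5 a6]].
  by apply: eq_bigr => -[[[a1 a2] a3] [[a4 a5] a6]] _ /=; ring.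
transitivity (\sum_(e : Y3) \sum_(m : Y3) G e.1.1 e.1.2 e.2 *
  (Rent R y z e.1.2 e.2 m.1.2 m.2 * Rent R x z a m.2 m.1.1 c' * Rent R x y m.1.1 m.1.2
    e.1.1 b')).
  apply: eq_bigr => -[[a' b] c] _ /=; rewrite -!mulr_sumr; congr (_ * _).
  have := Rent_YB x y z a b c a' b' c'.
  rewrite pair_big /= pair_big /= => ->.
  by rewrite pair_big /= pair_big.
rewrite pair_big /= [RHS](reindex (fun f : Y3 * Y3 =>
    ((f.2.1.1, f.2.2), (f.1.1.1, f.2.1.2), (f.1.2, f.1.1.2)))) /=; last first.
  exists (fun z => ((z.1.2.1, z.2.2, z.2.1), (z.1.1.1, z.1.2.2, z.1.1.2))).
    by move=> [[[a1 a2] a3] [[a4 a5] a6]].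
  by move=> [[[a1 a2] [a3 a4]] [a5 a6]].
by apply: eq_bigr => -[[[a1 a2] a3] [[a4 a5] a6]] _ /=; ring.
Qed.

(** The variant for one creator crossing two letters, as needed in [sym_cr]. *)
Lemma Rent_YB_cols (x y z : K) (a b c' : I) (G : I -> I -> I -> C) :
  \sum_a1 \sum_c1 Rent R x z a c1 a1 c' *
    (\sum_b1 \sum_c Rent R y z b c b1 c1 *
      (\sum_b' \sum_a' Rent R x y a1 b1 a' b' * G c a' b')) =
  \sum_b1 \sum_a1 Rent R x y a b a1 b1 *
    (\sum_b' \sum_c1 Rent R y z b1 c1 b' c' *
      (\sum_a' \sum_c Rent R x z a1 c a' c1 * G c a' b')).
Proof.
under eq_bigr => c1 _ do under eq_bigr => b1 _ do rewrite pair_big /=.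
rewrite pair_big /=; under eq_bigr => s _ do under [X in _ * X]eq_bigr => t _ do rewrite
  pair_big /=.
under [RHS]eq_bigr => c1 _ do under eq_bigr => b1 _ do rewrite pair_big /=.
rewrite [RHS]pair_big /=; under [RHS]eq_bigr => s _ do under [X in _ * X]eq_bigr => t _
  do rewrite pair_big /=.
rewrite !sum_nest3.
pose Y3 := (I * I * I)%type.
transitivity (\sum_(e : Y3) \sum_(m : Y3) G e.2 e.1.1 e.1.2 *
  (Rent R y z b e.2 m.1.2 m.2 * Rent R x z a m.2 m.1.1 c' * Rent R x y m.1.1 m.1.2 e.1.1
    e.1.2)).
  rewrite pair_big /= (reindex (fun f : Y3 * Y3 =>
    ((f.2.1.1, f.2.2), (f.2.1.2, f.1.2), (f.1.1.2, f.1.1.1)))) /=; last first.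
    exists (fun z => ((z.2.2, z.2.1, z.1.2.2), (z.1.1.1, z.1.2.1, z.1.1.2))).
      by move=> [[[a1 a2] a3] [[a4 a5] a6]].
    by move=> [[[a1 a2] [a3 a4]] [a5 a6]].
  by apply: eq_bigr => -[[[a1 a2] a3] [[a4 a5] a6]] _ /=; ring.
transitivity (\sum_(e : Y3) \sum_(m : Y3) G e.2 e.1.1 e.1.2 *
  (Rent R x y a b m.1.1 m.1.2 * Rent R x z m.1.1 e.2 e.1.1 m.2 * Rent R y z m.1.2 m.2
    e.1.2 c')).
  apply: eq_bigr => -[[a' b'] c] _ /=; rewrite -!mulr_sumr; congr (_ * _).
  have := esym (Rent_YB x y z a b c a' b' c').
  rewrite pair_big /= pair_big /= => ->.
  by rewrite pair_big /= pair_big.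
rewrite pair_big /= [RHS](reindex (fun f : Y3 * Y3 =>
    ((f.2.1.2, f.2.1.1), (f.1.1.2, f.2.2), (f.1.1.1, f.1.2)))) /=; last first.
  exists (fun z => ((z.2.1, z.1.2.1, z.2.2), (z.1.1.2, z.1.1.1, z.1.2.2))).
    by move=> [[[a1 a2] a3] [[a4 a5] a6]].
  by move=> [[[a1 a2] [a3 a4]] [a5 a6]].
by apply: eq_bigr => -[[[a1 a2] a3] [[a4 a5] a6]] _ /=; ring.
Qed.

Lemma sum2_split (F G : I -> I -> C) :
  \sum_i \sum_j (F i j + G i j) = \sum_i \sum_j F i j + \sum_i \sum_j G i j.
Proof. by rewrite -big_split; apply: eq_bigr => i _; rewrite big_split. Qed.

Lemma sum_delta j (b : bool) (F : I -> C) :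
  \sum_i F i * ((i == j) && b)%:R = b%:R * F j.
Proof.
rewrite (bigD1 j) //= eqxx big1 ?addr0 1?mulrC // => i ij.
by rewrite (negbTE ij) mulr0.
Qed.

Lemma cr_an_cr i x a p j q phi w : cr i x (an a p (cr j q phi)) w =
  \sum_a' \sum_j' Rent R p.1 q.1 a j' a' j * cr i x (cr j' q (an a' p phi)) w +
  ((a == j) && (p == q))%:R * cr i x phi w.
Proof. exact: cr_sum2D. Qed.

(** Induction on the word. If both creators cross its first letter, Yang-Baxter exchanges them. If
    that letter is at [x], the right-hand side has two R-matrices, which unitarity removes; if it is
    at [y], the contraction terms agree directly. *)
Lemma cr_cr i (x : pt) j (y : pt) phi w : cr i x (cr j y phi) w =
  \sum_i' \sum_j' Rent R y.1 x.1 j' i' j i * cr j' y (cr i' x phi) w.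
Proof.
elim: w i j phi => [|[a p] w IH] i j phi.
  by rewrite /cr /= big1 // => i' _; rewrite big1 // => j' _; rewrite mulr0.
rewrite cr_cons.
transitivity (\sum_a' \sum_i' Rent R p.1 x.1 a i' a' i *
   (\sum_a'' \sum_j' Rent R p.1 y.1 a' j' a'' j *
     (\sum_i2 \sum_j2 Rent R y.1 x.1 j2 i2 j' i' * cr j2 y (cr i2 x (an a'' p phi)) w)) +
  (p == y)%:R * (\sum_i' Rent R p.1 x.1 a i' j i * cr i' x phi w) +
  ((a == i) && (p == x))%:R * cr j y phi w).
  congr (_ + _); rewrite mulr_sumr.
  under eq_bigr => a' _ do under eq_bigr => i' _ do rewrite cr_an_cr mulrDr.
  rewrite sum2_split; congr (_ + _).
    apply: eq_bigr => a' _; apply: eq_bigr => i' _; congr (_ * _).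
    by apply: eq_bigr => a'' _; apply: eq_bigr => j' _; rewrite IH.
  rewrite exchange_big; apply: eq_bigr => i' _ /=.
  rewrite -(sum_delta j (p == y) (fun a' => Rent R p.1 x.1 a i' a' i * cr i' x phi w)).
  by apply: eq_bigr => a' _; rewrite mulrCA mulrC.
rewrite -(Rent_YB_rows p.1 y.1 x.1 a j i (fun a' b c => cr b y (cr c x (an a' p phi)) w)).
under [RHS]eq_bigr => i1 _ do under eq_bigr => j1 _ do rewrite cr_cons.
transitivity (\sum_i1 \sum_j1 Rent R y.1 x.1 j1 i1 j i *
   (\sum_a1 \sum_b Rent R p.1 y.1 a b a1 j1 *
        (\sum_a' \sum_c Rent R p.1 x.1 a1 c a' i1 * cr b y (cr c x (an a' p phi)) w)) +
   (\sum_i1 \sum_j1 Rent R y.1 x.1 j1 i1 j i * (\sum_a1 \sum_b Rent R p.1 y.1 a b a1 j1 *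
        (((a1 == i1) && (p == x))%:R * cr b y phi w)) +
    \sum_i1 \sum_j1 Rent R y.1 x.1 j1 i1 j i * (((a == j1) && (p == y))%:R * cr i1 x phi
      w))); last first.
  rewrite -!sum2_split; apply: eq_bigr => i1 _; apply: eq_bigr => j1 _.
  rewrite -!mulrDr addrA -sum2_split; congr (_ * (_ + _)).
  by apply: eq_bigr => a1 _; apply: eq_bigr => b _; rewrite cr_an_cr mulrDr.
rewrite -addrA; congr (_ + _); rewrite addrC; congr (_ + _).
  case: (p =P x) => [->|_]; last first.
    rewrite andbF mul0r big1 // => i1 _; rewrite big1 // => j1 _.
    rewrite big1 ?mulr0 // => a1 _; rewrite big1 // => b _.
    by rewrite andbF mul0r mulr0.
  transitivity (\sum_b ((a == i) && (b == j))%:R * cr b y phi w).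
    rewrite (bigD1 j) //= eqxx big1 ?addr0 // => b bj.
    by rewrite (negbTE bj) andbF mul0r.
  under eq_bigr => b _ do rewrite -(Rent_unit x.1 y.1) mulr_suml.
  rewrite exchange_big; apply: eq_bigr => i1 _ /=.
  under eq_bigr => b _ do rewrite mulr_suml.
  rewrite exchange_big; apply: eq_bigr => j1 _ /=.
  rewrite [RHS]mulr_sumr [RHS](bigD1 i1) //= [X in _ = _ + X]big1 ?addr0; last first.
    move=> a1 ai; rewrite big1 ?mulr0 // => b _.
    by rewrite (negbTE ai) mul0r mulr0.
  rewrite mulr_sumr; apply: eq_bigr => b _; rewrite eqxx mul1r.
  by rewrite mulrA [_ * Rent R y.1 x.1 _ _ _ _]mulrC.
case: (p =P y) => [->|_]; last first.
  rewrite mul0r big1 // => i1 _; rewrite big1 // => j1 _.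
  by rewrite andbF mul0r mulr0.
rewrite mul1r; apply: eq_bigr => i1 _; rewrite (bigD1 a) //= eqxx mul1r.
rewrite big1 ?addr0 // => j1 j1a.
by rewrite eq_sym (negbTE j1a) mul0r mulr0.
Qed.

(** The exchange relation of annihilators, which a general function on words violates; the model is
    valid on such states only. *)
Definition sym phi : Prop := forall u i (x : pt) j (y : pt) w,
  phi (u ++ (j, y) :: (i, x) :: w) =
  \sum_i' \sum_j' Rent R y.1 x.1 j i j' i' * phi (u ++ (i', x) :: (j', y) :: w).

Lemma sym_an i p phi : sym phi -> sym (an i p phi).
Proof. by move=> S u a x b y w; exact: (S ((i, p) :: u)). Qed.

Lemma sum22_exchange (A B : I -> I -> C) (F : I -> I -> I -> I -> C) :
  \sum_s \sum_t A s t * (\sum_i \sum_j B i j * F s t i j) =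
  \sum_i \sum_j B i j * (\sum_s \sum_t A s t * F s t i j).
Proof.
under eq_bigr => s _ do under eq_bigr => t _ do rewrite pair_big mulr_sumr /=.
rewrite pair_big exchange_big /=.
under [RHS]eq_bigr => s _ do under eq_bigr => t _ do rewrite pair_big mulr_sumr /=.
rewrite [RHS]pair_big /=; apply: eq_bigr => -[s t] _; apply: eq_bigr => -[i j] _ /=.
by rewrite mulrCA.
Qed.

(** Letters in front of the exchanged pair are crossed by induction. At the pair itself the cases
    are those of [cr_cr]: Yang-Baxter when both letters are crossed, and unitarity when the creator,
    having crossed y, is contracted at x in the swapped order or the reverse. *)
Lemma sym_cr z (r : pt) phi : sym phi -> sym (cr z r phi).
Proof.
move=> S u; elim: u z phi S => [|[t p] u IH] z phi S i x j y w; last first.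
  rewrite !cat_cons cr_cons.
  under [RHS]eq_bigr => i' _ do under eq_bigr => j' _ do rewrite cat_cons cr_cons mulrDr.
  rewrite sum2_split -sum22_exchange; congr (_ + _).
    apply: eq_bigr => t' _; apply: eq_bigr => z' _; congr (_ * _).
    by apply: IH; apply: sym_an.
  rewrite (S u) mulr_sumr; apply: eq_bigr => i' _; rewrite mulr_sumr.
  by apply: eq_bigr => j' _; rewrite mulrCA.
rewrite !cat0s cr_cons.
transitivity (\sum_j1 \sum_z1 Rent R y.1 r.1 j z1 j1 z *
    (\sum_i1 \sum_z2 Rent R x.1 r.1 i z2 i1 z1 *
      (\sum_i2 \sum_j2 Rent R y.1 x.1 j1 i1 j2 i2 * cr z2 r (an j2 y (an i2 x phi)) w)) +
   \sum_j1 \sum_z1 Rent R y.1 r.1 j z1 j1 z * (((i == z1) && (x == r))%:R * phi ((j1, y)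
     :: w)) +
   ((j == z) && (y == r))%:R * phi ((i, x) :: w)).
  congr (_ + _); rewrite -sum2_split.
  apply: eq_bigr => j1 _; apply: eq_bigr => z1 _.
  rewrite cr_cons mulrDr; congr (_ * _ + _).
  apply: eq_bigr => i1 _; apply: eq_bigr => z2 _; congr (_ * _).
  rewrite -(cr_sum2 (fun i2 j2 => Rent R y.1 x.1 j1 i1 j2 i2) (fun i2 j2 => an j2 y (an
    i2 x phi))).
  by apply: cr_ext => w'; exact: (S [::]).
rewrite (Rent_YB_cols y.1 x.1 r.1 j i z (fun c a' b' => cr c r (an a' y (an b' x phi)) w)).
under [RHS]eq_bigr => i' _ do under eq_bigr => j' _ do rewrite cat0s cr_cons.
transitivity (\sum_i' \sum_j' Rent R y.1 x.1 j i j' i' *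
   (\sum_i1 \sum_z1 Rent R x.1 r.1 i' z1 i1 z *
     (\sum_j1 \sum_z2 Rent R y.1 r.1 j' z2 j1 z1 * cr z2 r (an j1 y (an i1 x phi)) w)) +
  (\sum_i' \sum_j' Rent R y.1 x.1 j i j' i' * (\sum_i1 \sum_z1 Rent R x.1 r.1 i' z1 i1 z *
     (((j' == z1) && (y == r))%:R * phi ((i1, x) :: w))) +
   \sum_i' \sum_j' Rent R y.1 x.1 j i j' i' * (((i' == z) && (x == r))%:R * phi ((j', y)
     :: w)))); last first.
  rewrite -!sum2_split; apply: eq_bigr => i' _; apply: eq_bigr => j' _.
  rewrite -!mulrDr addrA -sum2_split; congr (_ * (_ + _)).
  apply: eq_bigr => i1 _; apply: eq_bigr => z1 _; rewrite -mulrDr; congr (_ * _).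
rewrite -addrA; congr (_ + _); rewrite addrC; congr (_ + _).
  case: (y =P r) => [->|_]; last first.
    rewrite andbF mul0r big1 // => i' _; rewrite big1 // => j' _.
    rewrite big1 ?mulr0 // => i1 _; rewrite big1 // => z1 _.
    by rewrite andbF mul0r mulr0.
  transitivity (\sum_i1 ((j == z) && (i == i1))%:R * phi ((i1, x) :: w)).
    rewrite (bigD1 i) //= eqxx big1 ?addr0 // => i1 ii.
    by rewrite [i == i1]eq_sym (negbTE ii) andbF mul0r.
  under eq_bigr => i1 _ do rewrite -(Rent_unit r.1 x.1) mulr_suml.
  rewrite exchange_big [RHS]exchange_big; apply: eq_bigr => j' _ /=.
  under eq_bigr => i1 _ do rewrite mulr_suml.
  rewrite exchange_big; apply: eq_bigr => i' _ /=.
  rewrite mulr_sumr; apply: eq_bigr => i1 _.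
  rewrite (bigD1 j') //= [X in _ = _ * (_ + X)]big1 ?addr0; last first.
    move=> z1 zj; by rewrite eq_sym (negbTE zj) mul0r mulr0.
  by rewrite eqxx mul1r mulrA.
case: (x =P r) => [->|_]; last first.
  rewrite big1 => [|j1 _]; last by rewrite big1 // => z1 _; rewrite andbF mul0r mulr0.
  by rewrite big1 // => i' _; rewrite big1 // => j' _; rewrite andbF mul0r mulr0.
rewrite [RHS]exchange_big; apply: eq_bigr => j1 _ /=.
rewrite (bigD1 i) //= eqxx [X in _ + X]big1 ?addr0; last first.
  by move=> z1 zi; rewrite eq_sym (negbTE zi) mul0r mulr0.
rewrite (bigD1 z) //= eqxx [X in _ = _ + X]big1 ?addr0 // => i' iz.
by rewrite (negbTE iz) mul0r mulr0.
Qed.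

End Fock.

(** * Interpretation of expressions as operators on states *)

Section Semantics.
Variables (K : realType) (N : nat) (R : Rmatrix K N).
Hypothesis hU : unitarity R.
Hypothesis hYB : yang_baxter R.
Local Notation I := 'I_N.
Local Notation C := K[i].
Local Notation state := (state K N).
Local Notation cr := (cr R).
Local Notation sym := (sym R).
Implicit Types (phi psi : state) (W : seq (ix K N)).

Section Op.
Variables (X : Type) (k : X -> pt K).

(** A fixed parameter always sits at the point with second component 0, so the Kronecker symbol of
    two distinct fixed parameters vanishes, as their delta does. *)
Definition ev (x : param K X) : pt K := match x with inl q => (q, 0%N) | inr z => k z end.

Definition lop (l : letter K N X) (phi : state) : state :=
  match l with Ann i x => an i (ev x) phi | Cre i x => cr i (ev x) phi end.

Definition wop (w : seq (letter K N X)) (phi : state) : state := foldr lop phi w.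

Lemma wop_cat w1 w2 phi : wop (w1 ++ w2) phi = wop w1 (wop w2 phi).
Proof. exact: foldr_cat. Qed.

Lemma wop_ext w phi psi : phi =1 psi -> wop w phi =1 wop w psi.
Proof. by move=> /funext ->. Qed.

Lemma sym_wop w phi : sym phi -> sym (wop w phi).
Proof.
move=> S; elim: w => [//|[i x|i x] w IH] /=; first exact: sym_an.
exact: sym_cr.
Qed.

Lemma wop_sum2D w (a : I -> I -> C) (F : I -> I -> state) b G W :
  wop w (fun W => \sum_s \sum_t a s t * F s t W + b * G W) W =
  \sum_s \sum_t a s t * wop w (F s t) W + b * wop w G W.
Proof.
elim: w W => [//|[i x|i x] w IH] W /=; first exact: IH.
rewrite -cr_sum2D; apply: cr_ext; exact: IH.
Qed.

Lemma wop_sum2 w (a : I -> I -> C) (F : I -> I -> state) W :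
  wop w (fun W => \sum_s \sum_t a s t * F s t W) W =
  \sum_s \sum_t a s t * wop w (F s t) W.
Proof.
have := wop_sum2D w a F 0 (fun=> 0) W; rewrite [X in _ = _ + X]mul0r addr0 => <-.
by apply: wop_ext => W'; rewrite mul0r addr0.
Qed.

End Op.

Lemma wop_rename (X Y : Type) (f : X -> Y) (k : Y -> pt K) w phi :
  wop k (map (lrename f) w) phi = wop (k \o f) w phi.
Proof. by elim: w => [//|[i [q|x]|i [q|x]] w IH] /=; rewrite IH. Qed.

Section Sem.
Variable Lam : seq (pt K).

Definition pts (X : finType) (f : {ffun X -> seq_sub Lam}) (x : X) : pt K := val (f x).

Definition sem (t : term K N) phi W : C :=
  \sum_(f : {ffun tvar t -> seq_sub Lam})
     @tker _ _ t (fun x => (pts f x).1) * wop (pts f) (tword t) phi W.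

Definition semE (e : expr K N) phi W : C := \sum_(t <- e) sem t phi W.

Lemma semE_cat e f phi W : semE (e ++ f) phi W = semE e phi W + semE f phi W.
Proof. exact: big_cat. Qed.

Lemma semE1 t phi W : semE [:: t] phi W = sem t phi W.
Proof. by rewrite /semE big_seq1. Qed.

Lemma sem_rename (X Y : finType) (f : X -> Y) w c phi W : bijective f ->
  sem (Term w c) phi W =
  sem (Term [seq lrename f l | l <- w] (fun k => c (k \o f))) phi W.
Proof.
move=> fB; have [g fK gK] := fB.
rewrite /sem /= (reindex (fun h : {ffun Y -> seq_sub Lam} => [ffun x => h (f x)])) /=;
  last first.
  exists (fun h : {ffun X -> seq_sub Lam} => [ffun y => h (g y)]) => h _;
    by apply/ffunP => x; rewrite !ffunE ?fK ?gK.
apply: eq_bigr => h _; rewrite wop_rename.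
have E : pts [ffun x => h (f x)] = pts h \o f.
  by apply/funext => x; rewrite /pts /= ffunE.
by rewrite E.
Qed.

Lemma sum_ffun_option (Y : finType) (F : {ffun option Y -> seq_sub Lam} -> C) :
  \sum_f F f = \sum_(g : {ffun Y -> seq_sub Lam}) \sum_t
     F [ffun o => if o is Some y then g y else t].
Proof.
rewrite pair_big /=.
rewrite (reindex (fun p : {ffun Y -> seq_sub Lam} * seq_sub Lam =>
  [ffun o => if o is Some y then p.1 y else p.2])) //=.
exists (fun f : {ffun option Y -> seq_sub Lam} => ([ffun y => f (Some y)], f None)).
  by move=> [g t] _ /=; congr (_, _); [apply/ffunP => y; rewrite !ffunE | rewrite ffunE].
by move=> f _; apply/ffunP => -[y|]; rewrite !ffunE.
Qed.

Lemma wop_elim (Y : finType) (z : param K Y) (k : Y -> pt K) (kk : option Y -> pt K) w phi :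
  (forall y, kk (Some y) = k y) -> kk None = ev k z ->
  wop kk w phi = wop k [seq lsubst (elim_var z) l | l <- w] phi.
Proof.
move=> Hs Hn; have E p : ev kk p = ev k (psubst (elim_var z) p).
  by case: p => [q|[y|]] //=; rewrite Hs.
by elim: w => [//|[i x|i x] w IH] /=; rewrite IH E.
Qed.

(** F is the Kronecker symbol replacing the delta. It selects one value of the eliminated variable,
    which must be among the points summed over; for a value given by another variable this is
    automatic. *)
Lemma sem_elim (Y : finType) (z : param K Y) w c (F : {ffun option Y -> seq_sub Lam} ->
  bool) phi W :
  (forall q, z = inl q -> (q, 0%N) \in Lam) ->
  (forall (g : {ffun Y -> seq_sub Lam}) t,
     F [ffun o => if o is Some y then g y else t] = (ev (pts g) z == val t)) ->
  \sum_f (F f)%:R * (c (fun x => (pts f x).1) * wop (pts f) w phi W) =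
  sem (elim_term z w c) phi W.
Proof.
move=> zL HF; rewrite sum_ffun_option; apply: eq_bigr => g _.
have evL : ev (pts g) z \in Lam.
  by case: z zL {HF} => [q /(_ q erefl)|y _] //=; exact: valP.
rewrite (bigD1 (SeqSub evL)) //= [X in _ + X]big1 ?addr0; last first.
  move=> t tn; rewrite HF; case: eqP => [E|_]; last by rewrite mul0r.
  by case/eqP: tn; apply: val_inj.
rewrite HF /= eqxx mul1r; set f := [ffun _ => _].
have fS y : pts f (Some y) = pts g y by rewrite /pts ffunE.
have fN : pts f None = ev (pts g) z by rewrite /pts ffunE.
rewrite (wop_elim _ _ fS fN); congr (c _ * _); apply/funext => -[y|].
  by rewrite fS.
by rewrite fN; case: (z).
Qed.

End Sem.

Definition contains (Lam : seq (pt K)) (Q : seq K) : Prop :=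
  forall q, q \in Q -> (q, 0%N) \in Lam.

Lemma contains_cat Lam Q1 Q2 : contains Lam (Q1 ++ Q2) -> contains Lam Q1 /\ contains Lam
  Q2.
Proof.
by move=> H; split=> q qQ; apply: H; rewrite mem_cat qQ ?orbT.
Qed.

Lemma dirac_sem (X : finType) (x y : param K X) w c d : dirac x y w c d ->
  exists Q, forall Lam, contains Lam Q -> forall phi W,
  \sum_(f : {ffun X -> seq_sub Lam}) (ev (pts f) x == ev (pts f) y)%:R *
     (c (fun x => (pts f x).1) * wop (pts f) w phi W) = semE Lam d phi W.
Proof.
case=> {X x y w c d} [X q q' w c qq'|Y z w c|Y z w c].
- exists [::] => Lam _ phi W; rewrite /semE big_nil; apply: big1 => f _ /=.
  by case: eqP => [[/qq']|_] //; rewrite mul0r.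
- exists (if z is inl q then [:: q] else [::]) => Lam HL phi W.
  rewrite semE1; apply: sem_elim.
    by move=> q zq; apply: HL; rewrite zq mem_head.
  move=> g t /=; rewrite /pts ffunE; congr (_ == _).
  by case: (z) => [q|y] //=; rewrite /pts ffunE.
- exists (if z is inl q then [:: q] else [::]) => Lam HL phi W.
  rewrite semE1; apply: sem_elim.
    by move=> q zq; apply: HL; rewrite zq mem_head.
  move=> g t /=; rewrite eq_sym /pts ffunE; congr (_ == _).
  by case: (z) => [q|y] //=; rewrite /pts ffunE.
Qed.

Lemma pval_ev (X : finType) (k : X -> pt K) x : pval (fun x => (k x).1) x = (ev k x).1.
Proof. by case: x. Qed.

Lemma semE_allpairs Lam (F : I -> I -> term K N) phi W :
  semE Lam [seq F i j | i <- enum I, j <- enum I] phi W = \sum_i \sum_j sem Lam (F i j)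
    phi W.
Proof.
rewrite /semE big_flatten big_map big_enum; apply: eq_bigr => i _ /=.
by rewrite big_map big_enum.
Qed.

(* A contraction with a fixed parameter [q] puts the eliminated variable at the point
   (q, 0), which therefore has to be among the points [Lam] summed over. *)
Lemma sound e f : zfeq R e f -> exists Q, forall Lam, contains Lam Q ->
  forall phi W, sym phi -> semE Lam e phi W = semE Lam f phi W.
Proof.
elim=> {e f}.
- by move=> e; exists [::].
- by move=> e f _ [Q H]; exists Q => Lam HL phi W S; rewrite (H Lam HL).
- move=> e f g _ [Q1 H1] _ [Q2 H2]; exists (Q1 ++ Q2) => Lam /contains_cat[L1 L2] phi W S.
  by rewrite (H1 Lam L1) // (H2 Lam L2).
- move=> e e' f f' _ [Q1 H1] _ [Q2 H2]; exists (Q1 ++ Q2) => Lam /contains_cat[L1 L2] phi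
  W S.
  by rewrite !semE_cat (H1 Lam L1) // (H2 Lam L2).
- by move=> e f; exists [::] => Lam _ phi W S; rewrite !semE_cat addrC.
- move=> X w c c0; exists [::] => Lam _ phi W S.
  rewrite semE1 /semE big_nil; apply: big1 => h _; by rewrite /= c0 mul0r.
- move=> X w c c1 c2 cE; exists [::] => Lam _ phi W S.
  rewrite semE1 /semE big_cons big_seq1 -big_split; apply: eq_bigr => h _.
  by rewrite /= cE mulrDl.
- move=> X Y f w c fB; exists [::] => Lam _ phi W S.
  by rewrite !semE1; exact: sem_rename.
- move=> X u v i j x y c; exists [::] => Lam _ phi W S.
  rewrite semE1 semE_allpairs /sem /=.
  under [RHS]eq_bigr => i' _ do rewrite exchange_big /=.
  rewrite [RHS]exchange_big; apply: eq_bigr => h _ /=.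
  (* The state to the right of the two annihilators has to be symmetric: the letters of [v] preserve
     the symmetry of phi. *)
  set k := pts h; rewrite !wop_cat /=; have Sv : sym (wop k v phi) by exact: sym_wop.
  transitivity (c (fun x => (k x).1) * wop k u (fun W => \sum_i' \sum_j'
     Rent R (ev k y).1 (ev k x).1 j i j' i' * an j' (ev k y) (an i' (ev k x) (wop k v
       phi)) W) W).
    by congr (_ * _); apply: wop_ext => W'; exact: (Sv [::]).
  rewrite wop_sum2 mulr_sumr; apply: eq_bigr => i' _; rewrite mulr_sumr.
  apply: eq_bigr => j' _; rewrite wop_cat /= !pval_ev.
  by rewrite mulrA [c _ * _]mulrC.
- move=> X u v i j x y c; exists [::] => Lam _ phi W S.
  rewrite semE1 semE_allpairs /sem /=.
  under [RHS]eq_bigr => i' _ do rewrite exchange_big /=.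
  rewrite [RHS]exchange_big; apply: eq_bigr => h _ /=.
  set k := pts h; rewrite !wop_cat /=.
  transitivity (c (fun x => (k x).1) * wop k u (fun W => \sum_i' \sum_j'
     Rent R (ev k y).1 (ev k x).1 j' i' j i * cr j' (ev k y) (cr i' (ev k x) (wop k v
       phi)) W) W).
    by congr (_ * _); apply: wop_ext => W'; exact: cr_cr.
  rewrite wop_sum2 mulr_sumr; apply: eq_bigr => i' _; rewrite mulr_sumr.
  apply: eq_bigr => j' _; rewrite wop_cat /= !pval_ev.
  by rewrite mulrA [c _ * _]mulrC.
move=> X u v i j x y c d D; have [Q HQ] := dirac_sem D.
exists Q => Lam HL phi W S; rewrite semE1 semE_cat semE_allpairs.
have -> : semE Lam (if i == j then d else [::]) phi W = (i == j)%:R *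
  \sum_(f : {ffun X -> seq_sub Lam}) (ev (pts f) x == ev (pts f) y)%:R *
     (c (fun x => (pts f x).1) * wop (pts f) (u ++ v) phi W).
  rewrite HQ //; case: eqP => _; first by rewrite mul1r.
  by rewrite mul0r /semE big_nil.
rewrite /sem /=.
under [X in _ = X + _]eq_bigr => i' _ do rewrite exchange_big /=.
rewrite [X in _ = X + _]exchange_big mulr_sumr -big_split; apply: eq_bigr => h _ /=.
set k := pts h; rewrite wop_cat /=.
(* Unfolding [cr_rec] at its first letter is the mixed relation itself, with the Kronecker symbol in
   place of the delta. *)
transitivity (c (fun x => (k x).1) * wop k u (fun W => \sum_i' \sum_j'
   Rent R (ev k x).1 (ev k y).1 i j' i' j * cr j' (ev k y) (an i' (ev k x) (wop k v phi))
     W +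
   ((i == j) && (ev k x == ev k y))%:R * wop k v phi W) W).
  by congr (_ * _); apply: wop_ext.
rewrite wop_sum2D mulrDr; congr (_ + _).
  rewrite mulr_sumr; apply: eq_bigr => i' _; rewrite mulr_sumr.
  apply: eq_bigr => j' _; rewrite wop_cat /= !pval_ev.
  by rewrite mulrA [c _ * _]mulrC.
by rewrite wop_cat -mulnb natrM mulrCA -!mulrA; congr (_ * _); rewrite mulrCA.
Qed.

End Semantics.

(** * Many-particle states *)

Section Fock_states.
Variables (K : realType) (N : nat) (R : Rmatrix K N).
Hypothesis hU : unitarity R.
Hypothesis hYB : yang_baxter R.
Local Notation I := 'I_N.
Local Notation C := K[i].
Local Notation "''V_' L" := {ffun L -> I} (at level 8, L at level 2).
Local Notation state := (state K N).
Local Notation cr := (cr R).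
Local Notation sym := (sym R).
Implicit Types (phi psi : state) (W : seq (ix K N)) (xs : seq (ix K N)).

Definition vac : state := fun W => (nilp W)%:R.

Definition fock xs : state := foldl (fun phi x => cr x.1 x.2 phi) vac xs.

Lemma fock_rcons xs x : fock (rcons xs x) = cr x.1 x.2 (fock xs).
Proof. by rewrite /fock foldl_rcons. Qed.

Lemma sym_vac : sym vac.
Proof.
move=> u i x j y w; rewrite /vac /nilp !size_cat /= addnS.
rewrite big1 // => i' _; rewrite big1 // => j' _.
by rewrite !size_cat /= addnS mulr0.
Qed.

Lemma sym_fock xs : sym (fock xs).
Proof.
elim/last_ind: xs => [|xs x IH]; first exact: sym_vac.
by rewrite fock_rcons; exact: sym_cr.
Qed.

(** The particles of the state sit at the points [m] minus [e]. The list [e] records the letters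
    already read, which makes the induction on words in [supp_cr] possible. *)
Definition supp (e m : seq (pt K)) phi : Prop :=
  forall W, ~~ perm_eq (e ++ map snd W) m -> phi W = 0.

Lemma supp_cr e m j q phi : supp e m phi -> supp e (q :: m) (cr j q phi).
Proof.
move=> S W; elim: W e j phi S => [//|[i p] W IH] e j phi S H.
rewrite cr_cons big1 ?add0r => [|i' _]; last first.
  rewrite big1 // => j' _; rewrite (IH (rcons e p)) ?mulr0 //.
    by move=> W'; rewrite cat_rcons => H'; exact: (S ((i', p) :: W')).
  by rewrite cat_rcons.
case: eqP => [_|_] /=; last by rewrite mul0r.
case: eqP => [pq|_]; last by rewrite mul0r.
rewrite S ?mulr0 //; apply: contra H; rewrite /= -pq => H.
by rewrite (perm_catCA e [:: p] (map snd W)) /= perm_cons.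
Qed.

Lemma supp_fock xs : supp [::] (map snd xs) (fock xs).
Proof.
suff H : supp [::] (map snd (rev xs)) (fock xs).
  move=> W HW; apply: H; apply: contra HW => /perm_trans; apply.
  by apply: perm_map; rewrite perm_rev.
elim/last_ind: xs => [|xs x IH].
  by case=> //= x W _.
by rewrite fock_rcons rev_rcons; apply: supp_cr.
Qed.

Lemma fock_size xs W : size W != size xs -> fock xs W = 0.
Proof.
move=> H; apply: supp_fock; apply: contra H => /perm_size.
by rewrite !size_map => ->.
Qed.

Lemma cr_fock_eq0 j q phi : (forall W, phi W = 0) -> forall W, cr j q phi W = 0.
Proof. by move=> H W; apply: cr0. Qed.

(** The points being distinct, each creator can only be contracted with the letter at its own point:
    a crossing would annihilate at [t a] a state with no particle there. *)
Lemma fock_diag (T : eqType) (s : seq T) (t : T -> pt K) (u v : T -> I) :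
  uniq (map t s) ->
  fock [seq (u a, t a) | a <- s] (rev [seq (v a, t a) | a <- s]) =
  (all (fun a => u a == v a) s)%:R.
Proof.
elim/last_ind: s => [|s a IH]; first by [].
rewrite map_rcons rcons_uniq => /andP[tas us].
rewrite !map_rcons rev_rcons fock_rcons cr_cons IH // all_rcons eqxx andbT.
rewrite [v a == u a]eq_sym big1 ?add0r => [|i' _]; first by rewrite -natrM mulnb.
rewrite big1 // => j' _; rewrite cr_fock_eq0 ?mulr0 // => W.
apply: supp_fock; apply/negP => /perm_mem/(_ (t a)).
rewrite mem_head -map_comp => /esym/mapP[b bs /= tab].
by case/negP: tas; rewrite tab; apply: map_f.
Qed.

Section Reorder.
Variables (L : finType) (p : L -> pt K).
Local Notation k := (fun a => (p a).1).

Definition word (x : 'V_L) (s : seq L) : seq (ix K N) := [seq (x a, p a) | a <- s].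

Lemma word_upd (x : 'V_L) s a i : a \notin s -> word (upd x a i) s = word x s.
Proof.
by move=> as_; apply/eq_in_map => b bs; rewrite upd_other //; apply: contraNneq as_ => <-.
Qed.

(** Each swap is one instance of [sym]. The word is reversed because a state lists first the
    annihilator acting first, which is the rightmost one. *)
Lemma reorder_ket w s M phi : reorder R k w s M -> uniq w -> sym phi -> forall x,
  phi (rev (word x s)) = \sum_y entry M x y * phi (rev (word y w)).
Proof.
move=> H uw S; elim: H => [|u a b v {}M H IH] x.
  rewrite (bigD1 x) //= entry_id eqxx mul1r big1 ?addr0 // => y yx.
  by rewrite entry_id eq_sym (negbTE yx) mul0r.
have un : uniq (u ++ a :: b :: v) by rewrite -(perm_uniq (reorder_perm H)).
have ab := swap_neq un.
have [_ au av bu bv] := uniq_mid un.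
rewrite /word map_cat /= rev_cat !rev_cons -!cats1 -!catA /= S.
transitivity (\sum_i \sum_j Rent R (p a).1 (p b).1 (x a) (x b) i j *
   phi (rev (word (upd (upd x a i) b j) (u ++ a :: b :: v)))).
  rewrite exchange_big; apply: eq_bigr => i _; apply: eq_bigr => j _ /=.
  congr (_ * phi _); rewrite /word map_cat /= -!/(word _ _) !word_upd //.
  by rewrite rev_cat !rev_cons -!cats1 -!catA /= upd_same (upd_other _ _ ab) upd_same.
under [LHS]eq_bigr => i _ do under eq_bigr => j _ do rewrite IH mulr_sumr.
under [LHS]eq_bigr => i _ do rewrite exchange_big /=.
rewrite [LHS]exchange_big; apply: eq_bigr => y _ /=.
rewrite entry_Rab_mul // mulr_suml; apply: eq_bigr => i _; rewrite mulr_suml.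
by apply: eq_bigr => j _; rewrite mulrA.
Qed.

Lemma fock_swap xs1 xs2 i (x : pt K) j (y : pt K) W :
  fock (xs1 ++ (j, y) :: (i, x) :: xs2) W =
  \sum_i' \sum_j' Rent R y.1 x.1 j' i' j i * fock (xs1 ++ (i', x) :: (j', y) :: xs2) W.
Proof.
elim/last_ind: xs2 W => [|xs2 z IH] W.
  rewrite /fock foldl_cat /= cr_cr //; apply: eq_bigr => i' _; apply: eq_bigr => j' _.
  by rewrite foldl_cat.
rewrite -!rcons_cons -rcons_cat fock_rcons (cr_ext R _ _ IH) cr_sum2.
by apply: eq_bigr => i' _; apply: eq_bigr => j' _; rewrite -!rcons_cons -rcons_cat
  fock_rcons.
Qed.

(** Created states transform inversely to the values of symmetric states, by unitarity. *)
Lemma reorder_bra w s M W : reorder R k w s M -> uniq w -> forall y,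
  \sum_x fock (word x s) W * entry M x y = fock (word y w) W.
Proof.
move=> H uw; elim: H => [|u a b v {}M H IH] y.
  rewrite (bigD1 y) //= entry_id eqxx mulr1 big1 ?addr0 // => x xy.
  by rewrite entry_id (negbTE xy) mulr0.
have un : uniq (u ++ a :: b :: v) by rewrite -(perm_uniq (reorder_perm H)).
have ab := swap_neq un; have ba : b != a by rewrite eq_sym.
have [_ au av bu bv] := uniq_mid un.
have E x : fock (word x (u ++ b :: a :: v)) W =
    \sum_z fock (word z (u ++ a :: b :: v)) W * entry (Rab R k b a) z x.
  (* The values are packed as an operator so that the sum over two indices becomes a product by an
     R-matrix. *)
  pose G := mkop (fun (y z : 'V_L) => fock (word z (u ++ a :: b :: v)) W).
  transitivity (entry (G *m Rab R k b a) x x); last first.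
    by rewrite entry_mul; apply: eq_bigr => z _; rewrite entry_mkop.
  rewrite entry_mul_Rab // /word map_cat /= fock_swap exchange_big.
  apply: eq_bigr => i _; apply: eq_bigr => j _ /=.
  rewrite entry_mkop mulrC; congr (fock _ _ * _).
  rewrite /word map_cat /= -!/(word _ _) !word_upd //.
  by rewrite upd_same (upd_other _ _ ba) upd_same.
rewrite -IH.
transitivity (\sum_x \sum_z fock (word z (u ++ a :: b :: v)) W *
   (entry (Rab R k b a) z x * entry (Rab R k a b *m M) x y)).
  by apply: eq_bigr => x _; rewrite E mulr_suml; apply: eq_bigr => z _; rewrite mulrA.
rewrite exchange_big; apply: eq_bigr => z _; rewrite -mulr_sumr -entry_mul.
by rewrite mulmxA (Rab_unit hU k ba) mul1mx.
Qed.

End Reorder.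
End Fock_states.

(** * Matrix elements of sandwiches between many-particle states *)

Section Pairings.
Variables (K : realType) (N : nat) (R : Rmatrix K N).
Hypothesis hU : unitarity R.
Hypothesis hYB : yang_baxter R.
Local Notation I := 'I_N.
Local Notation C := K[i].
Local Notation "''V_' L" := {ffun L -> I} (at level 8, L at level 2).
Local Notation state := (state K N).
Local Notation cr := (cr R).
Local Notation sym := (sym R).
Local Notation fock := (fock R).
Implicit Types (phi psi : state) (W : seq (ix K N)) (xs : seq (ix K N)).

Lemma cr_scale c j q phi W : cr j q (fun W => c * phi W) W = c * cr j q phi W.
Proof.
have := cr_sum R [:: tt] (fun=> c) (fun=> phi) j q W.
by rewrite big_seq1 => <-; apply: cr_ext => W'; rewrite big_seq1.
Qed.

Section Words.
Variables (n : nat) (f : 'I_n -> pt K).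

Definition letters (u : {ffun 'I_n -> I}) : seq (ix K N) := [seq (u a, f a) | a <- enum
  'I_n].

Lemma wop_annW v phi W : wop R f (annW K v) phi W = phi (rev (letters v) ++ W).
Proof.
rewrite /annW /letters; elim: (enum 'I_n) W => [//|a s IH] W.
by rewrite /= /an IH rev_cons cat_rcons.
Qed.

Lemma wop_creW u c : wop R f (creW K u) (fun W => c * vac W) = fun W => c * fock (letters
  u) W.
Proof.
rewrite /wop /creW -(foldl_rev (fun z x => lop R f x z)) revK /fock /letters.
have H s psi : foldl (fun x y => lop R f y x) (fun W => c * psi W) [seq Cre (u a) (inr a)
  | a <- s] =
  fun W => c * foldl (fun phi x => cr x.1 x.2 phi) psi [seq (u a, f a) | a <- s] W.
  elim: s psi => [//|a s IH] psi; rewrite /= -IH; congr foldl.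
  by apply/funext => W; rewrite cr_scale.
exact: H.
Qed.

(** Annihilating [n] particles of an [n]-particle state leaves a multiple of the vacuum, from which
    the creators build [fock]. *)
Lemma wop_normal u v phi W : (forall W, size W != n -> phi W = 0) ->
  wop R f (creW K u ++ annW K v) phi W = fock (letters u) W * phi (rev (letters v)).
Proof.
move=> H; have E : wop R f (annW K v) phi = fun W => phi (rev (letters v)) * vac W.
  apply/funext => -[|x W']; rewrite wop_annW /vac /=; first by rewrite cats0 mulr1.
  rewrite mulr0 H // size_cat size_rev size_map size_enum_ord.
  by rewrite -[X in _ != X]addn0 eqn_add2l.
by rewrite wop_cat E wop_creW mulrC.
Qed.

End Words.

Section Sandwich.
Variables (n : nat) (D : coef K N n) (koo : K) (i j : I).
Hypothesis D_cov : covariant R D.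
Variables (W : seq (ix K N)) (phi : state).
Hypothesis phi_sym : sym phi.

(** The contribution of one assignment of points to the integration variables. *)
Definition pairing (f : 'I_n -> pt K) : C :=
  \sum_(u : {ffun 'I_n -> I}) \sum_(v : {ffun 'I_n -> I})
    entry (D (with_oo koo (fun a => (f a).1))) [ffun o => with_oo i u o] [ffun o =>
      with_oo j v o] *
    (fock (letters f u) W * phi (rev (letters f v))).

Definition opts (f : 'I_n -> pt K) (a : option 'I_n) : pt K :=
  if a is Some x then f x else (koo, 0%N).

(** The Kronecker symbol at [None] fixes the index in the space infinity, so that the pairing
    becomes a product row, matrix, column over all the copies. *)
Definition bra (f : 'I_n -> pt K) s (x : 'V_(option 'I_n)) : C :=
  (x None == i)%:R * fock (word (opts f) x s) W.

Definition ket (f : 'I_n -> pt K) s (y : 'V_(option 'I_n)) : C :=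
  (y None == j)%:R * phi (rev (word (opts f) y s)).

Lemma pairingE f : pairing f = \sum_x \sum_y
  bra f (somes n) x * entry (D (fun a => (opts f a).1)) x y * ket f (somes n) y.
Proof.
have okE l (x : 'V_(option 'I_n)) : agrees (at_oo l) x = (x None == l).
  by apply/agreesP/eqP => [H|E [a|] y //= [<-]] //; exact: H.
transitivity (\sum_(x | agrees (at_oo i) x) \sum_(y | agrees (at_oo j) y)
  fock (word (opts f) x (somes n)) W * entry (D (fun a => (opts f a).1)) x y *
  phi (rev (word (opts f) y (somes n)))).
  rewrite sum_at_oo; apply: eq_bigr => u _; rewrite sum_at_oo; apply: eq_bigr => v _.
  have wE l (w : {ffun 'I_n -> I}) : word (opts f) [ffun a => with_oo l w a] (somes n) =
    letters f w.
    by rewrite /word /letters /somes -map_comp; apply: eq_map => a /=; rewrite ffunE.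
  rewrite !wE mulrA [entry _ _ _ * _]mulrC; congr (_ * entry (D _) _ _ * _).
  by apply/funext => -[a|].
rewrite [LHS]big_mkcond; apply: eq_bigr => x _; rewrite okE /bra.
case: eqP => _; last by rewrite big1 // => y _; rewrite !mul0r.
rewrite [LHS]big_mkcond; apply: eq_bigr => y _; rewrite okE /ket.
by case: eqP => _; rewrite ?mul0r ?mulr0 // !mul1r.
Qed.

Lemma reorder_trivial f s M : reorder R (fun a => (opts f a).1) (somes n) s M ->
  trivial_on None M.
Proof.
move=> H; apply: Rgen_trivial (reorder_Rgen H (uniq_somes n)).
exact: None_somes.
Qed.

Lemma ket_reorder f s M : reorder R (fun a => (opts f a).1) (somes n) s M ->
  forall x, ket f s x = \sum_y entry M x y * ket f (somes n) y.
Proof.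
move=> H x; rewrite /ket (reorder_ket H (uniq_somes n) phi_sym) mulr_sumr.
apply: eq_bigr => y _; rewrite mulrCA.
case: (eqVneq (x None) (y None)) => [->//|xy].
by rewrite (trivial_entry0 (reorder_trivial H) xy) !mul0r.
Qed.

Lemma bra_reorder f s M : reorder R (fun a => (opts f a).1) (somes n) s M ->
  forall y, \sum_x bra f s x * entry M x y = bra f (somes n) y.
Proof.
move=> H y; rewrite /bra -(reorder_bra hU hYB W H (uniq_somes n)) mulr_sumr.
apply: eq_bigr => x _; rewrite -mulrA.
case: (eqVneq (x None) (y None)) => [->//|xy].
by rewrite (trivial_entry0 (reorder_trivial H) xy) !mulr0.
Qed.

Lemma bilin (L : finType) (al be : 'V_L -> C) (M : Op K N L) :
  \sum_x \sum_y al x * entry M x y * be y =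
  ((\row_p al (enum_val p)) *m M *m (\col_p be (enum_val p))) 0 0.
Proof.
have rB : {on [pred _ | true], bijective (@enum_rank ('V_L))}.
  by apply: onW_bij; apply: enum_rank_bij.
rewrite mxE exchange_big [RHS](reindex _ rB) /=.
apply: eq_bigr => y _; rewrite !mxE enum_rankK -mulr_suml; congr (_ * _).
rewrite [RHS](reindex _ rB) /=.
by apply: eq_bigr => x _; rewrite !mxE enum_rankK.
Qed.

(** Covariance conjugates the kernel by [Rsigma], and the bra and the ket absorb the two conjugating
    factors. *)
Lemma pairing_perm (s : 'S_n) f : pairing (f \o s) = pairing f.
Proof.
have sI : injective (omap s) by apply: omap_inj; apply: perm_inj.
have pI : injective (pull (N := N) (omap s)).
  move=> x x' /ffunP E; apply/ffunP => -[a|]; last by have := E None; rewrite !ffunE.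
  by have := E (Some ((s^-1)%g a)); rewrite !ffunE /= permKV.
pose w' := [seq Some (s a) | a <- enum 'I_n].
set k := fun a => (opts f a).1; pose Rs := Rsigma R k s.
have Hs : reorder R k (somes n) w' Rs by exact: Rsigma_reorder.
have braE x : bra (f \o s) (somes n) (pull (omap s) x) = bra f w' x.
  rewrite /bra ffunE /=; congr (_ * fock _ _).
  by rewrite /word /somes /w' -!map_comp; apply: eq_map => a /=; rewrite ffunE.
have ketE x : ket (f \o s) (somes n) (pull (omap s) x) = ket f w' x.
  rewrite /ket ffunE /=; congr (_ * phi (rev _)).
  by rewrite /word /somes /w' -!map_comp; apply: eq_map => a /=; rewrite ffunE.
have DE x y : entry (D (fun a => (opts (f \o s) a).1)) (pull (omap s) x) (pull (omap s) y) =
    entry (Rs *m D k *m invmx Rs) x y.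
  rewrite -D_cov /Tplace place_perm_entry //; congr (entry (D _) _ _).
  by apply/funext => -[a|].
rewrite !pairingE (reindex_inj pI) /=.
under eq_bigr => x _ do rewrite (reindex_inj pI) /=.
under eq_bigr => x _ do under eq_bigr => y _ do rewrite braE ketE DE.
rewrite !bilin.
have uR : Rs \in unitmx by apply: reorder_unit Hs (uniq_somes n).
have -> : \col_p ket f w' (enum_val p) = Rs *m (\col_p ket f (somes n) (enum_val p)).
  apply/colP => p; rewrite !mxE (ket_reorder Hs) [RHS](reindex (@enum_rank _)) /=.
    by apply: eq_bigr => q _; rewrite mxE /entry enum_rankK enum_valK.
  by apply: onW_bij; apply: enum_rank_bij.
have -> : \row_p bra f (somes n) (enum_val p) = (\row_p bra f w' (enum_val p)) *m Rs.
  apply/rowP => p; rewrite !mxE -(bra_reorder Hs) [RHS](reindex (@enum_rank _)) /=.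
    by apply: eq_bigr => q _; rewrite mxE /entry enum_rankK enum_valK.
  by apply: onW_bij; apply: enum_rank_bij.
by rewrite !mulmxA (mulmxKV uR).
Qed.

End Sandwich.

Section Matrix_elements.
Variables (n : nat) (D : coef K N n) (koo : K) (i j : I).
Hypothesis D_cov : covariant R D.
Variables (t : 'I_n -> pt K) (u0 v0 : {ffun 'I_n -> I}).
Hypothesis t_inj : injective t.

Lemma sem_sandwich Lam phi W : (forall W, size W != n -> phi W = 0) ->
  semE R Lam (sandwich D koo i j) phi W =
  \sum_(f : {ffun 'I_n -> seq_sub Lam}) pairing D koo i j W phi (pts f).
Proof.
move=> H; rewrite /semE big_flatten big_map big_enum /=.
under eq_bigr => u _ do rewrite big_map big_enum /=.
rewrite /pairing; under [RHS]eq_bigr => f _ do rewrite pair_big /=.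
rewrite pair_big exchange_big /=; apply: eq_bigr => -[u v] _ /=.
rewrite /sem /=; apply: eq_bigr => f _.
by rewrite -/(creW K u) -/(annW K v) wop_normal.
Qed.

Lemma uniq_t : uniq (map t (enum 'I_n)).
Proof. by rewrite map_inj_uniq ?enum_uniq. Qed.

(** Only the assignments that permute the points [t] contribute, by the support of the states. By
    covariance the n! of them contribute equally, and the identity assignment picks a single entry.
    Only the points have to be distinct, so the parameters may coincide. *)
Lemma sem_fock_sandwich Lam : (forall a, t a \in Lam) ->
  semE R Lam (sandwich D koo i j) (fock (letters t v0)) (rev (letters t u0)) =
  n`!%:R * entry (D (with_oo koo (fun a => (t a).1)))
     [ffun o => with_oo i u0 o] [ffun o => with_oo j v0 o].
Proof.
move=> tL; set phi := fock _; set W := rev _.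
rewrite sem_sandwich; last first.
  by move=> W' HW; apply: fock_size; rewrite size_map size_enum_ord.
have pairing0 (f : {ffun 'I_n -> seq_sub Lam}) :
    ~~ perm_eq (map t (enum 'I_n)) (map (pts f) (enum 'I_n)) -> pairing D koo i j W phi
      (pts f) = 0.
  move=> H; rewrite /pairing big1 // => u _; rewrite big1 // => v _.
  have -> : fock (letters (pts f) u) W = 0; last by rewrite mul0r mulr0.
  apply: supp_fock; apply: contra H.
  by rewrite cat0s /W map_rev perm_rev /letters -!map_comp.
pose h (s : 'S_n) : {ffun 'I_n -> seq_sub Lam} := [ffun a => SeqSub (tL (s a))].
have hE s : pts (h s) = t \o s by apply/funext => a; rewrite /pts ffunE.
have hI : injective h.
  move=> s s' E; apply/permP => a; apply: t_inj.
  by have := congr1 (fun f => pts f a) E; rewrite !hE.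
(* Distinctness of the points makes such an assignment injective, so it is [t] composed with a
   permutation. *)
have hS f : perm_eq (map t (enum 'I_n)) (map (pts f) (enum 'I_n)) -> f \in h @: [set: 'S_n].
  move=> H; have fI : injective (pts f).
    by apply/injectiveP; rewrite /injectiveb /dinjectiveb -(perm_uniq H) uniq_t.
  have fE a : {b | t b = pts f a}.
    apply: cid; have : pts f a \in map t (enum 'I_n).
      by rewrite (perm_mem H); apply: map_f; rewrite mem_enum.
    by move/mapP => [b _ ->]; exists b.
  have gI : injective (fun a => sval (fE a)).
    move=> a b E; have := congr1 t E; rewrite !(svalP (fE _)) => E'.
    exact: fI E'.
  apply/imsetP; exists (perm gI); rewrite ?inE //; apply/ffunP => a.
  apply: val_inj; rewrite -[RHS]/(pts (h (perm gI)) a) hE /= permE.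
  by rewrite (svalP (fE a)).
rewrite (bigID (fun f => f \in h @: [set: 'S_n])) /= [X in _ + X]big1 ?addr0; last first.
  by move=> f Hf; apply: pairing0; apply: contra Hf; exact: hS.
rewrite big_imset /=; last by move=> s s' _ _; exact: hI.
under eq_bigr => s _ do rewrite hE (pairing_perm _ _ _ D_cov _ (sym_fock hU hYB _)).
rewrite sumr_const cardsT card_Sn -[LHS]mulr_natl; congr (_ * _).
rewrite /pairing (bigD1 u0) //= [X in _ + X]big1 ?addr0; last first.
  move=> u uu; rewrite big1 // => v _.
  rewrite (fock_diag R _ _ uniq_t).
  have -> : all (fun a => u a == u0 a) (enum 'I_n) = false; last by rewrite mul0r mulr0.
  by apply: contraNF uu => /allP H; apply/eqP/ffunP => a; apply/eqP/H; rewrite mem_enum.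
rewrite (bigD1 v0) //= [X in _ + X]big1 ?addr0; last first.
  move=> v vv; rewrite [X in _ * (_ * X)](fock_diag R _ _ uniq_t).
  have -> : all (fun a => v0 a == v a) (enum 'I_n) = false; last by rewrite !mulr0.
  by apply: contraNF vv => /allP H; apply/eqP/ffunP => a; apply/esym/eqP/H; rewrite
    mem_enum.
rewrite [X in _ * (_ * X)](fock_diag R _ _ uniq_t) (fock_diag R _ _ uniq_t).
by rewrite !(introT allP _) ?mulr1.
Qed.

End Matrix_elements.
End Pairings.

(** * Uniqueness of the coefficients and the equivalence *)

Section Final.
Variables (K : realType) (N : nat) (R : Rmatrix K N).
Hypothesis hU : unitarity R.
Hypothesis hYB : yang_baxter R.
Local Notation I := 'I_N.
Local Notation C := K[i].
Local Notation "''V_' L" := {ffun L -> I} (at level 8, L at level 2).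
Local Notation state := (state K N).
Local Notation cr := (cr R).
Local Notation fock := (fock R).

Section Entries.
Variables (n : nat) (D D' : coef K N n).
Hypotheses (D_cov : covariant R D) (D_cov' : covariant R D').

Lemma entry_from_fock k (t : 'I_n -> pt K) (x y : 'V_(option 'I_n)) Lam :
  injective t -> (forall a, t a \in Lam) -> (forall a, (t a).1 = k (Some a)) ->
  (forall W, let v0 := [ffun a => y (Some a)] in
    semE R Lam (sandwich D (k None) (x None) (y None)) (fock (letters t v0)) W =
    semE R Lam (sandwich D' (k None) (x None) (y None)) (fock (letters t v0)) W) ->
  entry (D k) x y = entry (D' k) x y.
Proof.
move=> tI tL tk H.
pose u0 := [ffun a => x (Some a)] : {ffun 'I_n -> I}.
pose v0 := [ffun a => y (Some a)] : {ffun 'I_n -> I}.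
have := H (rev (letters t u0)); rewrite /= !sem_fock_sandwich //.
have -> : with_oo (k None) (fun a => (t a).1) = k by apply/funext => -[a|] //=.
have -> : [ffun o => with_oo (x None) u0 o] = x.
  by apply/ffunP => -[a|]; rewrite !ffunE //= ffunE.
have -> : [ffun o => with_oo (y None) v0 o] = y.
  by apply/ffunP => -[a|]; rewrite !ffunE //= ffunE.
by apply: mulfI; rewrite pnatr_eq0 -lt0n fact_gt0.
Qed.

Lemma same_operator_inj : same_operator R D D' -> D = D'.
Proof.
move=> H; apply/funext => k; apply: op_ext => x y.
have [Q HQ] := sound hU hYB (H (k None) (x None) (y None)).
(* The second component separates the points whatever the parameters are. *)
pose t (a : 'I_n) : pt K := (k (Some a), nat_of_ord a).
apply: (@entry_from_fock k t x y ([seq (q, 0%N) | q <- Q] ++ map t (enum 'I_n))) => //.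
- by move=> a b [_ /val_inj].
- by move=> a; rewrite mem_cat (map_f t) ?mem_enum ?orbT.
move=> W v0; apply: HQ; last exact: sym_fock.
by move=> q qQ; rewrite mem_cat (map_f (fun q => (q, 0%N))).
Qed.

End Entries.

Lemma wop0 (X : Type) (k : X -> pt K) w W : wop R k w (fun=> 0) W = 0.
Proof.
elim: w W => [//|[i x|i x] w IH] W /=; first exact: IH.
by apply: cr0; exact: IH.
Qed.

Lemma wop_anns (X : Type) (k : X -> pt K) w (phi : state) : all (@is_ann K N X) w ->
  exists2 xs, size xs = size w & forall W, wop R k w phi W = phi (xs ++ W).
Proof.
elim: w => [_|[i x|//] w IH] /=; first by exists [::].
move=> /IH[xs sxs E]; exists (rcons xs (i, ev k x)); first by rewrite size_rcons sxs.
by move=> W; rewrite cat_rcons -E.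
Qed.

(** The rightmost p annihilators act first and exhaust a state with fewer than p particles. *)
Lemma semE_ideal Lam p e (phi : state) W : in_ideal p e ->
  (forall W, (p <= size W)%N -> phi W = 0) -> semE R Lam e phi W = 0.
Proof.
move=> He Hphi; rewrite /semE; elim: e He => [|t e IH] /=; first by rewrite big_nil.
move=> /andP[/andP[H1 H2] /IH E]; rewrite big_cons E addr0 /sem big1 // => f _.
rewrite -(cat_take_drop (size (tword t) - p) (tword t)) wop_cat.
rewrite take_rev all_rev in H2.
have [xs sxs Exs] := wop_anns (pts f) phi H2.
have -> : wop R (pts f) (drop (size (tword t) - p) (tword t)) phi = fun=> 0.
  apply/funext => W'; rewrite Exs Hphi // size_cat sxs size_drop subKn //.
  exact: leq_addr.
by rewrite wop0 mulr0.
Qed.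

Lemma semE_cre Lam e l q (phi : state) W :
  semE R Lam (emul e (cre l q)) phi W = semE R Lam e (cr l (q, 0%N) phi) W.
Proof.
rewrite /cre emul_r /semE big_map; apply: eq_bigr => -[X w c] _.
rewrite (sem_rename R _ _ _ _ _ (void_ext_bij X)) map_cat /= -map_comp.
have -> : map (lrename (@void_ext X) \o lrename inl) w = w.
  rewrite -[RHS]map_id; apply: eq_map => l' /=.
  by rewrite lrename_comp lrename_id.
by rewrite /sem /=; apply: eq_bigr => f _; rewrite wop_cat mulr1.
Qed.

Lemma semE_escale Lam c e (phi : state) W :
  semE R Lam (escale c e) phi W = c * semE R Lam e phi W.
Proof.
rewrite /semE big_map mulr_sumr; apply: eq_bigr => t _.
by rewrite /sem mulr_sumr; apply: eq_bigr => f _; rewrite mulrA.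
Qed.

Lemma semE_psum Lam S M (phi : state) W :
  semE R Lam (psum S M) phi W = \sum_(n < M) semE R Lam (S n) phi W.
Proof.
rewrite /semE /psum big_flatten big_map -(big_mkord xpredT (fun n => \sum_(t <- S n) sem
  R Lam t phi W)).
by rewrite /index_iota subn0.
Qed.

Lemma in_ideal_flatten p (ss : seq (expr K N)) :
  in_ideal p (flatten ss) = all (in_ideal p) ss.
Proof. exact: all_flatten. Qed.

Lemma in_ideal_escale p c (e : expr K N) : in_ideal p (escale c e) = in_ideal p e.
Proof. by rewrite /in_ideal /escale all_map; apply: eq_all. Qed.

Lemma in_ideal_emul p t (e : expr K N) : in_ideal p e -> in_ideal p (emul [:: t] e).
Proof.
rewrite emul_l /in_ideal all_map; apply: sub_all => s /andP[H1 H2] /=.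
rewrite size_cat !size_map (leq_trans H1) ?leq_addl //= rev_cat -map_rev take_cat.
rewrite size_map size_rev.
have E w : all (@is_ann K N _) (map (lrename (@inr (tvar t) (tvar s))) w) = all (@is_ann
  K N _) w.
  by rewrite all_map; apply: eq_all => -[].
case: ltnP => [_|ps]; first by rewrite -map_take E.
have -> : p = size (tword s) by apply/eqP; rewrite eqn_leq H1 ps.
rewrite subnn take0 cats0 E; move: H2; rewrite take_oversize // size_rev.
exact: ps.
Qed.

Lemma in_ideal_vertex (T : forall n, coef K N n) koo i j n p :
  (0 < n)%N -> (p <= n)%N -> in_ideal p (vertex T koo i j n).
Proof.
case: n => // n _ pn; rewrite /= in_ideal_escale /sandwich in_ideal_flatten all_map.
apply/allP => u _ /=; rewrite /in_ideal all_map; apply/allP => v _ /=.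
rewrite size_cat size_rev !size_map -enumT size_enum_ord (leq_trans pn) ?leq_addl //=.
rewrite rev_cat take_cat size_rev size_map size_enum_ord.
case: ltnP => [_|np].
  have : all (@is_ann K N 'I_n.+1) (rev [seq Ann (v a) (inr a) | a <- enum 'I_n.+1]).
    by rewrite all_rev all_is_ann.
  rewrite -{1}(cat_take_drop p (rev _)) all_cat => /andP[H _]; exact: H.
have -> : p = n.+1 by apply/eqP; rewrite eqn_leq pn np.
by rewrite subnn take0 cats0 all_rev all_is_ann.
Qed.

Section WellBred.
Variable T : forall n, coef K N n.
Arguments T : clear implicits.
Hypothesis T_cov : forall n, (1 <= n)%N -> covariant R (T n).
Hypothesis T_wb : well_bred R (vertex T).

Lemma vertex_eq n koo i j : (forall m, (1 <= m <= n)%N -> T m = uvertex R (n := m)) ->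
  vertex T koo i j n = vertex (uvertex R) koo i j n.
Proof. by case: n => [//|n] H; rewrite /vertex H //= leqnn. Qed.

(** The series T and the one of U satisfy the same relation. Applied to a well-chosen state, the
    right-hand sides coincide and the left-hand sides can differ at a single order. *)
Lemma well_bred_uvertex n : (1 <= n)%N -> T n = uvertex R (n := n).
Proof.
elim/ltn_ind: n => -[//|m] IH _.
apply/funext => k; apply: op_ext => x y.
(* The numbering is reversed so that the last point has second component 0: its particle is the one
   created by [a^+] at the fixed parameter q, which sits at (q, 0). *)
pose t (a : 'I_m.+1) : pt K := (k (Some a), (m - a)%N).
have tI : injective t.
  move=> a b [_ E]; apply: val_inj => /=.
  have := leq_ord a; have := leq_ord b.
  by move=> bm am; rewrite -(subKn am) E subKn.
pose koo := k None; pose q := k (Some ord_max).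
have tmax : t ord_max = (q, 0%N) by rewrite /t /= subnn.
pose i := x None; pose j := y None; pose l := y (Some ord_max).
pose v0 := [ffun a => y (Some a)] : {ffun 'I_m.+1 -> I}.
pose phi := fock [seq (v0 a, t a) | a <- map (widen_ord (leqnSn m)) (enum 'I_m)].
have phiE : fock (letters t v0) = cr l (q, 0%N) phi.
  rewrite /letters enum_ordSr map_rcons fock_rcons tmax /=; congr cr.
  by rewrite ffunE.
have sphi : sym R phi by exact: sym_fock.
have phi0 W : (m.+1 <= size W)%N -> phi W = 0.
  move=> H; apply: fock_size; rewrite !size_map -enumT size_enum_ord.
  by apply: contraTneq H => ->; rewrite ltnn.
have cphi0 W : (m.+2 <= size W)%N -> cr l (q, 0%N) phi W = 0.
  move=> H; rewrite -phiE; apply: fock_size; rewrite size_map size_enum_ord.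
  by apply: contraTneq H => ->; rewrite ltnn.
have [M1 H1] := T_wb.2 koo q i j l m.+1.
have [M2 H2] := (uvertex_well_bred hU hYB).2 koo q i j l m.+1.
(* Large enough for both relations, and for the order [m.+1] to occur in the partial sums. *)
pose M := (maxn (maxn M1 M2) m.+2).
have [e1 [e1' [I1 I1' Z1]]] := H1 M (leq_trans (leq_maxl _ _) (leq_maxl _ _)).
have [e2 [e2' [I2 I2' Z2]]] := H2 M (leq_trans (leq_maxr _ _) (leq_maxl _ _)).
have [Q1 HQ1] := sound hU hYB Z1.
have [Q2 HQ2] := sound hU hYB Z2.
pose Lam := [seq (q, 0%N) | q <- Q1 ++ Q2] ++ map t (enum 'I_m.+1).
have LQ : contains Lam (Q1 ++ Q2).
  by move=> q' q'Q; rewrite mem_cat (map_f (fun q => (q, 0%N))).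
have [L1 L2] := contains_cat LQ.
apply: (@entry_from_fock _ (T m.+1) (uvertex R (n := m.+1)) _ _ k t x y Lam) => //.
- exact: T_cov.
- exact: uvertex_covariant.
- by move=> a; rewrite mem_cat (map_f t) ?mem_enum ?orbT.
move=> W /=; rewrite -/v0 phiE.
have := HQ1 Lam L1 phi W sphi; have := HQ2 Lam L2 phi W sphi.
have Z e : in_ideal m.+1 e -> semE R Lam e phi W = 0.
  by move=> He; apply: semE_ideal He phi0.
have Zc e : in_ideal m.+2 e -> semE R Lam e (cr l (q, 0%N) phi) W = 0.
  by move=> He; apply: semE_ideal He cphi0.
rewrite !semE_cat !(Z _ I1, Z _ I1', Z _ I2, Z _ I2') !addr0 !semE_psum.
set S2 := (X in _ = X -> _); set S1 := (X in _ -> _ = X -> _).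
(* On the right-hand sides the series acts directly on m particles: orders above m vanish, and the
   others agree by induction. *)
have -> : S1 = S2.
  apply: eq_bigr => -[n nM] _ /=; case: (leqP n m) => nm.
    congr (semE R Lam (flatten _) phi W); apply: eq_allpairs => i' l'.
    by rewrite vertex_eq // => m' /andP[m0 m'n]; apply: IH => //; apply: leq_ltn_trans
      m'n _.
  have n0 : (0 < n)%N by apply: leq_ltn_trans nm.
  have V (T' : forall n, coef K N n) : semE R Lam (flatten
      [seq escale (Rent R koo q i l' i' l) (emul (cre l' q) (vertex T' koo i' j n))
      | i' <- enum I, l' <- enum I]) phi W = 0.
    apply: Z; rewrite in_ideal_flatten all_flatten all_map.
    apply/allP => i' _ /=; rewrite all_map; apply/allP => l' _ /=.
    by rewrite in_ideal_escale; apply: in_ideal_emul; apply: in_ideal_vertex.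
  by rewrite !V.
move=> <- /eqP; rewrite -subr_eq0 -sumrB.
have mM : (m.+1 < M)%N by exact: leq_maxr.
(* On the left-hand sides the series acts after [a^+], on m+1 particles. Lower orders agree by
   induction, higher ones vanish, and order [m.+1] is isolated. *)
rewrite (bigD1 (Ordinal mM)) //= big1 ?addr0; last first.
  move=> [n nM] nm /=; rewrite !semE_cre; case: (ltngtP n m.+1) => H.
  - rewrite vertex_eq ?subrr // => m' /andP[m0 m'n]; apply: IH => //.
    exact: leq_ltn_trans m'n H.
  - rewrite !Zc ?subrr //; apply: in_ideal_vertex => //;
      exact: leq_ltn_trans H.
  by case/eqP: nm; apply: val_inj.
rewrite !semE_cre subr_eq0 => /eqP; rewrite /= !semE_escale.
apply: mulfI; rewrite mulf_neq0 ?invr_eq0 ?pnatr_eq0 -?lt0n ?fact_gt0 //.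
by rewrite expf_neq0 // oppr_eq0 oner_eq0.
Qed.

End WellBred.

Lemma uvertex1 : uvertex R (n := 1) = vertex_coef1 R.
Proof.
apply/funext => k; rewrite /uvertex /somes enum_ordSl /=.
have -> : enum 'I_0 = [::] by apply/size0nil; rewrite size_enum_ord.
rewrite /= /vertex_coef1 !mulmx1; congr (_ - _); exact: mul1mx.
Qed.

End Final.

Theorem theorem3p3 (K : realType) (N : nat) (hN : (1 <= N)%N)
    (R : Rmatrix K N) (hYB : yang_baxter R) (hU : unitarity R)
    (T : forall n : nat, coef K N n)
    (hT : forall n : nat, (1 <= n)%N -> covariant R (T n)) :
  well_bred R (vertex T) <->
  (same_operator R (T 1%N) (vertex_coef1 R) /\
   forall n : nat, (1 <= n)%N ->
     same_operator R (T n.+1) (vertex_coefS R (T n))).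
Proof.
split=> [wb|[H1 HS]].
  have TU := well_bred_uvertex hU hYB hT wb; split=> [|n n1].
    by rewrite TU // uvertex1 => koo i j; exact: zf_refl.
  by rewrite !TU //; exact: uvertex_recursion.
(* The recursion fixes only the operators, but a covariant kernel is determined by its operator, so
   the induction can replace [T n] by U in the next step. *)
have TU n : (1 <= n)%N -> T n = uvertex R (n := n).
  case: n => // n _; elim: n => [|n IH].
    apply: (same_operator_inj hU hYB); [exact: hT|exact: uvertex_covariant|].
    by rewrite uvertex1.
  apply: (same_operator_inj hU hYB); [exact: hT|exact: uvertex_covariant|].
  move=> koo i j; apply: zf_trans (HS n.+1 isT koo i j) _.
  by rewrite IH; apply: zf_sym; exact: uvertex_recursion.
have -> : vertex T = vertex (uvertex R); last exact: uvertex_well_bred.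
apply/funext => koo; apply/funext => i; apply/funext => j; apply/funext => n.
by apply: vertex_eq => m /andP[m0 _]; exact: TU.
Qed.
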